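(* The map $\kappa:\mathcal{M}\longrightarrow\mathcal{T}$, $\kappa(A)=(\mathbf{P}(A),\mathbf{Q}(A))$, is an isomorphism of $\mathfrak{gl}_\infty$-crystals.
   Context: **Lie algebra and weights.** $\mathbb{Z}^\times=\mathbb{Z}\setminus\{0\}$. $\mathfrak{gl}_\infty$ is the Lie algebra of complex $\mathbb{Z}^\times\times\mathbb{Z}^\times$ matrices with finitely many nonzero entries; $E_{ij}$ are the elementary matrices, $\mathfrak{h}=\bigoplus_{i\in\mathbb{Z}^\times}\mathbb{C}E_{ii}$, and $\epsilon_i\in\mathfrak{h}^*$ is given by $\langle\epsilon_i,E_{jj}\rangle=\delta_{ij}$. Simple coroots: $h_0=E_{-1,-1}-E_{11}$, $h_i=E_{ii}-E_{i+1,i+1}$, $h_{-i}=E_{-i-1,-i-1}-E_{-i,-i}$ ($i\ge1$). Simple roots: $\alpha_0=\epsilon_{-1}-\epsilon_1$, $\alpha_i=\epsilon_i-\epsilon_{i+1}$, $\alpha_{-i}=\epsilon_{-i-1}-\epsilon_{-i}$ ($i\ge1$). $\Lambda_0\in\mathfrak{h}^*$ is given by $\langle\Lambda_0,E_{-i,-i}\rangle=-\langle\Lambda_0,E_{ii}\rangle=\frac12$ ($i\geq1$). $P=\bigoplus_{i\in\mathbb{Z}^\times}\mathbb{Z}\epsilon_i\oplus\mathbb{Z}\Lambda_0$. **Crystals.** A $\mathfrak{gl}_\infty$-crystal is a set $B$ with maps $\mathrm{wt}:B\to P$, $\varepsilon_i,\varphi_i:B\to\mathbb{Z}\cup\{-\infty\}$,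 $\widetilde e_i,\widetilde f_i:B\to B\cup\{\mathbf 0\}$ ($i\in\mathbb{Z}$; $\mathbf 0\notin B$ a formal symbol, with $\widetilde e_i\mathbf 0=\widetilde f_i\mathbf 0=\mathbf 0$) such that for $b,b'\in B$: (1) $\varphi_i(b)=\langle\mathrm{wt}(b),h_i\rangle+\varepsilon_i(b)$; (2) if $\widetilde e_ib\in B$, then $\varepsilon_i(\widetilde e_ib)=\varepsilon_i(b)-1$, $\varphi_i(\widetilde e_ib)=\varphi_i(b)+1$, $\mathrm{wt}(\widetilde e_ib)=\mathrm{wt}(b)+\alpha_i$; (3) if $\widetilde f_ib\in B$, then $\varepsilon_i(\widetilde f_ib)=\varepsilon_i(b)+1$, $\varphi_i(\widetilde f_ib)=\varphi_i(b)-1$, $\mathrm{wt}(\widetilde f_ib)=\mathrm{wt}(b)-\alpha_i$; (4) $\widetilde f_ib=b'$ iff $b=\widetilde e_ib'$; (5) if $\varphi_i(b)=-\infty$ then $\widetilde e_ib=\widetilde f_ib=\mathbf 0$. $\mathfrak{gl}_{>0}$-crystals (resp. $\mathfrak{gl}_{<0}$-crystals) are defined likewise using only indices $i>0$ (resp. $i<0$). An isomorphism of crystals is a bijection preserving $\mathrm{wt},\varepsilon_i,\varphi_i$ and commuting with all $\widetilde e_i,\widetilde f_i$ (with $\mathbf 0\mapsto\mathbf 0$). Tensor product: $B_1\otimes B_2=\{b_1\otimes b_2\}$ with $\mathrm{wt}(b_1\otimes b_2)=\mathrm{wt}(b_1)+\mathrm{wt}(b_2)$, $\varepsilon_i(b_1\otimes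 b_2)=\max(\varepsilon_i(b_1),\varepsilon_i(b_2)-\langle\mathrm{wt}(b_1),h_i\rangle)$, $\varphi_i(b_1\otimes b_2)=\max(\varphi_i(b_1)+\langle\mathrm{wt}(b_2),h_i\rangle,\varphi_i(b_2))$; $\widetilde e_i(b_1\otimes b_2)$ is $\widetilde e_ib_1\otimes b_2$ if $\varphi_i(b_1)\ge\varepsilon_i(b_2)$ and $b_1\otimes\widetilde e_ib_2$ otherwise; $\widetilde f_i(b_1\otimes b_2)$ is $\widetilde f_ib_1\otimes b_2$ if $\varphi_i(b_1)>\varepsilon_i(b_2)$ and $b_1\otimes\widetilde f_ib_2$ otherwise (where $\mathbf 0\otimes b_2=b_1\otimes\mathbf 0=\mathbf 0$). **Letters and words.** $\mathbf{B}_{>0}=\{1<2<3<\cdots\}$ is the $\mathfrak{gl}_{>0}$-crystal $1\stackrel{1}{\to}2\stackrel{2}{\to}3\to\cdots$ with $\mathrm{wt}(k)=\epsilon_k$; $\mathbf{B}^\vee_{<0}=\{-1^\vee<-2^\vee<-3^\vee<\cdots\}$ is the $\mathfrak{gl}_{<0}$-crystal $-1^\vee\stackrel{-1}{\to}-2^\vee\stackrel{-2}{\to}-3^\vee\to\cdots$ with $\mathrm{wt}(-k^\vee)=-\epsilon_{-k}$. Here $b\stackrel{i}{\to}b'$ means $b'=\widetilde f_ib$, and $\varepsilon_i(b)$ (resp. $\varphi_i(b)$) is the number of $i$-arrows into (resp. out of) $b$. A word $w_1\cdots w_r$ is identified with $w_1\otimes\cdots\otimes w_r$ (the empty word has weight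 $0$, $\varepsilon_i=\varphi_i=0$, and is killed by all operators), making the sets of finite words crystals. **The crystal $\mathcal{M}$.** $\mathcal{M}$ is the set of matrices $A=(a_{-i^\vee,j})_{i,j\ge1}$ with entries in $\mathbb{Z}_{\ge0}$ and finitely many nonzero entries. To $A$ associate two-row words $(\mathbf i,\mathbf j)$ and $(\mathbf k,\mathbf l)$, each containing the pair $(-i^\vee,j)$ exactly $a_{-i^\vee,j}$ times: in $(\mathbf i,\mathbf j)$, $\mathbf i=i_1\cdots i_r$, $\mathbf j=j_1\cdots j_r$, the pairs $(i_m,j_m)$ are sorted so that $j_1\le j_2\le\cdots$ and $i_m\ge i_{m+1}$ whenever $j_m=j_{m+1}$; in $(\mathbf k,\mathbf l)$ the pairs $(k_m,l_m)$ are sorted so that $k_1\le k_2\le\cdots$ and $l_m\ge l_{m+1}$ whenever $k_m=k_{m+1}$. We write $A=A(\mathbf i,\mathbf j)=A(\mathbf k,\mathbf l)$. For $i<0$, $\widetilde e_i,\widetilde f_i$ act on $A$ by acting on $\mathbf i$ and fixing $\mathbf j$ (the result is again correctly sorted or $\mathbf 0$), with $\varepsilon_i(A)=\varepsilon_i(\mathbf i)$, $\varphi_i(A)=\varphi_i(\mathbf i)$; for $i>0$ they act on $\mathbf l$, fixing $\mathbf k$, with $\varepsilon_i(A)=\varepsilon_i(\mathbf l)$, $\varphi_i(A)=\varphi_i(\mathbf l)$. For $i=0$: $\widetilde f_0A=A+E_{-1^\vee,1}$; $\widetilde e_0A=A-E_{-1^\vee,1}$ if $a_{-1^\vee,1}\ne0$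 and $\mathbf 0$ otherwise; $\varepsilon_0(A)=a_{-1^\vee,1}$; $\varphi_0(A)=\langle\mathrm{wt}(A),h_0\rangle+\varepsilon_0(A)$. Finally $\mathrm{wt}(A)=\sum_{i,j\ge1}a_{-i^\vee,j}(-\epsilon_{-i}+\epsilon_j)$. **Tableaux.** $\nu^\pi$ is the $180^\circ$-rotation of the Young diagram of a partition $\nu$ (rows right-justified, $i$-th row from the bottom of length $\nu_i$, columns bottom-aligned). $SST_{\mathcal A}(\nu^\pi)$ is the set of semistandard tableaux of shape $\nu^\pi$ with entries in $\mathcal A$ (rows weakly increasing left to right, columns strictly increasing top to bottom); for $\mathcal A=\mathbf{B}_{>0}$ or $\mathbf{B}^\vee_{<0}$ it is a crystal via the reading word (rows from top to bottom, each row from right to left). **The map $\kappa$.** For a semistandard tableau $T$ of shape $\nu^\pi$ and a letter $a$, $T\leftarrow a$ is obtained as follows: let $a'$ be the largest entry $\le a$ in the rightmost column and replace $a'$ by $a$; if there is no such $a'$, put $a$ on top of that column and stop; otherwise repeat with $a'$ in the next column to the left. For a word, $\mathbf P(w_1\cdots w_r)=(\cdots((w_1\leftarrow w_2)\leftarrow w_3)\cdots)\leftarrow w_r$. For $A=A(\mathbf i,\mathbf j)=A(\mathbf k,\mathbf l)$ put $\mathbf P(A)=\mathbf P(\mathbf i_{\rm rev})$, $\mathbf Q(A)=\mathbf P(\mathbf l_{\rm rev})$, where rev denotes the reversed word. These have the same shape, and $\kappa(A)=(\mathbf P(A),\mathbf Q(A))$ is the (bijective) RSK map onto $\mathcal{T}=\bigsqcup_{\nu}SST_{\mathbf{B}^\vee_{<0}}(\nu^\pi)\times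 SST_{\mathbf{B}_{>0}}(\nu^\pi)$, $\nu$ ranging over all partitions. **The crystal $\mathcal{T}$.** For $(S,T)\in\mathcal{T}$, $\mathrm{wt}(S,T)=\mathrm{wt}(S)+\mathrm{wt}(T)$; operators (and $\varepsilon_i,\varphi_i$) with $i<0$ act through $S$, those with $i>0$ through $T$. For $i=0$: number the columns from right to left $k=1,2,\dots$ (all columns beyond the shape are empty), let $s_k,t_k$ be the smallest entries of the $k$-th columns of $S,T$, and let $\sigma_k=+$ if the $k$-th column is empty or if ($s_k>-1^\vee$ and $t_k>1$), $\sigma_k=-$ if ($s_k=-1^\vee$ and $t_k=1$), and $\sigma_k=\cdot$ otherwise. In $(\ldots,\sigma_2,\sigma_1)$ repeatedly replace pairs $(\sigma_{s'},\sigma_s)=(-,+)$ with $s'>s$ and only dots in between by $(\cdot,\cdot)$, until no $-$ lies to the left of a $+$; the result is the $0$-signature. $\widetilde e_0(S,T)$ removes $-1^\vee$ and $1$ from the columns of $S$ and $T$ at the leftmost $-$ of the $0$-signature ($\mathbf 0$ if there is none); $\widetilde f_0(S,T)$ adds $-1^\vee$ and $1$ on top of the columns of $S$ and $T$ at the rightmost $+$. $\varepsilon_0(S,T)=\max\{k\geq 0:\widetilde e_0^k(S,T)\ne\mathbf 0\}$ and $\varphi_0=\langle\mathrm{wt},h_0\rangle+\varepsilon_0$. *)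

(* Defs.v *)
From HB Require Import structures.
From mathcomp Require Import all_boot all_order all_algebra.
From mathcomp Require Import finmap monalg zify.

Set Implicit Arguments.
Unset Strict Implicit.
Unset Printing Implicit Defensive.
Import Order.TTheory GRing.Theory Num.Theory.

Local Open Scope ring_scope.

Definition Zx := {n : int | n != 0}.

Definition zpos (k : nat) : Zx := exist _ (Posz k.+1) isT. (*    k + 1  *)
Definition zneg (k : nat) : Zx := exist _ (Negz k) isT.    (* - (k + 1) *)

(* The functionals eps_i and Lambda_0 are linearly independent in h^*, so
   the lattice P is free on them: (x, c) stands for \sum_i x_i eps_i + c Lambda_0. *)
Definition weight : zmodType := ({malg int[Zx]} * int)%type.

Definition epsilon (j : Zx) : weight := (<< j >>, 0).
Definition Lambda0 : weight := (0, 1).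

(* The value <lambda, E_jj>; it is a half-integer because of Lambda_0. *)
Definition pairE (lambda : weight) (j : Zx) : rat :=
  (lambda.1@_j)%:~R + (if val j < 0 then 2^-1 else - 2^-1) * lambda.2%:~R.

(* The pair (a, b) such that alpha_i = eps_a - eps_b and h_i = E_aa - E_bb. *)
Definition ends (i : int) : Zx * Zx :=
  match i with
  | Posz 0    => (zneg 0, zpos 0)
  | Posz k.+1 => (zpos k, zpos k.+1)
  | Negz k    => (zneg k.+1, zneg k)
  end.

Definition alpha (i : int) : weight := epsilon (ends i).1 - epsilon (ends i).2.

(* <lambda, h_i>, which is an integer: see pairhE. *)
Definition pairh (lambda : weight) (i : int) : int :=
  lambda.1@_(ends i).1 - lambda.1@_(ends i).2 + (if i == 0 then lambda.2 else 0).

Lemma pairhE (lambda : weight) (i : int) :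
  (pairh lambda i)%:~R = pairE lambda (ends i).1 - pairE lambda (ends i).2.
Proof.
rewrite /pairh /pairE !rmorphD rmorphN /= opprD addrACA; congr (_ + _).
have half2 (x : rat) : x = 2^-1 * x + 2^-1 * x.
  by rewrite -mulrDl -[2^-1]mul1r -mulrDl divff // mul1r.
case: i => [[|k]|k] //=; rewrite ?subrr // mulNr opprK; exact: half2.
Qed.

(* MInf is -oo. *)
Variant zbar := MInf | Fin of int.

Definition zadd (x : zbar) (n : int) : zbar :=
  if x is Fin m then Fin (m + n) else MInf.
Definition zle (x y : zbar) : bool :=
  match x, y with
  | MInf, _ => true
  | Fin _, MInf => false
  | Fin m, Fin n => m <= n
  end.
Definition zlt (x y : zbar) : bool := ~~ zle y x.
Definition zmax (x y : zbar) : zbar := if zle x y then y else x.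

(* The underlying set of a crystal is {b : csort B | cmem B b}; the formal
   symbol 0 is None. *)
Record precrystal := Precrystal {
  csort :> Type;
  cmem : csort -> Prop;
  wt : csort -> weight;
  eps : int -> csort -> zbar;
  phi : int -> csort -> zbar;
  et : int -> csort -> option csort;
  ft : int -> csort -> option csort
}.

(* Crystal axioms for the indices in J: J is all of int for gl_oo, the
   positive integers for gl_{>0}, the negative ones for gl_{<0}. *)
Record is_crystal (J : pred int) (B : precrystal) : Prop := IsCrystal {
  et_closed : forall i (b b' : B), J i -> cmem b -> et i b = Some b' -> cmem b';
  ft_closed : forall i (b b' : B), J i -> cmem b -> ft i b = Some b' -> cmem b';
  phi_eps : forall i (b : B), J i -> cmem b ->
    phi i b = zadd (eps i b) (pairh (wt b) i);
  et_shift : forall i (b b' : B), J i -> cmem b -> et i b = Some b' ->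
    [/\ eps i b' = zadd (eps i b) (- 1), phi i b' = zadd (phi i b) 1
      & wt b' = wt b + alpha i];
  ft_shift : forall i (b b' : B), J i -> cmem b -> ft i b = Some b' ->
    [/\ eps i b' = zadd (eps i b) 1, phi i b' = zadd (phi i b) (- 1)
      & wt b' = wt b - alpha i];
  ft_et : forall i (b b' : B), J i -> cmem b -> cmem b' ->
    (ft i b = Some b' <-> Some b = et i b');
  phi_MInf : forall i (b : B), J i -> cmem b -> phi i b = MInf ->
    et i b = None /\ ft i b = None
}.

Record crystal_iso (J : pred int) (B1 B2 : precrystal) (f : B1 -> B2) : Prop :=
  CrystalIso {
  iso_source : is_crystal J B1;
  iso_target : is_crystal J B2;
  iso_maps : forall b, cmem b -> cmem (f b);
  iso_inj : forall b b', cmem b -> cmem b' -> f b = f b' -> b = b';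
  iso_surj : forall c, cmem c -> exists2 b, cmem b & f b = c;
  iso_wt : forall b, cmem b -> wt (f b) = wt b;
  iso_eps : forall i b, J i -> cmem b -> eps i (f b) = eps i b;
  iso_phi : forall i b, J i -> cmem b -> phi i (f b) = phi i b;
  iso_et : forall i b, J i -> cmem b -> et i (f b) = omap f (et i b);
  iso_ft : forall i b, J i -> cmem b -> ft i (f b) = omap f (ft i b)
}.

Definition gl_infty : pred int := predT.
Definition gl_pos : pred int := fun i => 0 < i.
Definition gl_neg : pred int := fun i => i < 0.

Definition tensor (B1 B2 : precrystal) : precrystal := {|
  csort := B1 * B2;
  cmem b := cmem b.1 /\ cmem b.2;
  wt b := wt b.1 + wt b.2;
  eps i b := zmax (eps i b.1) (zadd (eps i b.2) (- pairh (wt b.1) i));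
  phi i b := zmax (zadd (phi i b.1) (pairh (wt b.2) i)) (phi i b.2);
  et i b := if zle (eps i b.2) (phi i b.1)
            then omap (fun x => (x, b.2)) (et i b.1)
            else omap (fun x => (b.1, x)) (et i b.2);
  ft i b := if zlt (eps i b.2) (phi i b.1)
            then omap (fun x => (x, b.2)) (ft i b.1)
            else omap (fun x => (b.1, x)) (ft i b.2)
|}.

(* w_1 ... w_r is w_1 (x) (w_2 (x) (...)): see words_consE. *)

Section Words.
Variable B : precrystal.
Implicit Type w : seq B.

Fixpoint word_mem w : Prop := if w is b :: w' then cmem b /\ word_mem w' else True.

Fixpoint word_wt w : weight := if w is b :: w' then wt b + word_wt w' else 0.

Fixpoint word_eps (i : int) w : zbar :=
  if w is b :: w'
  then zmax (eps i b) (zadd (word_eps i w') (- pairh (wt b) i)) else Fin 0.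

Fixpoint word_phi (i : int) w : zbar :=
  if w is b :: w'
  then zmax (zadd (phi i b) (pairh (word_wt w') i)) (word_phi i w') else Fin 0.

Fixpoint word_et (i : int) w : option (seq B) :=
  if w is b :: w' then
    if zle (word_eps i w') (phi i b)
    then omap (fun x => x :: w') (et i b) else omap (cons b) (word_et i w')
  else None.

Fixpoint word_ft (i : int) w : option (seq B) :=
  if w is b :: w' then
    if zlt (word_eps i w') (phi i b)
    then omap (fun x => x :: w') (ft i b) else omap (cons b) (word_ft i w')
  else None.

Definition words : precrystal :=
  Precrystal word_mem word_wt word_eps word_phi word_et word_ft.

Let ucons (p : tensor B words) : words := p.1 :: p.2.

Lemma words_consE (i : int) (b : B) w (bw := (b, w) : tensor B words) :
  [/\ wt (b :: w : words) = wt bw,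
      eps i (b :: w : words) = eps i bw /\ phi i (b :: w : words) = phi i bw,
      et i (b :: w : words) = omap ucons (et i bw)
    & ft i (b :: w : words) = omap ucons (ft i bw)].
Proof.
split=> //=; case: ifP => _.
- by case: (et i b).
- by case: (word_et i w).
- by case: (ft i b).
- by case: (word_ft i w).
Qed.

End Words.

(* A natural number k stands for the letter k + 1 of B_{>0}, and for the letter
   -(k + 1)^v of B^v_{<0}; in both alphabets the order of the letters is then
   the usual order of nat. *)

Definition Bpos_ft (i : int) (k : nat) : option nat :=
  if i == Posz k.+1 then Some k.+1 else None.
Definition Bpos_et (i : int) (k : nat) : option nat :=
  if k is k'.+1 then if i == Posz k then Some k' else None else None.

Definition Bpos : precrystal := {|
  csort := nat;
  cmem _ := True;
  wt k := epsilon (zpos k);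
  eps i k := Fin (Posz (Bpos_et i k : bool));
  phi i k := Fin (Posz (Bpos_ft i k : bool));
  et := Bpos_et;
  ft := Bpos_ft
|}.

Lemma Bpos_crystal : is_crystal gl_pos Bpos.
Proof.
split=> //.
- move=> i k i_gt0 _; case: i i_gt0 => [[|n]|n] // _; rewrite /= /pairh /=.
  rewrite addr0 !mcoeffU -!val_eqE /= !eqz_nat !eqSS /Bpos_ft eqz_nat eqSS.
  rewrite /= [n == k]eq_sym.
  case: k => [|k] /=; rewrite ?eqz_nat ?eqSS; do ?case: eqP => //=; by lia.
- case=> [[|n]|n] // [|k] k' _ _ //=; case: eqP => // -[->] [<-].
  rewrite /Bpos_ft /Bpos_et eqxx.
  have -> : (Posz k.+1 == Posz k.+2) = false by lia.
  split; [|by []|exact/esym/subrKC].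
  by case: k => //= k; case: eqP => //; lia.
- case=> [[|n]|n] // k k' _ _ //=; rewrite /Bpos_ft; case: eqP => // -[->] [<-].
  have -> : (Posz k.+1 == Posz k.+2) = false by lia.
  split; [|by []|by rewrite opprB subrKC].
  rewrite /= eqxx; case: k => //= k; case: eqP => //; lia.
- move=> i k k' _ _ _ /=; rewrite /Bpos_ft /Bpos_et; split.
  + by case: eqP => // -> [<-]; rewrite eqxx.
  + by case: k' => // k'; case: eqP => // -> [->]; rewrite eqxx.
Qed.

Definition Bneg_ft (i : int) (k : nat) : option nat :=
  if i == - Posz k.+1 then Some k.+1 else None.
Definition Bneg_et (i : int) (k : nat) : option nat :=
  if k is k'.+1 then if i == - Posz k then Some k' else None else None.

Definition Bneg : precrystal := {|
  csort := nat;
  cmem _ := True;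
  wt k := - epsilon (zneg k);
  eps i k := Fin (Posz (Bneg_et i k : bool));
  phi i k := Fin (Posz (Bneg_ft i k : bool));
  et := Bneg_et;
  ft := Bneg_ft
|}.

Lemma Bneg_crystal : is_crystal gl_neg Bneg.
Proof.
split=> //.
- move=> i k i_lt0 _; case: i i_lt0 => [n|n] // _; rewrite /= /pairh /=.
  rewrite addr0 !mcoeffN !mcoeffU -!val_eqE /= /Bneg_ft /Bneg_et.
  case: k => [|k] /=; do ?case: eqP => //=; lia.
- case=> // n [|k] k' _ _ //=; case: eqP => // -[->] [<-].
  rewrite /Bneg_ft /Bneg_et eqxx.
  have -> : (Negz k == - Posz k.+2) = false by lia.
  split; [|by []|exact/esym/addKr].
  by case: k => //= k; case: eqP => //; lia.
- case=> // n k k' _ _ //=; rewrite /Bneg_ft; case: eqP => // -[->] [<-].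
  have -> : (Negz k == - Posz k.+2) = false by lia.
  split; [|by []|by rewrite opprB addKr].
  rewrite /= eqxx; case: k => //= k; case: eqP => //; lia.
- move=> i k k' _ _ _ /=; rewrite /Bneg_ft /Bneg_et; split.
  + by case: eqP => // -> [<-]; rewrite eqxx.
  + by case: k' => // k'; case: eqP => // -> [->]; rewrite eqxx.
Qed.

(* A (i, j) is the entry of A at the position (-(i + 1)^v, j + 1). *)
Definition mat := {fsfun nat * nat -> nat with 0%N}.

Definition pairs (A : mat) : seq (nat * nat) :=
  flatten [seq nseq (A p) p | p <- enum_fset (finsupp A)].

Definition ij_le (p q : nat * nat) : bool :=
  (p.2 < q.2)%N || (p.2 == q.2) && (q.1 <= p.1)%N.
Definition kl_le (p q : nat * nat) : bool :=
  (p.1 < q.1)%N || (p.1 == q.1) && (q.2 <= p.2)%N.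

Definition word_i (A : mat) : seq nat := unzip1 (sort ij_le (pairs A)).
Definition word_j (A : mat) : seq nat := unzip2 (sort ij_le (pairs A)).
Definition word_k (A : mat) : seq nat := unzip1 (sort kl_le (pairs A)).
Definition word_l (A : mat) : seq nat := unzip2 (sort kl_le (pairs A)).

(* A(u, v): the matrix counting the occurrences of each pair in (u, v). *)
Definition mat_of (u v : seq nat) : mat :=
  [fsfun p in [fset p in zip u v]%fset => count_mem p (zip u v) | 0%N].

Lemma mat_ofE (u v : seq nat) p : mat_of u v p = count_mem p (zip u v).
Proof. by rewrite fsfunE inE /=; case: ifPn => // /count_memPn ->. Qed.

Definition mat_wt (A : mat) : weight :=
  \sum_(p <- enum_fset (finsupp A))
    (- epsilon (zneg p.1) + epsilon (zpos p.2)) *+ A p.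

Definition mat_eps (i : int) (A : mat) : zbar :=
  if i < 0 then eps i (word_i A : words Bneg)
  else if 0 < i then eps i (word_l A : words Bpos)
  else Fin (Posz (A (0, 0)%N)).

Definition mat_phi (i : int) (A : mat) : zbar :=
  if i < 0 then phi i (word_i A : words Bneg)
  else if 0 < i then phi i (word_l A : words Bpos)
  else zadd (mat_eps 0 A) (pairh (mat_wt A) 0).

Definition mat_et (i : int) (A : mat) : option mat :=
  if i < 0 then omap (fun u => mat_of u (word_j A)) (et i (word_i A : words Bneg))
  else if 0 < i then omap (mat_of (word_k A)) (et i (word_l A : words Bpos))
  else if A (0, 0)%N == 0%N then None
  else Some [fsfun A with (0, 0)%N |-> (A (0, 0)%N).-1].

Definition mat_ft (i : int) (A : mat) : option mat :=
  if i < 0 then omap (fun u => mat_of u (word_j A)) (ft i (word_i A : words Bneg))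
  else if 0 < i then omap (mat_of (word_k A)) (ft i (word_l A : words Bpos))
  else Some [fsfun A with (0, 0)%N |-> (A (0, 0)%N).+1].

Definition crysM : precrystal :=
  Precrystal (fun _ : mat => True) mat_wt mat_eps mat_phi mat_et mat_ft.

(* The list of the columns, from right to left, each column being listed
   from top to bottom; columns are bottom-aligned. *)
Definition tableau (X : Type) := seq (seq X).

Definition is_partition (nu : seq nat) : bool := sorted geq nu && (0%N \notin nu).

(* The column lengths of nu^pi, from right to left: its i-th row from the bottom
   has length nu_i, so its k-th column from the right has one cell for each part
   of nu that is at least k. *)
Definition conj_part (nu : seq nat) : seq nat :=
  [seq count (fun p => k < p)%N nu | k <- iota 0 (head 0%N nu)].

(* The rows are numbered by h = 0, 1, ... from the bottom. *)
Definition is_sst (nu : seq nat) (T : tableau nat) : Prop :=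
  [/\ shape T = conj_part nu,
      all (sorted ltn) T
    & forall k h, (k.+1 < size T)%N -> (h < size (nth [::] T k.+1))%N ->
        (nth 0%N (rev (nth [::] T k.+1)) h <= nth 0%N (rev (nth [::] T k)) h)%N].

Section Reading.
Variable X : Type.
Implicit Type T : tableau X.

(* The rows of T from top to bottom, each from right to left. *)
Definition rows T : seq (seq X) :=
  [seq pmap (fun c => onth (rev c) h) T | h <- rev (iota 0 (size (head [::] T)))].

Definition reading T : seq X := flatten (rows T).

(* The filling of the shape of T whose reading word is w; see unreadingK. *)
Definition unreading T (w : seq X) : tableau X :=
  let rs := reshape (shape (rows T)) w in
  [seq pmap (fun r => onth r k) rs | k <- iota 0 (size T)].

Lemma shape_rows T T' : shape T = shape T' -> shape (rows T) = shape (rows T').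
Proof.
move=> eqT.
have size_row h T1 :
    size (pmap (fun c : seq X => onth (rev c) h) T1) = count (ltn h) (shape T1).
  rewrite size_pmap count_map; apply: eq_count => c /=.
  by rewrite onthTE size_rev.
have ht : size (head [::] T) = size (head [::] T').
  by case: T T' eqT => [|? ?] [|? ?] //= [].
rewrite /rows ht /shape -!map_comp; apply: eq_map => h /=.
by rewrite !size_row eqT.
Qed.

Lemma unreadingK T T' : sorted geq (shape T') -> shape T = shape T' ->
  unreading T (reading T') = T'.
Proof.
move=> sT eqT; rewrite /unreading (shape_rows eqT) flattenK.
have geq_trans : transitive geq by move=> m n p nm mp; apply: leq_trans nm.
have onth_row h k T1 : sorted geq (shape T1) ->
    onth (pmap (fun c => onth (rev c) h) T1) k = onth (rev (nth [::] T1 k)) h.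
  elim: T1 k => [|c T1 IH] k /= sT1.
    by rewrite nth_nil onth0n /rev /= onth0n.
  have {}IH := IH ^~ (path_sorted sT1).
  case E: (onth (rev c) h) => [x|] /=; first by case: k => [|k] /=.
  have c_le : (size c <= h)%N by rewrite -size_rev -onthNE E.
  have none (d : seq X) : size d \in shape T1 -> onth (rev d) h = None.
    move=> dT1; apply: onth_default; rewrite size_rev; apply: leq_trans c_le.
    exact: (allP (order_path_min geq_trans sT1)).
  have tail j : onth (pmap (fun c => onth (rev c) h) T1) j = None.
    rewrite IH; case: (ltnP j (size T1)) => j_lt.
      by apply: none; rewrite -(nth_map _ 0%N) // mem_nth ?size_map.
    by rewrite nth_default // onth0n.
  by case: k => [|k]; rewrite tail /= ?E -?IH ?tail.
have pmap_col (c : seq X) n : (size c <= n)%N ->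
    pmap (fun h => onth (rev c) h) (rev (iota 0 n)) = c.
  move=> c_le; elim: n c c_le => [|n IH] c c_le.
    by move: c_le; rewrite leqn0 => /nilP->.
  rewrite -addn1 iotaD rev_cat /= add0n.
  case: (ltnP n (size c)) => [n_lt|c_le']; last first.
    by rewrite onth_default ?size_rev //=; apply: IH.
  case: c c_le n_lt => // x c; rewrite /= !ltnS => c_le n_le.
  have sz : size c = n by apply/eqP; rewrite eqn_leq c_le.
  rewrite rev_cons -cats1 onth_cat size_rev sz ltnn subnn /=; congr cons.
  rewrite -[RHS](IH c) ?sz //; apply: eq_in_pmap => h.
  by rewrite mem_rev mem_iota onth_cat size_rev sz => /= ->.
have szT : size T = size T' by rewrite -(size_map size T) -/(shape T) eqT size_map.
rewrite szT; apply: (@eq_from_nth _ [::]); first by rewrite size_map size_iota.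
move=> k; rewrite size_map size_iota => k_lt.
rewrite (nth_map 0%N) ?size_iota // nth_iota // add0n /rows.
have -> (f : nat -> seq X) s :
    pmap (fun r => onth r k) [seq f h | h <- s] = pmap (fun h => onth (f h) k) s.
  by elim: s => //= h s ->.
rewrite (eq_pmap (fun h => onth_row h k T' sT)); apply: pmap_col.
case: (T') sT k k_lt {szT eqT} => // c T1 /= sT1 [|k] //= k_lt.
have /allP := order_path_min geq_trans sT1; apply.
by rewrite -(nth_map _ 0%N) ?mem_nth ?size_map.
Qed.

End Reading.

Section TableauCrystal.
Variable B : precrystal.

Definition tab_wt (T : tableau B) : weight := wt (reading T : words B).
Definition tab_eps i (T : tableau B) : zbar := eps i (reading T : words B).
Definition tab_phi i (T : tableau B) : zbar := phi i (reading T : words B).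
Definition tab_et i (T : tableau B) : option (tableau B) :=
  omap (unreading T) (et i (reading T : words B)).
Definition tab_ft i (T : tableau B) : option (tableau B) :=
  omap (unreading T) (ft i (reading T : words B)).

End TableauCrystal.

(* T <- a: the recursion moves from the rightmost column to the left. *)
Fixpoint insert (T : tableau nat) (a : nat) : tableau nat :=
  if T is c :: T' then
    let below := [seq x <- c | x <= a]%N in
    if below is [::] then (a :: c) :: T'
    else let a' := foldr maxn 0%N below in
         [seq if x == a' then a else x | x <- c] :: insert T' a'
  else [:: [:: a]].

Definition Ptab (w : seq nat) : tableau nat := foldl insert [::] w.

Definition kappa (A : mat) : tableau nat * tableau nat :=
  (Ptab (rev (word_i A)), Ptab (rev (word_l A))).

Definition bitableau := (tableau nat * tableau nat)%type.

Definition in_T (b : bitableau) : Prop :=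
  exists nu, [/\ is_partition nu, is_sst nu b.1 & is_sst nu b.2].

Variant sign := Plus | Minus | Dot.
Definition is_plus (s : sign) : bool := if s is Plus then true else false.
Definition is_minus (s : sign) : bool := if s is Minus then true else false.

(* The sign of a column; its smallest entry is the top one. *)
Definition col_sign (s t : seq nat) : sign :=
  match s, t with
  | x :: _, y :: _ =>
    if (0 < x)%N && (0 < y)%N then Plus
    else if (x == 0%N) && (y == 0%N) then Minus else Dot
  | _, _ => Plus
  end.

(* The list sigma_1, sigma_2, ..., sigma_(n+1), where n is the number of
   columns, so that it is read from right to left in the displayed sequence
   (..., sigma_2, sigma_1). All further signs are +; having no - to their left,
   these are never cancelled, and they are never the rightmost + since neither
   is sigma_(n+1) ever cancelled. *)
Definition signature (b : bitableau) : seq sign :=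
  [seq col_sign (nth [::] b.1 k) (nth [::] b.2 k) | k <- iota 0 (size b.1).+1].

(* One replacement of a pair (-, +) separated by dots by (., .); because of
   the reversed order, the pair occurs in the list as Plus, dots, Minus. *)
Fixpoint close_plus (s : seq sign) : option (seq sign) :=
  match s with
  | Dot :: s' => omap (cons Dot) (close_plus s')
  | Minus :: s' => Some (Dot :: s')
  | _ => None
  end.

Fixpoint cancel1 (s : seq sign) : seq sign :=
  match s with
  | Plus :: s' => if close_plus s' is Some s'' then Dot :: s''
                  else Plus :: cancel1 s'
  | x :: s' => x :: cancel1 s'
  | [::] => [::]
  end.

(* Replacements are exhausted after size s steps: see cancel1_signature0. *)
Definition signature0 (b : bitableau) : seq sign :=
  iter (size (signature b)) cancel1 (signature b).

Lemma cancel1_fix s : cancel1 s = s \/ (count is_plus (cancel1 s) < count is_plus s)%N.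
Proof.
have close_count s1 s' : close_plus s1 = Some s' -> count is_plus s' = count is_plus s1.
  by elim: s1 s' => //= -[] // s1 IH s'; [case=> <- | case: close_plus IH => //= t /(_ t erefl) <- [<-]].
elim: s => [|x s IH] /=; first by left.
case: x => /=; last 2 first.
- by case: IH => [->|]; [left | right].
- by case: IH => [->|]; [left | right].
case E: close_plus => [t|] /=; first by right; rewrite (close_count _ _ E).
by case: IH => [->|]; [left | right].
Qed.

Lemma cancel1_signature0 b : cancel1 (signature0 b) = signature0 b.
Proof.
rewrite /signature0; move: (signature b) => s; have := count_size is_plus s.
move: (size s) => n; elim: n s => [|n IH] s n_le.
  by case: (cancel1_fix s) => // /leq_trans/(_ n_le).
rewrite iterSr; case: (cancel1_fix s) => [s_fix|lt_s].
  have fixn m : iter m cancel1 s = s by elim: m => //= m ->.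
  by rewrite s_fix fixn.
by apply: IH; rewrite -ltnS; apply: leq_trans n_le.
Qed.

(* Modification of the k-th column; columns that become empty disappear. *)
Definition upd_col (g : seq nat -> seq nat) (k : nat) (T : tableau nat) :=
  [seq c <- set_nth [::] T k (g (nth [::] T k)) | c != [::]].

Definition bitab_e0 (b : bitableau) : option bitableau :=
  let s := signature0 b in
  if has is_minus s then
    let k := ((size s).-1 - find is_minus (rev s))%N in
    Some (upd_col behead k b.1, upd_col behead k b.2)
  else None.

Definition bitab_f0 (b : bitableau) : option bitableau :=
  let s := signature0 b in
  if has is_plus s then
    let k := find is_plus s in
    Some (upd_col (cons 0%N) k b.1, upd_col (cons 0%N) k b.2)
  else None.

Definition bitab_e0n (k : nat) (b : bitableau) : option bitableau :=
  iter k (obind bitab_e0) (Some b).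

Lemma signature0_minus b k :
  is_minus (nth Dot (signature0 b) k) -> (0 < size (nth [::] b.1 k))%N.
Proof.
have close_nth s1 s' j : close_plus s1 = Some s' ->
    is_minus (nth Dot s' j) -> is_minus (nth Dot s1 j).
  elim: s1 s' j => //= -[] // s1 IH s' j; first by case=> <-; case: j.
  by case E: close_plus => //= [t] [<-]; case: j => //= j; apply: IH.
have cancel_nth s j : is_minus (nth Dot (cancel1 s) j) -> is_minus (nth Dot s j).
  elim: s j => //= -[] s IH j /=; try by case: j => //= j; apply: IH.
  case E: close_plus => [t|] /=; case: j => //= j.
  exact: close_nth E.
have iter_nth n s : is_minus (nth Dot (iter n cancel1 s) k) -> is_minus (nth Dot s k).
  by elim: n => //= n IH /cancel_nth/IH.
rewrite /signature0 => /iter_nth.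
case: (ltnP k (size b.1).+1) => k_lt; last by rewrite nth_default ?size_map ?size_iota.
rewrite /signature (nth_map 0%N) ?size_iota // nth_iota // add0n.
by case: (nth [::] b.1 k).
Qed.

Lemma bitab_e0_size b b' :
  bitab_e0 b = Some b' -> (size (flatten b'.1) < size (flatten b.1))%N.
Proof.
rewrite /bitab_e0; case: ifP => // has_m [<-] /=.
set k := (_ - _)%N; have {has_m} : is_minus (nth Dot (signature0 b) k).
  move: (signature0 b) has_m @k => s has_s k.
  have find_lt : (find is_minus (rev s) < size s)%N.
    by rewrite -(size_rev s) -has_find has_rev.
  have := @nth_find _ Dot is_minus (rev s); rewrite has_rev => /(_ has_s).
  by rewrite nth_rev // subnS predn_sub.
move/signature0_minus; move: k b.1 => k T; rewrite /upd_col.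
have flat_filter (s : seq (seq nat)) : flatten [seq c <- s | c != [::]] = flatten s.
  by elim: s => //= c s; case: eqP => /= [->|_] ->.
rewrite flat_filter; elim: T k => [|c T IH] [|k] //=.
  by case: c => //= x c _; rewrite !size_cat ltnSn.
by move=> /IH; rewrite !size_cat ltn_add2l.
Qed.

Lemma bitab_e0n_lt k b : isSome (bitab_e0n k b) -> (k < (size (flatten b.1)).+1)%N.
Proof.
suff le b' : bitab_e0n k b = Some b' -> (k + size (flatten b'.1) <= size (flatten b.1))%N.
  by case E: bitab_e0n => [b'|] // _; rewrite ltnS; apply: leq_trans (leq_addr _ _) (le _ E).
elim: k b' => [|k IH] b' /=; first by case=> <-.
rewrite /bitab_e0n /= -/(bitab_e0n k b); case E: bitab_e0n IH => [b1|] //= /(_ _ erefl) b1_le.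
by move=> /bitab_e0_size b'_lt; rewrite addSnnS; apply: leq_trans b1_le; rewrite leq_add2l.
Qed.

(* max {k | e_0^k b <> 0}; the bound on k is no restriction: see bitab_e0n_lt. *)
Definition bitab_eps0 (b : bitableau) : nat :=
  (\max_(k < (size (flatten b.1)).+1 | isSome (bitab_e0n k b)) k)%N.

Definition bitab_wt (b : bitableau) : weight :=
  @tab_wt Bneg b.1 + @tab_wt Bpos b.2.

Definition bitab_eps (i : int) (b : bitableau) : zbar :=
  if i < 0 then @tab_eps Bneg i b.1
  else if 0 < i then @tab_eps Bpos i b.2
  else Fin (Posz (bitab_eps0 b)).

Definition bitab_phi (i : int) (b : bitableau) : zbar :=
  if i < 0 then @tab_phi Bneg i b.1
  else if 0 < i then @tab_phi Bpos i b.2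
  else zadd (bitab_eps 0 b) (pairh (bitab_wt b) 0).

Definition bitab_et (i : int) (b : bitableau) : option bitableau :=
  if i < 0 then omap (fun S => (S, b.2)) (@tab_et Bneg i b.1)
  else if 0 < i then omap (fun T => (b.1, T)) (@tab_et Bpos i b.2)
  else bitab_e0 b.

Definition bitab_ft (i : int) (b : bitableau) : option bitableau :=
  if i < 0 then omap (fun S => (S, b.2)) (@tab_ft Bneg i b.1)
  else if 0 < i then omap (fun T => (b.1, T)) (@tab_ft Bpos i b.2)
  else bitab_f0 b.

Definition crysT : precrystal :=
  Precrystal in_T bitab_wt bitab_eps bitab_phi bitab_et bitab_ft.

(* Main.v *)
(* Insertion is a cascade: each column turns the word it receives into the word of
   the letters bumped out of it, which is the input of the next column.

   For i <> 0, bumping one letter out of one column commutes with f_i, so P carries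
   f_i on words to f_i on tableaux read by columns; the latter agrees with f_i on row
   readings because a row reading, inserted, gives back its tableau, and because f_i
   turns row readings into row readings. The other tableau does not change: it is
   determined by the shapes of the P-tableaux of the suffixes of the word, and f_i acts
   on a suffix either trivially or as f_i.

   Let sh(p, q) be the shape of P(A) for the rows >= p and the columns >= q of A. Column
   by column from right to left, sh(p, q) is obtained from sh(p+1, q+1), sh(p, q+1),
   sh(p+1, q) and a carry which starts as the entry (p, q). This rule is symmetric in
   sh(p, q+1) and sh(p+1, q), whence P(A) and Q(A) have the same shape, and invertible,
   whence kappa is bijective. At p = q = 0 it is the 0-signature: a + raises the carry
   and a - consumes it, unless the carry is 0, which gives an uncancelled +. Adding 1
   to the entry (0, 0) turns the first such + into a -. *)

From HB Require Import structures.
From mathcomp Require Import all_boot all_order all_algebra.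
From mathcomp Require Import finmap monalg zify.
Require Import Defs.

Set Implicit Arguments.
Unset Strict Implicit.
Unset Printing Implicit Defensive.
Import GRing.Theory.

(** * Column insertion *)

(** A strictly increasing column is determined by the numbers of its letters at least [p], for all
    [p]. Deleting the letters below [p] commutes with insertion, so such a number is the height of
    the same column for the restricted word. Hence P(A) amounts to the chain of shapes sh(p, 0) and
    Q(A), the P-tableau of the transposed matrix, to the chain sh(0, q); equalities of tableaux
    become equalities of heights.

    In the encoding by naturals both alphabets carry the same operators, so the positive indices
    follow from the negative ones by transposition. Only the f_i are followed through insertion: e_i
    is recovered as their inverse, and eps_i, which insertion preserves, tells when it vanishes. The
    obstacle there is that operators on tableaux refill a shape with a modified row reading, whereas
    insertion builds columns. The crystal axioms are checked for matrices only and carried to pairs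
    of tableaux by the bijection. *)

Definition colins (c : seq nat) (a : nat) : seq nat :=
  let below := [seq x <- c | x <= a] in
  if below is [::] then a :: c
  else [seq if x == foldr maxn 0 below then a else x | x <- c].

(** A word of length 0 or 1 rather than an option: the letters bumped by successive insertions are
    simply concatenated into the input of the next column. *)
Definition colbump (c : seq nat) (a : nat) : seq nat :=
  let below := [seq x <- c | x <= a] in
  if below is [::] then [::] else [:: foldr maxn 0 below].

Definition colres (c u : seq nat) : seq nat := foldl colins c u.

Fixpoint colout (c u : seq nat) : seq nat :=
  if u is a :: u' then colbump c a ++ colout (colins c a) u' else [::].

(** Column [k] of the tableau comes from inserting [iter k bump w] into an empty column; the
    recursion over tableaux is thereby replaced by an induction on [k]. *)
Definition bump (w : seq nat) : seq nat := colout [::] w.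
Definition Pcol (k : nat) (w : seq nat) : seq nat := colres [::] (iter k bump w).

Lemma colins_top c a : all (ltn a) c -> colins c a = a :: c /\ colbump c a = [::].
Proof.
move=> /allP c_gt; rewrite /colins /colbump.
suff -> : [seq x <- c | x <= a] = [::] by [].
apply/nilP; rewrite /nilp size_filter -leqn0 leqNgt -has_count.
by apply/hasPn => x /c_gt /=; rewrite -ltnNge.
Qed.

Lemma colins_bump c1 m c2 a :
  all (ltn^~ m) c1 -> m <= a -> all (ltn a) c2 ->
  colins (c1 ++ m :: c2) a = c1 ++ a :: c2 /\ colbump (c1 ++ m :: c2) a = [:: m].
Proof.
move=> /allP c1_lt m_le /allP c2_gt.
have belowE : [seq x <- c1 ++ m :: c2 | x <= a] = rcons c1 m.
  rewrite filter_cat /= m_le -cats1; congr (_ ++ _ :: _).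
    by apply/all_filterP/allP => x /c1_lt /=; lia.
  apply/nilP; rewrite /nilp size_filter -leqn0 leqNgt -has_count.
  by apply/hasPn => x /c2_gt /=; lia.
have maxE : foldr maxn 0 (rcons c1 m) = m.
  elim: c1 c1_lt {belowE} => [|x c1 IH] c1_lt /=; first by rewrite maxn0.
  rewrite IH => [|z z_in]; last by apply: c1_lt; rewrite inE z_in orbT.
  by apply/maxn_idPr; have := c1_lt x (mem_head _ _) => /=; lia.
rewrite /colins /colbump belowE maxE.
have {belowE maxE} -> T (f g : T) : (if rcons c1 m is [::] then f else g) = g by case: (c1).
split; last by case: (c1).
have mapE : [seq if x == m then a else x | x <- c1 ++ m :: c2] = c1 ++ a :: c2.
  rewrite map_cat /= eqxx; congr (_ ++ _ :: _); rewrite -[RHS]map_id; apply/eq_in_map.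
    by move=> x /c1_lt /=; case: eqP => // ->; lia.
  by move=> x /c2_gt /=; case: eqP => // ->; lia.
exact: mapE.
Qed.

Variant colins_spec (c : seq nat) (a : nat) : seq nat -> seq nat -> Prop :=
| ColinsTop of all (ltn a) c : colins_spec c a (a :: c) [::]
| ColinsBump c1 m c2 of c = c1 ++ m :: c2 & all (ltn^~ m) c1 & m <= a & all (ltn a) c2 :
    colins_spec c a (c1 ++ a :: c2) [:: m].

Lemma colinsP c a : sorted ltn c -> colins_spec c a (colins c a) (colbump c a).
Proof.
move=> c_inc; have [c_gt|] := boolP (all (ltn a) c).
  by have [-> ->] := colins_top c_gt; constructor.
move=> c_le.
suff [c1 [m [c2 [-> c1_lt m_le c2_gt]]]] : exists c1 m c2,
    [/\ c = c1 ++ m :: c2, all (ltn^~ m) c1, m <= a & all (ltn a) c2].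
  by have [-> ->] := colins_bump c1_lt m_le c2_gt; econstructor.
elim: c c_inc c_le => //= x c IH x_c.
have c_gt_x := order_path_min ltn_trans x_c.
have [c_gt|/(IH (path_sorted x_c))[c1 [m [c2 [cE c1_lt m_le c2_gt]]]] _] := boolP (all (ltn a) c).
  case: ltnP => // x_le _; exists [::], x, c; by rewrite /= x_le.
exists (x :: c1), m, c2; rewrite cE /= c1_lt m_le c2_gt; split=> //; rewrite andbT.
by move/allP: c_gt_x => /(_ m) /=; apply; rewrite cE mem_cat mem_head orbT.
Qed.

Lemma sorted_ltn_cat c1 m c2 :
  sorted ltn (c1 ++ m :: c2) = [&& sorted ltn c1, all (ltn^~ m) c1, all (ltn m) c2 & sorted ltn c2].
Proof.
rewrite !(sorted_pairwise ltn_trans) pairwise_cat /= allrel_consr.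
have [/allP c1_lt|_] /= := boolP (all (ltn^~ m) c1); last by rewrite andbF.
have [/allP c2_gt|_] /= := boolP (all (ltn m) c2); last by rewrite !andbF.
have -> : allrel ltn c1 c2.
  apply/allrelP => y z /c1_lt /= ym /c2_gt /=; exact: ltn_trans.
by rewrite /=.
Qed.

Lemma sorted_colins c a : sorted ltn c -> sorted ltn (colins c a).
Proof.
move=> c_inc; case: (colinsP a c_inc) => [c_gt|c1 m c2 cE c1_lt m_le c2_gt] /=.
  by rewrite path_sortedE ?c_gt //; exact: ltn_trans.
move: c_inc; rewrite cE !sorted_ltn_cat => /and4P[-> _ _ ->]; rewrite c2_gt !andbT.
by apply/allP => x /(allP c1_lt) /=; lia.
Qed.

Lemma sorted_colres c u : sorted ltn c -> sorted ltn (colres c u).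
Proof. by elim: u c => //= a u IH c /(sorted_colins a)/IH. Qed.

Lemma colres_cat c u v : colres c (u ++ v) = colres (colres c u) v.
Proof. exact: foldl_cat. Qed.

Lemma colout_cat c u v : colout c (u ++ v) = colout c u ++ colout (colres c u) v.
Proof. by elim: u c => //= a u IH c; rewrite IH catA. Qed.

Lemma sorted_Pcol k w : sorted ltn (Pcol k w).
Proof. exact: sorted_colres. Qed.

Lemma PcolS k w : Pcol k.+1 w = Pcol k (bump w).
Proof. by rewrite /Pcol iterSr. Qed.

(** If [a < p], only letters below [p] are touched. If [p <= a] but the replaced letter is below
    [p], the restricted column sees [a] arrive on top. *)
Lemma filter_colins p c a : sorted ltn c ->
  [seq x <- colins c a | p <= x] =
    if p <= a then colins [seq x <- c | p <= x] a else [seq x <- c | p <= x].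
Proof.
move=> c_inc; case: (colinsP a c_inc) => [c_gt|c1 m c2 cE c1_lt m_le c2_gt] /=.
  case: ifP => // _; symmetry; apply: (colins_top _).1.
  by apply/allP => x; rewrite mem_filter => /andP[_ /(allP c_gt)].
rewrite cE !filter_cat /=; case: (leqP p a) => pa; last by rewrite leqNgt (leq_trans _ pa).
have f_gt : all (ltn a) [seq x <- c2 | p <= x].
  by apply/allP => x; rewrite mem_filter => /andP[_ /(allP c2_gt)].
case: (leqP p m) => pm.
  rewrite (colins_bump _ m_le f_gt).1 //.
  by apply/allP => x; rewrite mem_filter => /andP[_ /(allP c1_lt)].
suff -> : [seq x <- c1 | p <= x] = [::] by rewrite (colins_top f_gt).1.
apply/nilP; rewrite /nilp size_filter -leqn0 leqNgt -has_count.
by apply/hasPn => x /(allP c1_lt) /=; lia.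
Qed.

Lemma filter_colbump p c a : sorted ltn c ->
  [seq x <- colbump c a | p <= x] =
    if p <= a then colbump [seq x <- c | p <= x] a else [::].
Proof.
move=> c_inc; case: (colinsP a c_inc) => [c_gt|c1 m c2 cE c1_lt m_le c2_gt] /=.
  case: ifP => // _; symmetry; apply: (colins_top _).2.
  by apply/allP => x; rewrite mem_filter => /andP[_ /(allP c_gt)].
rewrite cE !filter_cat /=; case: (leqP p a) => pa; last by rewrite leqNgt (leq_trans _ pa).
have f_gt : all (ltn a) [seq x <- c2 | p <= x].
  by apply/allP => x; rewrite mem_filter => /andP[_ /(allP c2_gt)].
case: (leqP p m) => pm.
  rewrite (colins_bump _ m_le f_gt).2 //.
  by apply/allP => x; rewrite mem_filter => /andP[_ /(allP c1_lt)].
suff -> : [seq x <- c1 | p <= x] = [::] by rewrite (colins_top f_gt).2.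
apply/nilP; rewrite /nilp size_filter -leqn0 leqNgt -has_count.
by apply/hasPn => x /(allP c1_lt) /=; lia.
Qed.

Lemma filter_colres p c u : sorted ltn c ->
  [seq x <- colres c u | p <= x] = colres [seq x <- c | p <= x] [seq x <- u | p <= x].
Proof.
elim: u c => //= a u IH c c_inc; rewrite IH ?sorted_colins // filter_colins //.
by case: ifP.
Qed.

Lemma filter_colout p c u : sorted ltn c ->
  [seq x <- colout c u | p <= x] = colout [seq x <- c | p <= x] [seq x <- u | p <= x].
Proof.
elim: u c => //= a u IH c c_inc; rewrite filter_cat IH ?sorted_colins //.
by rewrite filter_colins // filter_colbump //; case: ifP.
Qed.

Lemma filter_bump p w : [seq x <- bump w | p <= x] = bump [seq x <- w | p <= x].
Proof. exact: filter_colout. Qed.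

Lemma filter_Pcol p k w : [seq x <- Pcol k w | p <= x] = Pcol k [seq x <- w | p <= x].
Proof.
by elim: k w => [|k IH] w; [exact: filter_colres | rewrite !PcolS IH filter_bump].
Qed.

(** * Insertion tableaux as a cascade of columns *)

Lemma insert_cons c T a : insert (c :: T) a = colins c a :: foldl insert T (colbump c a).
Proof. by rewrite /= /colins /colbump; case: [seq x <- c | x <= a]. Qed.

Lemma behead_insert T a :
  behead (insert T a) = foldl insert (behead T) (colbump (head [::] T) a).
Proof. by case: T => [|c T] //; rewrite insert_cons. Qed.

Lemma head_insert T a : head [::] (insert T a) = colins (head [::] T) a.
Proof. by case: T => [|c T] //; rewrite insert_cons. Qed.

Lemma head_foldl_insert T u : head [::] (foldl insert T u) = colres (head [::] T) u.
Proof. by elim: u T => //= a u IH T; rewrite IH head_insert. Qed.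

Lemma behead_foldl_insert T u :
  behead (foldl insert T u) = foldl insert (behead T) (colout (head [::] T) u).
Proof.
by elim: u T => //= a u IH T; rewrite IH behead_insert head_insert foldl_cat.
Qed.

Lemma nth_Ptab w k : nth [::] (Ptab w) k = Pcol k w.
Proof.
elim: k w => [|k IH] w; first by rewrite nth0 head_foldl_insert.
by rewrite PcolS -IH -nth_behead behead_foldl_insert.
Qed.

Lemma colins_nil c a : colins c a != [::].
Proof. by rewrite /colins; case: c => // x c /=; case: ifP; case: [seq _ <- _ | _]. Qed.

Lemma Ptab_nil w : [::] \notin Ptab w.
Proof.
rewrite /Ptab; have : [::] \notin ([::] : tableau nat) by [].
elim: w ([::] : tableau nat) => //= a w IH T T0; apply: IH.
elim: T a T0 => [//|c T IH] a; rewrite insert_cons !inE !negb_or => /andP[_ T0].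
rewrite eq_sym colins_nil /= /colbump; case: [seq x <- c | x <= a] => //= *; exact: IH.
Qed.

(** A default value absent from both lists makes their lengths visible to [nth]. It is the empty
    column for tableaux and 0 for lists of row or column lengths. *)
Lemma eq_nth_notin (X : eqType) (x0 : X) (s s' : seq X) : x0 \notin s -> x0 \notin s' ->
  nth x0 s =1 nth x0 s' -> s = s'.
Proof.
move=> s0 s0' eqs; suff le (s1 s2 : seq X) : x0 \notin s1 ->
    nth x0 s1 =1 nth x0 s2 -> size s1 <= size s2.
  apply: (@eq_from_nth _ x0) => [|i _]; last exact: eqs.
  by apply/eqP; rewrite eqn_leq !le.
move=> s1_0 eqs12; rewrite leqNgt; apply/negP => lt.
by move: (mem_nth x0 lt); rewrite eqs12 nth_default // (negPf s1_0).
Qed.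

Lemma size_Ptab w k : (k < size (Ptab w)) = (0 < size (Pcol k w)).
Proof.
rewrite -nth_Ptab; case: ltnP => [lt|le]; last by rewrite nth_default.
by have := mem_nth [::] lt; case: nth => // mem; move: (Ptab_nil w); rewrite mem.
Qed.

Lemma perm_colins c a : sorted ltn c -> perm_eq (colins c a ++ colbump c a) (a :: c).
Proof.
move=> c_inc; case: (colinsP a c_inc) => [_|c1 m c2 -> _ _ _]; first by rewrite cats0.
by apply/permP => P; rewrite /= !(count_cat, size_cat) /=; lia.
Qed.

Lemma strict_insert T a : all (sorted ltn) T -> all (sorted ltn) (insert T a).
Proof.
elim: T a => [//|c T IH] a; rewrite insert_cons /= => /andP[c_inc T_inc].
rewrite sorted_colins //=; case: (colinsP a c_inc) => //= *; exact: IH.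
Qed.

Lemma strict_Ptab w : all (sorted ltn) (Ptab w).
Proof.
rewrite /Ptab; have : all (sorted ltn) ([::] : tableau nat) by [].
by elim: w ([::] : tableau nat) => //= a w IH T /(strict_insert a)/IH.
Qed.

Lemma perm_Ptab w : perm_eq (flatten (Ptab w)) w.
Proof.
suff gen T : all (sorted ltn) T -> perm_eq (flatten (foldl insert T w)) (w ++ flatten T).
  by rewrite -[X in perm_eq _ X]cats0; exact: gen.
elim: w T => //= a w IH T T_inc; apply: perm_trans (IH _ (strict_insert a T_inc)) _.
have ins : perm_eq (flatten (insert T a)) (a :: flatten T).
  elim: T a T_inc {IH} => [//|c T IH] a; rewrite insert_cons /= => /andP[c_inc T_inc].
  have := perm_colins a c_inc; case: (colinsP a c_inc) => [_|c1 m c2 _ _ _ _] /= pc.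
    by rewrite cats0 in pc; rewrite -cat_cons perm_cat2r.
  move/permP: pc => pc; apply/permP => P; move/permP/(_ P): (IH m T_inc).
  by move: (pc P); rewrite /= !count_cat /= ?count_cat /=; lia.
by apply/permP => P; move/permP/(_ P): ins; rewrite /= !count_cat /=; lia.
Qed.

Lemma count_leqS x (c : seq nat) : count (leq x) c = count_mem x c + count (leq x.+1) c.
Proof. by elim: c => //= y c ->; lia. Qed.

Lemma eq_strict_col c d : sorted ltn c -> sorted ltn d ->
  (forall v, count (leq v) c = count (leq v) d) -> c = d.
Proof.
move=> c_inc d_inc eq_cd; apply: (irr_sorted_eq ltn_trans ltnn c_inc d_inc) => x.
rewrite -!has_pred1 !has_count.
by have := eq_cd x; rewrite !(count_leqS x) eq_cd => /addIn ->.
Qed.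

Lemma lt_count_leq c v h : sorted ltn c ->
  (h < count (leq v) c) = (h < size c) && (v <= nth 0 (rev c) h).
Proof.
rewrite -rev_sorted -(count_rev _ c) -(size_rev c).
elim: (rev c) h => //= x e IH h x_e; have e_lt := order_path_min (rev_trans ltn_trans) x_e.
have {}IH := IH ^~ (path_sorted x_e).
case: (leqP v x) => vx /=; first by case: h => [|h] //=; rewrite add1n !ltnS IH.
have nth_lt j : j < size e -> nth 0 e j < v.
  by move=> lt; apply: leq_ltn_trans vx; apply/ltnW/(allP e_lt)/mem_nth.
have -> : count (leq v) e = 0.
  apply/eqP; rewrite -leqn0 leqNgt -has_count; apply/hasPn => y /(allP e_lt) /=; lia.
case: h => [|h] /=; first by lia.
by rewrite ltnS; case: (ltnP h (size e)) => //= h_lt; have := nth_lt _ h_lt; lia.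
Qed.

(** Turns the comparison of two columns along the rows into inequalities between heights for
    restricted words, the form in which insertion can be controlled. *)
Lemma count_leq_col c d : sorted ltn c -> sorted ltn d ->
  (forall v, count (leq v) d <= count (leq v) c) <->
  size d <= size c /\ (forall h, h < size d -> nth 0 (rev d) h <= nth 0 (rev c) h).
Proof.
move=> c_inc d_inc; split=> [le_dc|[size_le le_dc] v].
  split=> [|h h_lt]; first by have := le_dc 0; rewrite !(@eq_count _ (leq 0) predT) ?count_predT.
  have := lt_count_leq (nth 0 (rev d) h) h d_inc; rewrite h_lt leqnn => h_lt'.
  by have := leq_trans h_lt' (le_dc _); rewrite lt_count_leq // => /andP[].
case E: (count (leq v) d) => [//|h].
have := lt_count_leq v h d_inc; rewrite E ltnSn => /esym/andP[h_lt v_le].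
by rewrite lt_count_leq // (leq_trans h_lt size_le) (leq_trans v_le) ?le_dc.
Qed.

Lemma count_Pcol p k w : count (leq p) (Pcol k w) = size (Pcol k [seq x <- w | p <= x]).
Proof. by rewrite -filter_Pcol size_filter. Qed.

(* If inserting a letter lengthens the second column but not the first, then the
   bumped letter m lies below the second column, whose height therefore only
   depends on the letters greater than m. *)
Lemma size_PcolS k w : size (Pcol k.+1 w) <= size (Pcol k w).
Proof.
elim: k w => [|k IHk] w; last by rewrite PcolS [in leqRHS]PcolS.
have [n] := ubnP (size w); elim: n w => // n IHn; case/lastP => // w a.
rewrite size_rcons ltnS => w_lt.
have {}IHn q : size (Pcol 1 [seq x <- w | q <= x]) <= size (Pcol 0 [seq x <- w | q <= x]).
  by apply: IHn; apply: leq_ltn_trans w_lt; rewrite size_filter count_size.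
have := IHn 0; rewrite !(@eq_filter _ (leq 0) predT) ?filter_predT // => IH0.
rewrite PcolS /bump -cats1 /Pcol /= colout_cat !colres_cat /=.
rewrite -[colout [::] w]/(bump w) -[colres [::] (bump w)]/(Pcol 0 (bump w)) -PcolS.
rewrite -[colres [::] w]/(Pcol 0 w).
case: (colinsP a (sorted_Pcol 0 w)) => [_|c1 m c2 cE c1_lt m_le c2_gt] /=.
  exact: leqW.
have -> : size (c1 ++ a :: c2) = size (Pcol 0 w) by rewrite cE !size_cat.
case: (colinsP m (sorted_Pcol 1 w)) => [d_gt|d1 x d2 dE _ _ _] /=; last first.
  by move: IH0; rewrite dE !size_cat.
rewrite -[size (Pcol 1 w)](@count_predT) -(@eq_in_count _ (leq m.+1)); last first.
  by move=> y /(allP d_gt).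
rewrite count_Pcol; apply: leq_ltn_trans (IHn _) _; rewrite -count_Pcol.
by rewrite -count_predT cE !count_cat /= ltnn /= !count_predT; have := count_size (leq m.+1) c1;
   have := count_size (leq m.+1) c2; lia.
Qed.

Lemma count_PcolS v k w : count (leq v) (Pcol k.+1 w) <= count (leq v) (Pcol k w).
Proof. by rewrite !count_Pcol size_PcolS. Qed.

Lemma Pcol_nil k w : size w <= k -> Pcol k w = [::].
Proof.
move=> w_le; apply/nilP; rewrite /nilp -leqn0 leqNgt -size_Ptab -leqNgt.
apply: leq_trans w_le; rewrite -(perm_size (perm_Ptab w)).
elim: (Ptab w) (Ptab_nil w) => //= c T IH; rewrite inE negb_or size_cat => /andP[c0 /IH].
by case: c c0 => //= x c _; lia.
Qed.

Arguments insert : simpl never.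

(** * Crystal operators and insertion *)

Section Letters.
Variable n : nat.

(* Words under the operators of index n.+1 over Bpos, or Negz n over Bneg: in the encoding
   by naturals these are the same operators, changing the letters n and n.+1. *)
Fixpoint weps (w : seq nat) : nat :=
  if w is b :: w' then
    if b == n then (weps w').-1 else if b == n.+1 then (weps w').+1 else weps w'
  else 0.

Fixpoint wft (w : seq nat) : option (seq nat) :=
  if w is b :: w' then
    if (b == n) && (weps w' == 0) then Some (n.+1 :: w') else omap (cons b) (wft w')
  else None.

(** [weps w' <= (b == n)] is the test eps <= phi of the tensor product rule: when it holds the
    operator falls on [b], and gives 0 unless [b] is [n.+1], the case treated just before. *)
Fixpoint wet (w : seq nat) : option (seq nat) :=
  if w is b :: w' then
    if (b == n.+1) && (weps w' == 0) then Some (n :: w')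
    else if weps w' <= (b == n) then None else omap (cons b) (wet w')
  else None.

Definition raise (c : seq nat) : seq nat := [seq if x == n then n.+1 else x | x <- c].

(* f_i on a tableau read by columns, from right to left and each from top to bottom. *)
Fixpoint tft (T : tableau nat) : option (tableau nat) :=
  if T is c :: T' then
    if [&& n \in c, n.+1 \notin c & weps (flatten T') == 0] then Some (raise c :: T')
    else omap (cons c) (tft T')
  else None.

Lemma raise_id c : n \notin c -> raise c = c.
Proof.
move=> nc; rewrite /raise -[RHS]map_id; apply/eq_in_map => x xc.
by case: eqP => // xn; rewrite xn (negPf nc) in xc *.
Qed.

(** If both letters occur in a strict column, [n] comes right before [n.+1] and the two cancel; only
    a lone one counts. *)
Lemma weps_col c s : sorted ltn c ->
  weps (c ++ s) = if n \in c then (if n.+1 \in c then weps s else (weps s).-1)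
                  else weps s + (n.+1 \in c).
Proof.
elim: c => [|x c IH] /= x_c; first by rewrite addn0.
have c_gt := order_path_min ltn_trans x_c; have {}IH := IH (path_sorted x_c).
have notin y : y <= x -> y \notin c.
  by move=> yx; apply/negP => /(allP c_gt) /=; rewrite ltnNge yx.
rewrite !inE ![_ == x]eq_sym; have [xn|xn] := eqVneq x n.
  by subst x; rewrite IH (negPf (notin n _)) // (ltn_eqF (ltnSn n)); case: (n.+1 \in c) => /=; lia.
have [xn'|xn'] := eqVneq x n.+1; last by rewrite IH.
by subst x; rewrite IH !(negPf (notin _ _)) //=; lia.
Qed.

Lemma sorted_raise c : n.+1 \notin c -> sorted ltn c -> sorted ltn (raise c).
Proof.
move=> nc; apply: (homo_sorted_in (P := mem c)); last exact/allP.
move=> x y xc yc /= xy; do 2!case: eqP => //; try by lia.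
by move=> _ xn; have : y != n.+1; [apply: contraNneq nc => <- | lia].
Qed.

Lemma strict_tft T T' : all (sorted ltn) T -> tft T = Some T' ->
  all (sorted ltn) T' /\ shape T' = shape T.
Proof.
elim: T T' => //= c T IH T' /andP[c_inc T_inc]; case: ifP => [/and3P[_ nc _]|_].
  by case=> <- /=; rewrite sorted_raise ?T_inc //= size_map.
by case: tft IH => //= T1 /(_ _ T_inc erefl)[T1_inc eq_sh] [<-] /=; rewrite c_inc T1_inc eq_sh.
Qed.

(** All that matters is where [n] and [n.+1] lie with respect to the inserted letter [b] and the
    bumped letter [m], which leaves finitely many cases. *)
Lemma weps_insert T b : all (sorted ltn) T -> weps (flatten (insert T b)) = weps (b :: flatten T).
Proof.
elim: T b => [//|c T IH] b /= /andP[c_inc T_inc]; rewrite insert_cons /=.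
have := sorted_colins b c_inc.
case: (colinsP b c_inc) => [b_lt|c1 m c2 cE c1_lt m_le c2_gt] ins_inc; first by [].
rewrite -[foldl _ _ _]/(insert T m).
have [/(_ n) n1 /(_ n.+1) n1'] := (allP c1_lt, allP c1_lt).
have [/(_ n) n2 /(_ n.+1) n2'] := (allP c2_gt, allP c2_gt).
rewrite !weps_col // IH //= cE !mem_cat !inE; move: n1 n1' n2 n2' => /=.
rewrite ![_ == m]eq_sym ![_ == b]eq_sym;
case: (n \in c1) => [/(_ isT) ?|_]; case: (n.+1 \in c1) => [/(_ isT) ?|_];
case: (n \in c2) => [/(_ isT) ?|_]; case: (n.+1 \in c2) => [/(_ isT) ?|_];
try (exfalso; lia); have [?|?] := eqVneq m n; have [?|?] := eqVneq m n.+1;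
have [?|?] := eqVneq b n; have [?|?] := eqVneq b n.+1; rewrite /=; lia.
Qed.
Lemma insert_top c T b : all (ltn b) c -> insert (c :: T) b = (b :: c) :: T.
Proof. by rewrite insert_cons => /colins_top[-> ->]. Qed.

Lemma insert_bump c1 m c2 T b : all (ltn^~ m) c1 -> m <= b -> all (ltn b) c2 ->
  insert ((c1 ++ m :: c2) :: T) b = (c1 ++ b :: c2) :: insert T m.
Proof. by rewrite insert_cons => c1_lt m_le /(colins_bump c1_lt m_le)[-> ->]. Qed.

Lemma raise_gt a c : all (ltn a) c -> all (ltn a) (raise c).
Proof. by move=> /allP c_gt; apply/allP => _ /mapP[x /c_gt /= ax ->]; case: eqP; lia. Qed.

Lemma raise_lt m c : all (ltn^~ m) c -> (n \in c -> n.+1 < m) -> all (ltn^~ m) (raise c).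
Proof.
move=> /allP c_lt n_lt; apply/allP => _ /mapP[x xc ->] /=; case: eqP => [xn|_].
  by apply: n_lt; rewrite -xn.
exact: c_lt.
Qed.

Lemma all_gtS c : all (ltn n) c -> n.+1 \notin c -> all (ltn n.+1) c.
Proof.
move=> /allP c_gt nc; apply/allP => x xc; have := c_gt x xc => /=.
by have : x != n.+1; [apply: contraNneq nc => <- | lia].
Qed.

Lemma raise_cat c1 x c2 :
  raise (c1 ++ x :: c2) = raise c1 ++ (if x == n then n.+1 else x) :: raise c2.
Proof. by rewrite /raise map_cat. Qed.

(** Since insertion preserves [weps], the tests of [tft] before and after the bump depend on the
    same number [weps (flatten T)] and on the places of [n] and [n.+1] among [b], [m] and the
    column. The cases in which the operator acts further left on both sides are closed by [insF]. *)
Lemma tft_insert T b : all (sorted ltn) T ->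
  tft (insert T b) = if (b == n) && (weps (flatten T) == 0) then Some (insert T n.+1)
                     else omap (insert^~ b) (tft T).
Proof.
elim: T b => [|c T IH] b.
  rewrite /insert /= !inE ![_ == b]eq_sym eqxx !andbT; have [->|//] := eqVneq b n.
  by rewrite (ltn_eqF (ltnSn n)).
move=> /= /andP[c_inc T_inc].
rewrite weps_col // insert_cons.
case: (colinsP b c_inc) => [b_lt|c1 m c2 cE c1_lt m_le c2_gt].
  rewrite /=; have /(_ n) cn := allP b_lt; have /(_ n.+1) cn' := allP b_lt.
  rewrite !inE ![_ == b]eq_sym; have [bn|bn] := eqVneq b n.
    subst b; move: cn => /=; case: (n \in c) => [/(_ isT)|_]; first by lia.
    rewrite /= (ltn_eqF (ltnSn n)) /=; case n'c: (n.+1 \in c) => /=.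
      by rewrite addn1 /=; case: (tft T) => //= T1; rewrite insert_top.
    rewrite addn0; case: eqP => _ /=; last first.
      by case: (tft T) => //= T1; rewrite insert_top.
        by rewrite insert_top ?all_gtS ?n'c //= raise_id //;
       apply/negP => /(allP b_lt) /=; lia.
  have [bn'|bn'] /= := eqVneq b n.+1.
    subst b; move: cn cn' => /=; case: (n \in c) => [/(_ isT)|_]; first by lia.
    case: (n.+1 \in c) => [/(_ isT)|_] /=; first by lia.
    by case: (tft T) => //= T1; rewrite insert_top.
  case: ifP => _ /=; last first.
    by case: (tft T) => //= T1; rewrite insert_top.
  by rewrite insert_top ?raise_gt // /raise /= (negPf bn).
rewrite -[foldl _ _ _]/(insert T m) /= weps_insert // IH //= cE !raise_cat !mem_cat !inE.
have insE T1 : insert ((c1 ++ m :: c2) :: T1) b = (c1 ++ b :: c2) :: insert T1 m.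
  exact: insert_bump.
have insF (o : option (tableau nat)) :
    omap (cons (c1 ++ b :: c2)) (omap (insert^~ m) o) =
    omap (insert^~ b) (omap (cons (c1 ++ m :: c2)) o).
  by case: o => //= T1; congr Some; rewrite -insE.
have [/(_ n) n1 /(_ n.+1) n1'] := (allP c1_lt, allP c1_lt).
have [/(_ n) n2 /(_ n.+1) n2'] := (allP c2_gt, allP c2_gt).
have rlt := raise_lt c1_lt; have rgt := raise_gt c2_gt.
have gtS := @all_gtS c2.
have c2S : n.+1 \in c2 -> m = n -> exists c2', c2 = n.+1 :: c2' /\ all (ltn n.+1) c2'.
  move=> n'c2 mn; move: c_inc; rewrite cE mn sorted_ltn_cat => /and4P[_ _ gt_n].
  case: (c2) n'c2 gt_n => // z c2' n'c2 /= /andP[nz _] z_c2'.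
  have c2'_gt := order_path_min ltn_trans z_c2'.
  move: n'c2; rewrite inE => /orP[/eqP zE|/(allP c2'_gt) /=]; last by rewrite ltnS leqNgt nz.
  by exists c2'; rewrite zE.
move: n1 n1' n2 n2' rlt gtS c2S (@raise_id c1) (@raise_id c2) => /=.
rewrite ![_ == m]eq_sym ![_ == b]eq_sym;
case: (n \in c1) => [/(_ isT) ?|_]; case: (n.+1 \in c1) => [/(_ isT) ?|_];
case: (n \in c2) => [/(_ isT) ?|_]; case: (n.+1 \in c2) => [/(_ isT) ?|_];
try (exfalso; lia);
have [mn|mn] := eqVneq m n; have [mn'|mn'] := eqVneq m n.+1;
have [bn|bn] := eqVneq b n; have [bn'|bn'] := eqVneq b n.+1;
try (exfalso; lia); rewrite /= ?addn0 ?addn1 /=; move=> rlt gtS c2S r1 r2.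
all: try exact: insF.
- case: ifP => _; last exact: insF.
  by rewrite /= insert_bump //; apply: rlt => _; lia.
- case: ifP => _; last exact: insF.
  by rewrite /= r1 // insert_bump.
(* Inserting [n] puts [n] in place of itself and bumps [n]; inserting [n.+1] does the same with the
   [n.+1] just below. The column is unchanged both times, and the raised letter is handed on to the
   next column. *)
- subst m b; case: ifP => _; last exact: insF.
  have [//|//|c2' [-> c2'_gt]] := c2S.
  rewrite /= -cat_rcons (@insert_bump (rcons c1 n)) ?cat_rcons //.
  by rewrite all_rcons /= ltnSn /=; apply: sub_all c1_lt => x /=; lia.
- subst m b; rewrite r1 // r2 //.
  case: (weps (flatten T)) => [|[|e]] /=; last exact: insF.
    by rewrite insert_bump ?gtS.
  by rewrite insert_bump ?gtS.
- subst m b; case: ifP => _; last exact: insF.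
  by rewrite r1 // r2 //= insert_bump //;
    first [by apply: sub_all c1_lt => x /=; lia | lia].
- subst m; case: ifP => _; last exact: insF.
  by rewrite r1 // r2 //= insert_bump //;
    first [by apply: sub_all c1_lt => x /=; lia | lia].
- subst b; case: ifP => _; last exact: insF.
  by rewrite r1 // r2 // insert_bump ?gtS //; lia.
Qed.

Lemma Ptab_rev_cons b w : Ptab (rev (b :: w)) = insert (Ptab (rev w)) b.
Proof. by rewrite rev_cons /Ptab foldl_rcons. Qed.

Lemma weps_Ptab w : weps (flatten (Ptab (rev w))) = weps w.
Proof.
elim: w => //= b w IH; rewrite Ptab_rev_cons weps_insert ?strict_Ptab //=.
by rewrite IH.
Qed.

Lemma tft_Ptab w : tft (Ptab (rev w)) = omap (fun v => Ptab (rev v)) (wft w).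
Proof.
elim: w => //= b w IH; rewrite Ptab_rev_cons tft_insert ?strict_Ptab //.
rewrite weps_Ptab IH; case: ifP => _ /=; first by rewrite Ptab_rev_cons.
by case: (wft w) => //= v; rewrite Ptab_rev_cons.
Qed.

Lemma wft_wet w v : wft w = Some v -> wet v = Some w /\ weps v = (weps w).+1.
Proof.
elim: w v => //= b w IH v; case: ifP => [/andP[/eqP -> /eqP w0] [<-]|].
  by rewrite /= w0 !eqxx (gtn_eqF (ltnSn n)).
case: (wft w) IH => //= v' /(_ _ erefl)[wetE wepsE] b_w [<-] /=.
rewrite wepsE wetE andbF; move: b_w.
by have [->|_] := eqVneq b n; case: (weps w) => //= e; case: ifP.
Qed.

Lemma wet_wft w v : wet w = Some v -> wft v = Some w.
Proof.
elim: w v => //= b w IH v; case: ifP => [/andP[/eqP -> /eqP w0] [<-]|b_w].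
  by rewrite /= w0 !eqxx.
case: ifP => // w_gt; case E: (wet w) IH => [v'|] //= /(_ _ erefl) ftE [<-] /=.
have [_ wE] := wft_wet ftE; rewrite ftE; move: w_gt; rewrite wE.
by have [->|_] := eqVneq b n; case: (weps v').
Qed.

Lemma wet_None w : (wet w == None) = (weps w == 0).
Proof.
elim: w => //= b w IH; have [->|bn] := eqVneq b n.
  rewrite (ltn_eqF (ltnSn n)) /=; case: (weps w) IH => [|[|e]] //=.
  by case: (wet w).
case: (weps w) IH => [|e] /=; first by case: (b == n.+1).
by rewrite andbF; case: (wet w) => //= v; case: (b == n.+1).
Qed.

Lemma size_wft w v : wft w = Some v -> size v = size w.
Proof.
elim: w v => //= b w IH v; case: ifP => [_ [<-] //|_].
by case: (wft w) IH => //= v' /(_ _ erefl) <- [<-].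
Qed.

Lemma drop_wft t w v : wft w = Some v -> drop t v = drop t w \/ wft (drop t w) = Some (drop t v).
Proof.
elim: w v t => //= b w IH v [|t] /=; first by rewrite drop0 => ->; right.
case: ifP => [_ [<-] /=|_]; first by left.
by case: (wft w) IH => //= v' IH [<-] /=; apply: IH.
Qed.

Lemma shape_Ptab_wft w v : wft w = Some v -> shape (Ptab (rev v)) = shape (Ptab (rev w)).
Proof.
by move=> wE; have := tft_Ptab w; rewrite wE => /(strict_tft (strict_Ptab _))[].
Qed.

(** A letter [n] just before the raised one would itself have passed the test, so there is none;
    this is what keeps a weakly decreasing row weakly decreasing. The default [n.+1] of [last]
    covers an empty [u1]. *)
Lemma wft_catP u s v : wft (u ++ s) = Some v ->
  (exists u1 u2, [/\ u = u1 ++ n :: u2, weps (u2 ++ s) = 0, last n.+1 u1 != n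
                   & v = (u1 ++ n.+1 :: u2) ++ s])
  \/ exists2 s', wft s = Some s' & v = u ++ s'.
Proof.
elim: u v => [|b u IH] v /=; first by right; exists v.
case: ifP => [/andP[/eqP -> /eqP us0] [<-]|b_us].
  by left; exists [::], u; rewrite /= (gtn_eqF (ltnSn n)).
case: (wft _) IH => //= v' /(_ _ erefl)[[u1 [u2 [uE us0 u1_n ->]]]|[s' sE ->]] [<-].
  left; exists (b :: u1), u2; rewrite uE; split=> //=.
  case: u1 uE u1_n => //= uE _; apply: contraFneq b_us => ->.
  by rewrite uE /= eqxx us0.
by right; exists s'.
Qed.

(** An [n] cancels a later [n.+1], and in a weakly decreasing word no [n.+1] comes after an [n]: all
    of them survive. *)
Lemma weps_ge_count h s : sorted geq h -> count_mem n.+1 h <= weps (h ++ s).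
Proof.
elim: h => //= b h IH b_h; have {}IH := IH (path_sorted b_h).
have h_le := order_path_min (rev_trans leq_trans) b_h.
have [bn|bn] := eqVneq b n; last by case: eqP => //=; lia.
subst b; suff -> : count_mem n.+1 h = 0 by rewrite (ltn_eqF (ltnSn n)).
by apply/count_memPn/negP => /(allP h_le) /=; lia.
Qed.

Lemma weps_cat_ge u s : weps s <= weps (u ++ s) + count_mem n u.
Proof.
elim: u => [|b u IH] /=; first by rewrite addn0.
move: IH; set C := count _ u; move: (weps (u ++ s)) => W.
by case: (b == n) => /=; [lia | case: (b == n.+1) => /=; lia].
Qed.

(** Rows are right-justified and listed from right to left, so equal positions lie in the same
    column; [r] is the row directly above [h]. *)
Definition dom (r h : seq nat) : Prop :=
  size r <= size h /\ forall k, k < size r -> nth 0 r k < nth 0 h k.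

Fixpoint rowcond (R : seq (seq nat)) : Prop :=
  if R is r :: R' then
    [/\ sorted geq r, (if R' is h :: _ then dom r h else True) & rowcond R']
  else True.

Lemma dom_raise r h1 h2 : dom r (h1 ++ n :: h2) -> dom r (h1 ++ n.+1 :: h2).
Proof.
case; rewrite !size_cat /= => sz lt; split=> [|k k_lt]; first by rewrite size_cat.
by apply: leq_trans (lt k k_lt) _; rewrite !nth_cat; case: ltnP => // _; case: (k - _).
Qed.

Lemma dom_behead x r y h : dom (x :: r) (y :: h) -> dom r h.
Proof. by case=> sz lt; split=> [|k k_lt]; [exact: sz | exact: (lt k.+1)]. Qed.

(** Below a letter [n] of [r] stands a letter larger than [n] and at most [n.+1]. *)
Lemma count_dom r h : all (leq^~ n) r -> all (leq^~ n.+1) h -> dom r h ->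
  count_mem n r <= count_mem n.+1 h.
Proof.
elim: r h => //= x r IH [|y h] /=; first by move=> _ _ [].
move=> /andP[_ r_le] /andP[y_le h_le] r_h; have := IH h r_le h_le (dom_behead r_h).
by have := r_h.2 0 isT => /=; case: (eqVneq x n) => [->|_]; case: (eqVneq y n.+1) => //=; lia.
Qed.

Lemma sorted_raise_row r1 r2 : sorted geq (r1 ++ n :: r2) -> last n.+1 r1 != n ->
  sorted geq (r1 ++ n.+1 :: r2).
Proof.
have path_n : path geq n r2 -> path geq n.+1 r2.
  by case: (r2) => //= z r3 /andP[zn ->]; rewrite andbT; lia.
case: r1 => [|a r1] /=; first by move=> /path_n.
by rewrite !cat_path /= => /and3P[-> le_n /path_n ->] r1_n; rewrite andbT /=; lia.
Qed.

(* If the entry below the raised letter n were n+1, then every letter n to the left of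
   it would also sit above a letter n+1, and one of these would be left unpaired. *)
Lemma rowcond_wft R v : rowcond R -> wft (flatten R) = Some v ->
  exists R', [/\ v = flatten R', shape R' = shape R, rowcond R'
               & forall r, dom r (head [::] R) -> dom r (head [::] R')].
Proof.
elim: R v => //= r R IH v [r_dec r_dom R_ok] /wft_catP[[r1 [r2 [rE eps0 r1_n ->]]]|]; last first.
  case=> s' sE ->; have [R' [-> shR' R'_ok R'_dom]] := IH _ R_ok sE.
  exists (r :: R'); rewrite /= shR'; split=> //; split=> //.
  by case: (R) (R') shR' R'_dom r_dom => [|h ?] [|h' ?] //= _; apply.
exists ((r1 ++ n.+1 :: r2) :: R); split=> //=; last first.
- by move=> r'; rewrite rE => /dom_raise.
- split=> //; first by apply: sorted_raise_row; rewrite -?rE.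
  case: (R) r_dom eps0 R_ok => // h R' r_h eps0 /= [h_dec _ _].
  have [sz lt] := r_h; move: sz; rewrite rE size_cat /= => sz.
  split=> [|k]; first by rewrite size_cat.
  rewrite size_cat /= => k_lt; have := lt k; rewrite rE size_cat => /(_ k_lt).
  rewrite !nth_cat; case: (ltngtP k (size r1)) => [//|k_gt|k_eq].
    by have -> : k - size r1 = (k - (size r1).+1).+1 by lia.
  rewrite k_eq subnn /= => h_gt; rewrite ltn_neqAle h_gt andbT; apply/negP => /eqP hE.
  have hcat : h = take (size r1) h ++ n.+1 :: drop (size r1).+1 h.
    by rewrite hE -drop_nth ?cat_take_drop //; lia.
  have drop_dom : dom r2 (drop (size r1).+1 h).
    split=> [|j j_lt]; first by rewrite size_drop; lia.
    have nthE : nth 0 (r1 ++ n :: r2) (size r1 + j.+1) = nth 0 r2 j.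
      by rewrite nth_cat ltnNge leq_addr addKn.
    by rewrite nth_drop addSnnS -nthE -rE; apply: lt; rewrite rE size_cat /=; lia.
  have r2_le : all (leq^~ n) r2.
    by move: r_dec; rewrite rE sorted_cat_cons => /andP[_ /(order_path_min (rev_trans leq_trans))].
  have h2_le : all (leq^~ n.+1) (drop (size r1).+1 h).
    move: h_dec; rewrite {1}hcat sorted_cat_cons.
    by case/andP=> _ /(order_path_min (rev_trans leq_trans)).
  have := count_dom r2_le h2_le drop_dom.
  have := weps_cat_ge r2 (h ++ flatten R'); rewrite eps0.
  have := weps_ge_count (flatten R') h_dec; rewrite {1}hcat count_cat /= eqxx.
  move: (count _ r2) (count _ (drop _ _)) (count _ (take _ _)) (weps _) => a b c d; lia.
- by rewrite rE /shape /= !size_cat.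
Qed.

(** The first letter inserted lands on top of [c]; each later one, at least as large but still
    smaller than the letters of [c], bumps its predecessor. So the column keeps only the last letter
    [x] and sends the others on in the same order. *)
Lemma colres_dec_row x r c : sorted geq (x :: r) -> all (ltn x) c ->
  colres c (rev (x :: r)) = x :: c /\ colout c (rev (x :: r)) = rev r.
Proof.
elim: r x => [|y r IH] x /=.
  by move=> _ /colins_top; rewrite /colres /= cats0.
move=> /andP[yx y_r] c_gt; rewrite rev_cons -cats1 colres_cat colout_cat.
have c_gty : all (ltn y) c by apply: sub_all c_gt => z /=; lia.
have [-> ->] := IH y y_r c_gty.
by have /= [-> ->] := @colins_bump [::] y c x isT yx c_gt; rewrite cats0 cats1 -rev_cons.
Qed.

Lemma Pcol_row k w r : sorted geq r ->
  (forall j, j < size r -> all (ltn (nth 0 r j)) (Pcol j w)) ->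
  Pcol k (w ++ rev r) = if k < size r then nth 0 r k :: Pcol k w else Pcol k w.
Proof.
elim: k w r => [|k IH] w [|x r] r_dec r_lt; try by rewrite cats0.
  by rewrite /Pcol /= colres_cat (colres_dec_row r_dec (r_lt 0 isT)).1.
rewrite !PcolS /bump colout_cat (colres_dec_row r_dec (r_lt 0 isT)).2.
rewrite IH ?(path_sorted r_dec) // => j.
by move=> /(r_lt j.+1); rewrite PcolS.
Qed.

(** The rows are inserted from the bottom one up; strictness of the columns makes each row land on
    top of what has been built. *)
Lemma Pcol_rows R k : rowcond R -> Pcol k (rev (flatten R)) = pmap (fun r => onth r k) R.
Proof.
elim: R k => [|r R IH] k /=; first by move=> _; rewrite Pcol_nil.
move=> [r_dec r_dom R_ok]; rewrite rev_cat Pcol_row // => [|j j_lt].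
  rewrite IH //; case E: (onth r k) => [x|]; first by rewrite -onthTE E (@onth_nth _ 0 _ _ _ E).
  by rewrite -onthTE E.
rewrite ?IH //; case: (R) r_dom R_ok IH => // h R' [sz lt] h_ok IH.
have h_lt : j < size h by apply: leq_trans sz.
have := sorted_Pcol j (rev (flatten (h :: R'))); rewrite IH //=.
case E: (onth h j) => [y|]; last by move: h_lt; rewrite -onthTE E.
move=> /= /(order_path_min ltn_trans) y_lt; have := lt j j_lt.
rewrite (@onth_nth _ 0 _ _ _ E) => jy.
by rewrite /= jy; apply: sub_all y_lt => z; apply: ltn_trans.
Qed.

(** [pmap] skips the rows that are too short; equal shapes ensure that the same rows are skipped on
    both sides. *)
Lemma eq_rows (R R' : seq (seq nat)) : shape R = shape R' ->
  (forall k, pmap (fun r => onth r k) R = pmap (fun r => onth r k) R') -> R = R'.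
Proof.
elim: R R' => [|r R IH] [|r' R'] //= [sz sh] eqk.
have eq_sz k : (onth r k : bool) = (onth r' k) by rewrite !onthTE sz.
congr cons; last first.
  apply: IH => // k; have := eqk k; have := eq_sz k.
  by case: (onth r k) (onth r' k) => [x|] [y|] //= _ [].
apply: eq_from_onth => k; have := eqk k; have := eq_sz k.
by case: (onth r k) (onth r' k) => [x|] [y|] //= _ [->].
Qed.
End Letters.

(** * Semistandard tableaux and their row readings *)

Definition semistandard (T : tableau nat) : Prop :=
  [/\ sorted geq (shape T), [::] \notin T, all (sorted ltn) T
    & forall k h, h < size (nth [::] T k.+1) ->
        nth 0 (rev (nth [::] T k.+1)) h <= nth 0 (rev (nth [::] T k)) h].

Definition row_of (T : tableau nat) h : seq nat := pmap (fun c => onth (rev c) h) T.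

Lemma onth_row_of T h k : sorted geq (shape T) ->
  onth (row_of T h) k = onth (rev (nth [::] T k)) h.
Proof.
rewrite /row_of; elim: T k => [|c T IH] k /= sT.
  by rewrite nth_nil onth0n /rev /= onth0n.
have {}IH := IH ^~ (path_sorted sT).
case E: (onth (rev c) h) => [x|] /=; first by case: k => [|k] /=.
have c_le : size c <= h by rewrite -size_rev -onthNE E.
have none (d : seq nat) : size d \in shape T -> onth (rev d) h = None.
  move=> dT; apply: onth_default; rewrite size_rev; apply: leq_trans c_le.
  exact: (allP (order_path_min (rev_trans leq_trans) sT)).
have tail j : onth (rev (nth [::] T j)) h = None.
  case: (ltnP j (size T)) => j_lt; last by rewrite nth_default // /rev /= onth0n.
  by apply: none; rewrite -(nth_map _ 0) // mem_nth ?size_map.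
by case: k => [|k]; rewrite IH tail /= ?E ?tail.
Qed.

Lemma size_row_of T h : size (row_of T h) = count (ltn h) (shape T).
Proof.
rewrite size_pmap count_map; apply: eq_count => c /=.
by rewrite onthTE size_rev.
Qed.

Lemma lt_size_row_of T h k : sorted geq (shape T) ->
  (k < size (row_of T h)) = (h < size (nth [::] T k)).
Proof. by move=> sT; rewrite -onthTE onth_row_of // onthTE size_rev. Qed.

Lemma nth_row_of T h k : sorted geq (shape T) ->
  nth 0 (row_of T h) k = nth 0 (rev (nth [::] T k)) h.
Proof. by move=> sT; rewrite -odflt_onth onth_row_of // odflt_onth. Qed.

Lemma rev_iotaS H : rev (iota 0 H.+1) = H :: rev (iota 0 H).
Proof. by rewrite -[H.+1]addn1 iotaD rev_cat. Qed.

Lemma rowcond_rows T : semistandard T -> rowcond (rows T).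
Proof.
case=> sT _ T_inc le_row; rewrite /rows; elim: (size _) => [//|H IH].
rewrite rev_iotaS /= -/(row_of T H); split=> //.
  apply/(sortedP 0) => k; rewrite lt_size_row_of // => /le_row.
  by rewrite !nth_row_of.
case: H {IH} => [|H] //; rewrite rev_iotaS /= -/(row_of T H); split.
  by rewrite !size_row_of; apply: sub_count => x /=; lia.
move=> k; rewrite lt_size_row_of // !nth_row_of // => H_lt.
have : sorted gtn (rev (nth [::] T k)).
  rewrite rev_sorted; case: (ltnP k (size T)) => k_lt; last by rewrite nth_default.
  exact/(allP T_inc)/mem_nth.
by move/(sortedP 0)/(_ H); rewrite size_rev; apply.
Qed.

Lemma nth_rows T k : semistandard T -> nth [::] T k = pmap (fun r => onth r k) (rows T).
Proof.
case=> sT T0 T_inc le_row; have := unreadingK sT (erefl (shape T)).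
rewrite /unreading /reading flattenK => TE.
case: (ltnP k (size T)) => k_lt.
  by rewrite -{1}TE (nth_map 0) ?size_iota // nth_iota.
rewrite nth_default //; symmetry; rewrite /rows.
elim: (rev _) => //= h s IH; rewrite -/(row_of T h) onth_row_of // nth_default //.
by rewrite /rev /= onth0n.
Qed.

Lemma Ptab_reading T : semistandard T -> Ptab (rev (reading T)) = T.
Proof.
move=> T_ok; have [_ T0 _ _] := T_ok.
apply: (@eq_nth_notin _ [::]) => // [|k]; first exact: Ptab_nil.
by rewrite nth_Ptab Pcol_rows ?nth_rows //; apply: rowcond_rows.
Qed.

Lemma semistandard_Ptab w : semistandard (Ptab w).
Proof.
split; [|exact: Ptab_nil|exact: strict_Ptab|].
  apply/(sortedP 0) => k _; rewrite /= !nth_shape !nth_Ptab; exact: size_PcolS.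
move=> k h; rewrite !nth_Ptab; move: h.
by have [+ _] := count_leq_col (sorted_Pcol k w) (sorted_Pcol k.+1 w);
   case=> // v; exact: count_PcolS.
Qed.

Lemma tft_reading n T : semistandard T ->
  omap (unreading T) (wft n (reading T)) = tft n T.
Proof.
move=> T_ok; have := tft_Ptab n (reading T); rewrite Ptab_reading // => ->.
case E: wft => [v|] //=; congr Some.
have := shape_Ptab_wft E; rewrite Ptab_reading // => sh_v.
have [R [vE sh R_ok _]] := rowcond_wft (rowcond_rows T_ok) E.
rewrite /unreading -sh vE flattenK -vE.
have sz : size (Ptab (rev v)) = size T by rewrite -(size_map size) -/(shape _) sh_v size_map.
apply: (@eq_from_nth _ [::]) => [|k]; first by rewrite size_map size_iota sz.
rewrite size_map size_iota => k_lt.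
by rewrite (nth_map 0) ?size_iota // nth_iota // nth_Ptab vE Pcol_rows.
Qed.

Lemma wft_reading n T T' : semistandard T -> semistandard T' -> tft n T = Some T' ->
  wft n (reading T) = Some (reading T').
Proof.
move=> T_ok T'_ok TT'; have := tft_Ptab n (reading T); rewrite Ptab_reading // TT'.
case E: wft => [v|] //= [T'E]; congr Some.
have [R [vE sh R_ok _]] := rowcond_wft (rowcond_rows T_ok) E.
rewrite vE /reading; congr flatten; apply: eq_rows => [|k].
  rewrite sh; apply: shape_rows; have [_ _ T_inc _] := T_ok.
  by have [_ ->] := strict_tft T_inc TT'.
by rewrite -nth_rows // T'E nth_Ptab vE Pcol_rows.
Qed.

Lemma weps_reading n w : weps n (reading (Ptab (rev w))) = weps n w.
Proof.
by rewrite -weps_Ptab Ptab_reading ?weps_Ptab //; apply: semistandard_Ptab.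
Qed.

Lemma tft_reading_Ptab n w (T := Ptab (rev w)) :
  omap (unreading T) (wft n (reading T)) = omap (fun v => Ptab (rev v)) (wft n w).
Proof. by rewrite tft_reading ?tft_Ptab //; apply: semistandard_Ptab. Qed.

(** No second case analysis: if [wet] turns [w] into [v], then [wft] turns [v] into [w], and the
    statement for [wft] at [v] is inverted; if it gives 0, then [weps] vanishes on [w], hence on the
    reading. *)
Lemma tet_reading_Ptab n w (T := Ptab (rev w)) :
  omap (unreading T) (wet n (reading T)) = omap (fun v => Ptab (rev v)) (wet n w).
Proof.
case E: (wet n w) => [v|] /=; last first.
  suff /eqP-> : wet n (reading T) == None by [].
  by rewrite wet_None weps_reading -wet_None E.
have ftv := wet_wft E; have tftv := tft_Ptab n v; rewrite ftv /= -/T in tftv.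
have ok_v := semistandard_Ptab (rev v); have ok_w := semistandard_Ptab (rev w).
have [-> _] := wft_wet (wft_reading ok_v ok_w tftv); congr Some.
have [sT _ v_inc _] := ok_v; apply: unreadingK => //.
by have [_ ->] := strict_tft v_inc tftv.
Qed.

(** * Growth diagrams *)

(* r, l, m are the heights of one column in sh(p+1, q+1), sh(p, q+1), sh(p+1, q), and c is
   the carry arriving at that column. *)
Definition carry_step (r l m c : nat) : nat :=
  if (r < l) && (r < m) then c.+1 else if (r < l) || (r < m) then c else c.-1.

Definition local_height (r l m c : nat) : nat := if [|| r < l, r < m | 0 < c] then r.+1 else r.

Fixpoint carry (r l m : nat -> nat) (c k : nat) : nat :=
  if k is k'.+1 then carry_step (r k') (l k') (m k') (carry r l m c k') else c.

Lemma carryS r l m c k : carry r l m c k.+1 =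
  carry (r \o S) (l \o S) (m \o S) (carry_step (r 0) (l 0) (m 0) c) k.
Proof. by elim: k => //= k <-. Qed.

Lemma mem_colins c a : sorted ltn c -> a \in colins c a.
Proof.
by move=> c_inc; case: (colinsP a c_inc) => [_|c1 m c2 _ _ _ _]; rewrite ?mem_cat mem_head ?orbT.
Qed.

(** The entry [a] is available to the next letter [x >= a], which therefore bumps an entry between
    [a] and [x]; then [x] takes over the role of [a]. *)
Lemma leq_path_colout c a b : sorted ltn c -> a \in c -> path leq a b ->
  path leq a (colout c b) /\ size (colres c b) = size c.
Proof.
elim: b c a => [//|x b IH] c a c_inc ac /= /andP[ax x_b].
have := IH _ x (sorted_colins x c_inc) (mem_colins x c_inc) x_b.
case: (colinsP x c_inc) => [c_gt|c1 m c2 cE c1_lt m_le c2_gt] /= [px ->].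
  by have := allP c_gt _ ac => /=; lia.
have am : a <= m.
  move: ac; rewrite cE mem_cat inE => /or3P[/(allP c1_lt)|/eqP->|/(allP c2_gt)] /=; lia.
rewrite cE !size_cat am /=; split=> //.
by case: (colout _ _) px => //= y s /andP[xy ->]; rewrite (leq_trans m_le).
Qed.

Lemma sorted_colout c b : sorted ltn c -> sorted leq b -> sorted leq (colout c b).
Proof.
case: b => //= x b c_inc x_b.
have [] := leq_path_colout (sorted_colins x c_inc) (mem_colins x c_inc) x_b.
case: (colinsP x c_inc) => [_|c1 m c2 _ _ m_le _] /= px _; first exact: path_sorted px.
by case: (colout _ _) px => //= y s /andP[xy ->]; rewrite (leq_trans m_le).
Qed.

Lemma all_colout p c b : sorted ltn c -> all (leq p) c -> all (leq p) b -> all (leq p) (colout c b).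
Proof.
elim: b c => //= x b IH c c_inc c_ge /andP[px b_ge]; rewrite all_cat.
have := IH _ (sorted_colins x c_inc).
case: (colinsP x c_inc) => [_|c1 m c2 cE _ _ _] /=; first by rewrite px c_ge => /(_ isT b_ge) ->.
move: c_ge; rewrite cE !all_cat /= => /and3P[-> -> ->].
by rewrite px => /(_ isT b_ge) ->.
Qed.

Lemma eq_carry r r' l l' m m' c k : r =1 r' -> l =1 l' -> m =1 m' ->
  carry r l m c k = carry r' l' m' c k.
Proof. by move=> rE lE mE; elim: k => //= k ->; rewrite rE lE mE. Qed.

(* Once a letter of a sorted block has been placed, the later ones bump, so a letter p
   smaller than all of them stays on top. *)
Lemma smallest_stays p c a b : sorted ltn (p :: c) -> a \in c -> path leq a b ->
  colres (p :: c) b = p :: colres c b /\ colout (p :: c) b = colout c b.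
Proof.
elim: b c a => [//|x b IH] c a pc_inc ac /= /andP[ax x_b].
have c_inc := path_sorted pc_inc; have c_gt := order_path_min ltn_trans pc_inc.
have ins_inc := sorted_colins x c_inc.
have := IH _ x _ (mem_colins x c_inc) x_b.
case: (colinsP x c_inc) ins_inc => [c_gt'|c1 m c2 cE c1_lt m_le c2_gt] ins_inc.
  by have := allP c_gt' _ ac => /=; lia.
have pm : p < m by apply: (allP c_gt); rewrite cE mem_cat mem_head orbT.
have pc1_lt : all (ltn^~ m) (p :: c1) by rewrite /= pm.
rewrite [in colins (p :: c) x]cE [in colbump (p :: c) x]cE.
have [-> ->] := colins_bump pc1_lt m_le c2_gt.
case=> [|-> ->] //; rewrite /= path_sortedE ?ins_inc ?andbT; last exact: ltn_trans.
by move: c_gt; rewrite cE !all_cat /= => /and3P[-> _ ->]; rewrite (leq_trans pm).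
Qed.

(** Only the first letter of the block can be put on top of [c]; if [p] is there, it bumps [p]
    instead, and afterwards the two columns evolve alike. So [p] leaves exactly when the column
    without [p] grows. *)
Lemma block_below p c b : sorted ltn (p :: c) -> sorted leq b -> all (ltn p) b ->
  [/\ size c <= size (colres c b) <= (size c).+1,
      size (colres (p :: c) b) = (size c).+1
    & colout (p :: c) b = nseq (size (colres c b) - size c) p ++ colout c b].
Proof.
move=> pc_inc; have c_inc := path_sorted pc_inc; have c_gt := order_path_min ltn_trans pc_inc.
case: b => [|x b] /=; first by rewrite subnn leqnn leqnSn.
move=> x_b /andP[px b_gt].
have ins_inc := sorted_colins x c_inc; have x_in := mem_colins x c_inc.
have [_ ->] := leq_path_colout ins_inc x_in x_b.
case: (colinsP x c_inc) ins_inc x_in => [x_lt|c1 m c2 cE c1_lt m_le c2_gt] ins_inc x_in.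
  have := @colins_bump [::] p c x isT (ltnW px) x_lt => /= -[-> ->].
  have [_ ->] := leq_path_colout ins_inc x_in x_b.
  by rewrite /= subSnn leqnn leqnSn.
have pm : p < m by apply: (allP c_gt); rewrite cE mem_cat mem_head orbT.
have pc1_lt : all (ltn^~ m) (p :: c1) by rewrite /= pm.
rewrite [in colins (p :: c) x]cE [in colbump (p :: c) x]cE.
have [-> ->] := colins_bump pc1_lt m_le c2_gt.
have pins_inc : sorted ltn (p :: c1 ++ x :: c2).
  rewrite /= path_sortedE ?ins_inc ?andbT; last exact: ltn_trans.
  by move: c_gt; rewrite cE !all_cat /= => /and3P[-> _ ->]; rewrite px.
have [/= -> ->] := smallest_stays pins_inc x_in x_b.
have -> : size (c1 ++ x :: c2) = size c by rewrite cE !size_cat.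
rewrite /= (leq_path_colout ins_inc x_in x_b).2.
by have -> : size (c1 ++ x :: c2) = size c; [rewrite cE !size_cat | rewrite subnn leqnn leqnSn].
Qed.

Lemma strict_col_split p c : sorted ltn c -> all (leq p) c ->
  c = nseq (p \in c) p ++ [seq x <- c | p < x].
Proof.
case: c => //= x c x_c /andP[px _]; have c_gt := order_path_min ltn_trans x_c.
have fE q : q <= x -> [seq y <- c | q < y] = c.
  by move=> qx; apply/all_filterP; apply: sub_all c_gt => y /=; apply: leq_ltn_trans.
rewrite inE fE //; case: (ltngtP p x) px => //= [lt|->] _; last by [].
by rewrite (_ : (p \in c) = false) //; apply/negP => /(allP c_gt) /=; lia.
Qed.

Lemma nseq_below p m c : all (ltn p) c ->
  colres (p :: c) (nseq m p) = p :: c /\ colout (p :: c) (nseq m p) = nseq m p.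
Proof.
move=> c_gt; elim: m => //= m [IH1 IH2].
by have [/= -> ->] := @colins_bump [::] p c p isT (leqnn p) c_gt; rewrite IH1 /= IH2.
Qed.

(** If [p] is in the column, the [m] letters [p] bump as many, and [b] bumps one more when [c0]
    grows. If it is not and [m > 0], the first [p] stays and only [m.-1] are passed on before [b]
    arrives. *)
Lemma block_col p m c b (c0 := [seq x <- c | p < x]) (s := size (colres c0 b)) :
  sorted ltn c -> all (leq p) c -> sorted leq b -> all (ltn p) b ->
  size (colres c (nseq m p ++ b)) = local_height (size c0) (size c) s m /\
  colout c (nseq m p ++ b) = nseq (carry_step (size c0) (size c) s m) p ++ colout c0 b.
Proof.
move=> c_inc c_ge b_inc b_gt.
have c0_inc : sorted ltn c0 by apply: sorted_filter c_inc; exact: ltn_trans.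
have c0_gt : all (ltn p) c0 by apply/allP => x; rewrite mem_filter => /andP[].
have pc0_inc : sorted ltn (p :: c0) by rewrite /= path_sortedE ?c0_gt //; exact: ltn_trans.
have [s_le sz_pc0 out_pc0] := block_below pc0_inc b_inc b_gt.
rewrite -/s in s_le out_pc0; move: (strict_col_split c_inc c_ge); rewrite -/c0 => {1 2 3 4}->.
rewrite colres_cat colout_cat /local_height /carry_step.
case: (p \in c) => /=.
  have [-> ->] := nseq_below m c0_gt; rewrite sz_pc0 out_pc0 ltnSn /=; split=> //.
  by rewrite catA -nseqD; congr (nseq _ _ ++ _); case: ltnP; lia.
case: m => [|m] /=.
  rewrite ltnn /= orbF -/s; split; first by case: ltnP; lia.
  by rewrite if_same.
have [-> ->] := colins_top c0_gt; have [-> ->] := nseq_below m c0_gt.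
rewrite sz_pc0 out_pc0 ltnn /= orbT; split=> //.
by rewrite catA -nseqD; congr (nseq _ _ ++ _); case: ltnP; lia.
Qed.

Definition height (w : seq nat) (k : nat) : nat := size (Pcol k w).

Lemma heightS w k : height w k.+1 = height (bump w) k.
Proof. by rewrite /height PcolS. Qed.

Lemma all_bump p w : all (leq p) w -> all (leq p) (bump w).
Proof. exact: all_colout. Qed.

Lemma bump_cat u v : bump (u ++ v) = bump u ++ colout (Pcol 0 u) v.
Proof. exact: colout_cat. Qed.

Lemma all_Pcol0 p w : all (leq p) w -> all (leq p) (Pcol 0 w).
Proof.
move=> w_ge; apply/all_filterP; rewrite filter_Pcol.
by move/all_filterP: w_ge => ->.
Qed.

(** The carry at column [k] is the number of letters [p] in the block arriving there. A column sends
    on a block of the same form, letters [p] followed by a sorted word of larger letters, so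
    [block_col] can be iterated. *)
Theorem local_rule k p w m b (w' := [seq x <- w | p < x]) :
  all (leq p) w -> sorted leq b -> all (ltn p) b ->
  height (w ++ nseq m p ++ b) k =
    local_height (height w' k) (height w k) (height (w' ++ b) k)
      (carry (height w') (height w) (height (w' ++ b)) m k).
Proof.
rewrite {}/w'; elim: k w m b => [|k IH] w m b w_ge b_inc b_gt.
  have := (block_col m (sorted_Pcol 0 w) (all_Pcol0 w_ge) b_inc b_gt).1.
  by rewrite /height /Pcol /= !colres_cat filter_colres.
rewrite carryS !heightS !bump_cat (block_col m (sorted_Pcol 0 w) (all_Pcol0 w_ge) b_inc b_gt).2.
rewrite !filter_Pcol IH.
- have -> u : height (u ++ b) 0 = size (colres (Pcol 0 u) b) by rewrite /height /Pcol /= colres_cat.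
  rewrite filter_bump; congr local_height; apply: eq_carry => j /=;
    by rewrite heightS ?bump_cat.
- exact: all_bump.
- exact: sorted_colout (sorted_Pcol _ _) b_inc.
- apply: all_colout => //; rewrite ?sorted_Pcol // all_Pcol0 //.
  by apply/allP => x; rewrite mem_filter => /andP[].
Qed.

(** * The growth diagram of a matrix *)

Section Growth.
Variables (F : nat -> nat -> nat) (n : nat).

Definition colword (p j : nat) : seq nat := flatten [seq nseq (F i j) i | i <- iota p (n - p)].

(* The word inserted for P(A) when A has the entries F i j for p <= i < n and q <= j < n,
   that is, the reversal of word_i: see rev_word_i. *)
Definition matword (p q : nat) : seq nat :=
  flatten [seq colword p j | j <- rev (iota q (n - q))].

Lemma iota_cons p : p < n -> iota p (n - p) = p :: iota p.+1 (n - p.+1).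
Proof. by move=> pn; rewrite -[n - p]prednK ?subn_gt0 // -subnS. Qed.

Lemma colword_cons p j : p < n -> colword p j = nseq (F p j) p ++ colword p.+1 j.
Proof. by move=> pn; rewrite /colword iota_cons. Qed.

Lemma matword_cat p q : q < n -> matword p q = matword p q.+1 ++ colword p q.
Proof.
by move=> qn; rewrite /matword iota_cons // rev_cons map_rcons flatten_rcons.
Qed.

Lemma all_colword p j : all (leq p) (colword p j).
Proof.
apply/allP => x /flattenP[_ /mapP[i + ->]]; rewrite mem_iota => /andP[pi _].
by move=> /nseqP[->].
Qed.

Lemma sorted_colword p j : sorted leq (colword p j).
Proof.
rewrite /colword; move: (n - p) => k; elim: k p => [|k IH] p //=.
have sp : sorted leq (nseq (F p j) p).
  by case: (F p j) => //= m; elim: m => //= m ->; rewrite leqnn.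
rewrite (sorted_pairwise leq_trans) pairwise_cat -!(sorted_pairwise leq_trans) sp IH !andbT.
apply/allrelP => x y /nseqP[-> _] /flattenP[_ /mapP[i + ->]].
by rewrite mem_iota => /andP[pi _] /nseqP[-> _]; apply: ltnW.
Qed.

Lemma filter_colword p j : [seq x <- colword p j | p < x] = colword p.+1 j.
Proof.
case: (ltnP p n) => [pn|np]; last first.
  by rewrite /colword (eqP np) (eqP (leqW np)).
rewrite colword_cons // filter_cat (all_filterP (all_colword p.+1 j)).
suff -> : [seq x <- nseq (F p j) p | p < x] = [::] by [].
by elim: (F p j) => //= m ->; rewrite ltnn.
Qed.

Lemma filter_matword p q : [seq x <- matword p q | p < x] = matword p.+1 q.
Proof.
rewrite /matword filter_flatten -map_comp; congr flatten; apply: eq_map => j /=.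
exact: filter_colword.
Qed.

Lemma all_matword p q : all (leq p) (matword p q).
Proof.
by apply/allP => x /flattenP[_ /mapP[j _ ->]] /(allP (all_colword p j)).
Qed.

Lemma filter_matword0 p q : [seq x <- matword 0 q | p <= x] = matword p q.
Proof.
elim: p => [|p IH]; first by rewrite (all_filterP (all_matword 0 q)).
rewrite -filter_matword -IH -filter_predI; apply: eq_filter => x /=.
by case: (ltnP p x) => // /ltnW.
Qed.

Lemma matword_nil p q : (n <= p) || (n <= q) -> matword p q = [::].
Proof.
case/orP=> [np|nq]; last by rewrite /matword (eqP nq).
rewrite /matword; elim: (rev _) => //= j s ->.
by rewrite /colword (eqP np).
Qed.

Definition sh (p q : nat) : nat -> nat := height (matword p q).

Lemma sh_local p q k : p < n -> q < n ->
  sh p q k = local_height (sh p.+1 q.+1 k) (sh p q.+1 k) (sh p.+1 q k)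
                  (carry (sh p.+1 q.+1) (sh p q.+1) (sh p.+1 q) (F p q) k).
Proof.
move=> pn qn; rewrite /sh matword_cat // colword_cons // local_rule; last first.
- exact: all_colword.
- exact: sorted_colword.
- exact: all_matword.
by rewrite filter_matword -matword_cat.
Qed.

Lemma sh_nil p q k : (n <= p) || (n <= q) -> sh p q k = 0.
Proof. by move=> /matword_nil; rewrite /sh /height => ->; rewrite Pcol_nil. Qed.

(** The letter [p] occurs at most once in a strict column: neighbouring shapes differ by a
    horizontal strip. *)
Lemma sh_strip p q k : sh p.+1 q k <= sh p q k <= (sh p.+1 q k).+1.
Proof.
rewrite /sh /height -filter_matword -filter_Pcol.
rewrite [X in _ <= size X <= _](@strict_col_split p) ?sorted_Pcol //; last first.
  apply/all_filterP; rewrite filter_Pcol; congr Pcol.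
  exact/all_filterP/all_matword.
by rewrite size_cat size_nseq leq_addl /=; case: (p \in _); rewrite ?add1n ?add0n.
Qed.

Lemma count_Pcol_matword p k : count (leq p) (Pcol k (matword 0 0)) = sh p 0 k.
Proof. by rewrite count_Pcol filter_matword0. Qed.
End Growth.

Lemma carry_step_sym r l m c : carry_step r l m c = carry_step r m l c.
Proof. by rewrite /carry_step andbC orbC. Qed.

Lemma local_height_sym r l m c : local_height r l m c = local_height r m l c.
Proof. by rewrite /local_height orbCA. Qed.

Lemma carry_sym r l m c k : carry r l m c k = carry r m l c k.
Proof. by elim: k => //= k ->; rewrite carry_step_sym. Qed.

Lemma sh_tr F n p q : sh F n p q =1 sh (fun i j => F j i) n q p.
Proof.
have [d] := ubnP ((n - p) + (n - q)); elim: d p q => // d IH p q d_ge k.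
have [np|pn] := leqP n p; first by rewrite !sh_nil ?np ?orbT.
have [nq|qn] := leqP n q; first by rewrite !sh_nil ?nq ?orbT.
rewrite [LHS]sh_local // [RHS]sh_local // local_height_sym carry_sym.
have e1 : sh F n p.+1 q.+1 =1 sh (fun i j => F j i) n q.+1 p.+1 by apply: IH; lia.
have e2 : sh F n p q.+1 =1 sh (fun i j => F j i) n q.+1 p by apply: IH; lia.
have e3 : sh F n p.+1 q =1 sh (fun i j => F j i) n q p.+1 by apply: IH; lia.
by rewrite e1 e2 e3; congr local_height; apply: eq_carry.
Qed.

(** When [l] and [m] both equal the new height, the outgoing carry decides: it is positive if
    [r < l] and [r < m], and 0 if [r] equals them and no carry arrived. The other cases are visible
    on the heights. *)
Lemma local_inj1 r r' l m x y : r <= l <= r.+1 -> r <= m <= r.+1 ->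
  r' <= l <= r'.+1 -> r' <= m <= r'.+1 ->
  local_height r l m x = local_height r' l m y ->
  carry_step r l m x = carry_step r' l m y -> x = y /\ r = r'.
Proof.
move=> /andP[? ?] /andP[? ?] /andP[? ?] /andP[? ?]; rewrite /local_height /carry_step.
case: (ltnP r l) => ?; case: (ltnP r m) => ?; case: (ltnP r' l) => ?; case: (ltnP r' m) => ? /=;
  case: x => [|x]; case: y => [|y] /= ? ?; lia.
Qed.

(** The comparison runs down from column [N]: from there on the height 0 forces the carry and [r] to
    be 0, and [local_inj1] leads from column [k.+1] to column [k]. *)
Lemma local_inj r l m c r' c' N :
  (forall k, local_height (r k) (l k) (m k) (carry r l m c k) =
             local_height (r' k) (l k) (m k) (carry r' l m c' k)) ->
  (forall k, r k <= l k <= (r k).+1) -> (forall k, r k <= m k <= (r k).+1) ->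
  (forall k, r' k <= l k <= (r' k).+1) -> (forall k, r' k <= m k <= (r' k).+1) ->
  (forall k, N <= k -> local_height (r k) (l k) (m k) (carry r l m c k) = 0) ->
  r =1 r' /\ c = c'.
Proof.
move=> eq_nu rl rm rl' rm' nu0.
suff eqk k : carry r l m c k = carry r' l m c' k /\ r k = r' k.
  by split=> [k|]; [case: (eqk k) | case: (eqk 0)].
have [le|lt] := leqP N k.
  have := nu0 k le; rewrite eq_nu; have := nu0 k le; rewrite /local_height.
  by do 2!case: ifP; rewrite // => /negbT + /negbT; rewrite !negb_or -!leqNgt !leqn0 =>
     /and3P[_ _ /eqP->] /and3P[_ _ /eqP->] -> ->.
have [d dE] : exists d, k + d = N by exists (N - k); lia.
elim: d k dE {lt} => [|d IH] k dE.
  have le : N <= k by lia.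
  have := nu0 k le; rewrite eq_nu; have := nu0 k le; rewrite /local_height.
  by do 2!case: ifP; rewrite // => /negbT + /negbT; rewrite !negb_or -!leqNgt !leqn0 =>
     /and3P[_ _ /eqP->] /and3P[_ _ /eqP->] -> ->.
have [] := IH k.+1 ltac:(lia); rewrite /= => eq_step _.
by have [] := local_inj1 (rl k) (rm k) (rl' k) (rm' k) (eq_nu k) eq_step.
Qed.

(* The inverse of carry_step runs from left to right, starting with carry 0 beyond the
   shape. *)
Definition icarry_step (nu l m c : nat) : nat :=
  if (l < nu) && (m < nu) then c.+1 else if (l < nu) || (m < nu) then c else c.-1.

(** * Inverting the local rule and the growth diagram *)

Section LocalInverse.
Variables (N : nat) (nu l m : nat -> nat).

Fixpoint icarry_from (d : nat) : nat :=
  if d is d'.+1 then icarry_step (nu (N - d)) (l (N - d)) (m (N - d)) (icarry_from d') else 0.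

Definition icarry (k : nat) : nat := icarry_from (N - k).

(** The inner shape sh(p+1, q+1), recovered from the other three. When [l] and [m] agree with [nu],
    it is the carry leaving the column that reveals a smaller inner column. *)
Definition irho (k : nat) : nat :=
  if [|| l k < nu k, m k < nu k | 0 < icarry k.+1] then (nu k).-1 else nu k.

Hypothesis nu_anti : forall k, nu k.+1 <= nu k.
Hypothesis l_anti : forall k, l k.+1 <= l k.
Hypothesis m_anti : forall k, m k.+1 <= m k.
Hypothesis l_strip : forall k, l k <= nu k <= (l k).+1.
Hypothesis m_strip : forall k, m k <= nu k <= (m k).+1.
Hypothesis nu0 : forall k, N <= k -> nu k = 0.

Lemma icarryE k : icarry k = icarry_step (nu k) (l k) (m k) (icarry k.+1).
Proof.
rewrite /icarry; have [lt|le] := ltnP k N; last first.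
  have -> : N - k = 0 by lia.
  have -> : N - k.+1 = 0 by lia.
  by rewrite /icarry_step nu0 // !ltn0.
have -> : N - k = (N - k.+1).+1 by lia.
rewrite /=; have -> : N - (N - k.+1).+1 = k by lia.
by [].
Qed.

(** Run backwards, the carry increases only at nonempty columns, and every column to the right of a
    nonempty one is nonempty. Hence the predecessor in [irho] is never taken at 0. *)
Lemma icarry_gt0 k : 0 < icarry k -> 0 < nu k.
Proof.
have [le|lt] := leqP N k; first by rewrite /icarry (eqP le).
have [d dE] : exists d, k + d = N by exists (N - k); lia.
elim: d k dE {lt} => [|d IH] k dE; first by rewrite /icarry -dE addn0 subnn.
rewrite icarryE => c_gt; have := IH k.+1 ltac:(lia); have := nu_anti k; move: c_gt.
rewrite /icarry_step; move: (nu k) (nu k.+1) (l k) (m k) (icarry k.+1) => a b x y z.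
by case: (ltnP x a) => ? /=; case: (ltnP y a) => ? /= ? ? ?; lia.
Qed.

(** All claims but the third concern a single column. The third compares neighbours, which is why
    the recurrence of the carry is used at [k] and at [k.+1]. *)
Lemma irho_spec k :
  [/\ irho k <= l k <= (irho k).+1, irho k <= m k <= (irho k).+1, irho k.+1 <= irho k,
      local_height (irho k) (l k) (m k) (icarry k) = nu k
    & carry_step (irho k) (l k) (m k) (icarry k) = icarry k.+1].
Proof.
have gt0 := @icarry_gt0 k.+1; have cE := icarryE k; have cE1 := icarryE k.+1.
move: gt0 cE cE1.
move: (nu_anti k) (l_anti k) (m_anti k) (l_strip k) (l_strip k.+1) (m_strip k) (m_strip k.+1).
rewrite /irho /icarry_step /local_height /carry_step.
move: (nu k) (nu k.+1) (l k) (l k.+1) (m k) (m k.+1) => a a1 b b1 c c1.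
move: (icarry k) (icarry k.+1) (icarry k.+2) => x y z.
move=> ? ? ? /andP[? ?] /andP[? ?] /andP[? ?] /andP[? ?] gt0.
have [ba|ba] := ltnP b a; have [ca|ca] := ltnP c a; rewrite /= => -> {x}.
- have -> : (a.-1 < b) = false by lia.
  have -> : (a.-1 < c) = false by lia.
  by case: (ltnP b1 a1) => ?; case: (ltnP c1 a1) => ?; case: z => [|z] /= ?; split; lia.
- have -> : (a.-1 < b) = false by lia.
  have -> : (a.-1 < c) = true by lia.
  by case: (ltnP b1 a1) => ?; case: (ltnP c1 a1) => ?; case: z => [|z] /= ?; split; lia.
- have -> : (a.-1 < b) = true by lia.
  have -> : (a.-1 < c) = false by lia.
  by case: (ltnP b1 a1) => ?; case: (ltnP c1 a1) => ?; case: z => [|z] /= ?; split; lia.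
case: y gt0 => [|y] gt0 /= yE.
  have -> : (a < b) = false by lia.
  have -> : (a < c) = false by lia.
  by move: yE; case: (ltnP b1 a1) => ?; case: (ltnP c1 a1) => ?; case: z => [|z] /= ?; split; lia.
have := gt0 isT => ?.
have -> : (a.-1 < b) = true by lia.
have -> : (a.-1 < c) = true by lia.
by move: yE; case: (ltnP b1 a1) => ?; case: (ltnP c1 a1) => ?; case: z => [|z] /= ?; split; lia.
Qed.

Lemma carry_icarry k : carry irho l m (icarry 0) k = icarry k.
Proof. by elim: k => //= k ->; have [] := irho_spec k. Qed.

End LocalInverse.

Section GrowthInverse.
Variables (N n : nat) (s t : nat -> nat -> nat).

(* The growth diagram with the shapes s on its first column and t on its first row. *)
Fixpoint grow_row (prev : nat -> nat -> nat) (first : nat -> nat) (q : nat) : nat -> nat :=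
  if q is q'.+1 then irho N (prev q') (prev q'.+1) (grow_row prev first q') else first.

Fixpoint grow (p : nat) : nat -> nat -> nat :=
  if p is p'.+1 then grow_row (grow p') (s p'.+1) else t.

(** The carry with which the rightmost column of a cell starts is the matrix entry of that cell. *)
Definition grow_entry (p q : nat) : nat :=
  icarry N (grow p q) (grow p q.+1) (grow p.+1 q) 0.

Hypothesis s0 : s 0 =1 t 0.
Hypothesis s_anti : forall p k, s p k.+1 <= s p k.
Hypothesis t_anti : forall q k, t q k.+1 <= t q k.
Hypothesis s_strip : forall p k, s p.+1 k <= s p k <= (s p.+1 k).+1.
Hypothesis t_strip : forall q k, t q.+1 k <= t q k <= (t q.+1 k).+1.
Hypothesis t0 : forall k, N <= k -> t 0 k = 0.
Hypothesis s_n : forall p k, n <= p -> s p k = 0.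
Hypothesis t_n : forall q k, n <= q -> t q k = 0.

Lemma growS p q : grow p.+1 q.+1 = irho N (grow p q) (grow p q.+1) (grow p.+1 q).
Proof. by []. Qed.

Lemma grow_p0 p : grow p 0 =1 s p.
Proof. by case: p => // k; rewrite s0. Qed.

Definition row_ok (g : nat -> nat -> nat) : Prop :=
  [/\ forall q k, g q k.+1 <= g q k, forall q k, N <= k -> g q k = 0
    & forall q k, g q.+1 k <= g q k <= (g q.+1 k).+1].

Lemma grow_row_ok p : row_ok (grow p) ->
  row_ok (grow p.+1) /\ forall q k, grow p.+1 q k <= grow p q k <= (grow p.+1 q k).+1.
Proof.
case=> anti_p N_p strip_p.
have main q : (forall k, grow p.+1 q k.+1 <= grow p.+1 q k) /\
    (forall k, grow p.+1 q k <= grow p q k <= (grow p.+1 q k).+1).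
  elim: q => [|q [anti_q strip_q]]; first by split=> k; rewrite grow_p0 ?s_anti // grow_p0.
  by split=> k; rewrite growS;
    have [] := irho_spec (anti_p q) (anti_p q.+1) anti_q (strip_p q) strip_q (N_p q) k.
split; last by move=> q; case: (main q).
split=> q k; first by case: (main q).
  by move=> /(N_p q); have [_ /(_ k)] := main q; lia.
have [anti_q strip_q] := main q; rewrite growS.
by have [] := irho_spec (anti_p q) (anti_p q.+1) anti_q (strip_p q) strip_q (N_p q) k.
Qed.

Lemma row_ok_grow p : row_ok (grow p).
Proof.
elim: p => [|p /grow_row_ok[]//]; split=> //= q k /t0; elim: q => // q IH /IH.
by have := t_strip q k; lia.
Qed.

Lemma grow_strip p q k : grow p.+1 q k <= grow p q k <= (grow p.+1 q k).+1.
Proof. by have [_] := grow_row_ok (row_ok_grow p). Qed.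

Lemma grow_nil p q k : (n <= p) || (n <= q) -> grow p q k = 0.
Proof.
case/orP=> [np|nq].
  elim: q => [|q IH]; first by rewrite grow_p0 s_n.
  by have [_ _ /(_ q k)] := row_ok_grow p; lia.
by elim: p => [|p IH]; [exact: t_n | have := grow_strip p q k; lia].
Qed.

(** Both diagrams vanish from index [n] on and obey the same forward rule, [grow] because [irho] and
    [icarry] invert it. *)
Lemma sh_grow p q : sh grow_entry n p q =1 grow p q.
Proof.
have [d] := ubnP ((n - p) + (n - q)); elim: d p q => // d IH p q d_ge k.
have [np|pn] := leqP n p; first by rewrite sh_nil ?grow_nil ?np.
have [nq|qn] := leqP n q; first by rewrite sh_nil ?grow_nil ?nq ?orbT.
have e1 : sh grow_entry n p.+1 q.+1 =1 grow p.+1 q.+1 by apply: IH; lia.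
have e2 : sh grow_entry n p q.+1 =1 grow p q.+1 by apply: IH; lia.
have e3 : sh grow_entry n p.+1 q =1 grow p.+1 q by apply: IH; lia.
have [anti_p N_p strip_p] := row_ok_grow p; have [anti_p' _ _] := row_ok_grow p.+1.
have spec := irho_spec (anti_p q) (anti_p q.+1) (anti_p' q) (strip_p q) (grow_strip p q) (N_p q).
rewrite sh_local // e1 e2 e3 (eq_carry _ k e1 e2 e3) growS.
rewrite /grow_entry (carry_icarry (anti_p q) (anti_p q.+1) (anti_p' q) (strip_p q)
  (grow_strip p q) (N_p q)).
by have [] := spec k.
Qed.
End GrowthInverse.

(** In each cell the shapes at (p, q), (p, q+1) and (p+1, q) determine the inner shape and the
    entry, so equality spreads from the first row and column to the whole diagram. *)
Lemma growth_inj F G n : (forall p, sh F n p 0 =1 sh G n p 0) ->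
  (forall q, sh F n 0 q =1 sh G n 0 q) -> forall p q, p < n -> q < n -> F p q = G p q.
Proof.
move=> eq_col eq_row.
have strip H p q k : sh H n p q.+1 k <= sh H n p q k <= (sh H n p q.+1 k).+1.
  by rewrite !(sh_tr H) sh_strip.
have bound H p q k : size (matword H n p q) <= k -> sh H n p q k = 0.
  by move=> le; rewrite /sh /height Pcol_nil.
have entry p q : p < n -> q < n -> sh F n p q =1 sh G n p q ->
    sh F n p.+1 q =1 sh G n p.+1 q -> sh F n p q.+1 =1 sh G n p q.+1 ->
    sh F n p.+1 q.+1 =1 sh G n p.+1 q.+1 /\ F p q = G p q.
  move=> pn qn e e1 e2.
  apply: (@local_inj _ (sh F n p q.+1) (sh F n p.+1 q) _ _ _ (size (matword F n p q))) => k.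
  - rewrite -sh_local // e sh_local // !e1 !e2; congr local_height.
    by apply: eq_carry.
  - exact: sh_strip.
  - exact: strip.
  - by rewrite e2 sh_strip.
  - by rewrite e1 strip.
  - by move=> le; rewrite -sh_local // bound.
have all_eq p q : sh F n p q =1 sh G n p q.
  elim: p q => [|p IHp] q; first exact: eq_row.
  elim: q => [|q IHq]; first exact: eq_col.
  have [np|pn] := leqP n p; first by move=> k; rewrite !sh_nil // (leqW np).
  have [nq|qn] := leqP n q; first by move=> k; rewrite !sh_nil // (leqW nq) orbT.
  by have [] := entry p q pn qn (IHp q) IHq (IHp q.+1).
by move=> p q pn qn; have [] := entry p q pn qn (all_eq _ _) (all_eq _ _) (all_eq _ _).
Qed.

(** * Matrices and their words *)

Lemma eq_matword F G n p q : (forall i j, i < n -> j < n -> F i j = G i j) ->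
  matword F n p q = matword G n p q.
Proof.
move=> FG; congr flatten; apply/eq_in_map => j; rewrite mem_rev mem_iota => jn.
congr flatten; apply/eq_in_map => i; rewrite mem_iota => i_n.
by rewrite FG //; lia.
Qed.

Lemma ij_le_trans : transitive ij_le.
Proof. by move=> [a b] [c d] [e f]; rewrite /ij_le /=; lia. Qed.

Lemma ij_le_anti : antisymmetric ij_le.
Proof. by move=> [a b] [c d] /=; rewrite /ij_le /= => ?; congr pair; lia. Qed.

Lemma ij_le_total : total ij_le.
Proof. by move=> [a b] [c d]; rewrite /ij_le /=; lia. Qed.

Definition swap (p : nat * nat) := (p.2, p.1).

Lemma swapK : involutive swap. Proof. by case. Qed.

Lemma ij_le_swap p q : ij_le (swap p) (swap q) = kl_le p q.
Proof. by []. Qed.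

Lemma count_pairs (A : mat) p : count_mem p (pairs A) = A p.
Proof.
rewrite /pairs count_flatten -map_comp sumnE big_map.
rewrite (eq_bigr (fun q => if q == p then A p else 0)); last first.
  by move=> q _ /=; rewrite count_nseq /=; case: eqP => [->|_]; rewrite ?mul1n.
rewrite -big_mkcond big_const_seq iter_addn_0.
have [pA|pA] := boolP (p \in finsupp A).
  rewrite (_ : count _ _ = 1) ?muln1 //.
  by have /= := count_uniq_mem p (fset_uniq (finsupp A));
    rewrite -[enum_fset _]/(finsupp A : seq _) pA.
by rewrite (fsfun_dflt pA).
Qed.

Lemma sort_ij (A : mat) s : sorted ij_le s -> (forall p, count_mem p s = A p) ->
  sort ij_le (pairs A) = s.
Proof.
move=> s_inc cnt; apply: (sorted_eq ij_le_trans ij_le_anti _ s_inc).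
  exact: sort_sorted ij_le_total _.
by rewrite perm_sort; apply/allP => p _ /=; rewrite count_pairs cnt.
Qed.

Lemma sorted_ij_pairs (A : mat) : sorted ij_le (sort ij_le (pairs A)).
Proof. exact: sort_sorted ij_le_total _. Qed.

Lemma size_word_ij (A : mat) : size (word_i A) = size (word_j A).
Proof. by rewrite !size_map. Qed.

Lemma zip_word_ij (A : mat) : zip (word_i A) (word_j A) = sort ij_le (pairs A).
Proof. exact: zip_unzip. Qed.

Lemma mat_of_words (A : mat) : mat_of (word_i A) (word_j A) = A.
Proof.
by apply/fsfunP => p; rewrite mat_ofE zip_word_ij count_sort count_pairs.
Qed.

Lemma word_mat_of u v : size u = size v -> sorted ij_le (zip u v) ->
  word_i (mat_of u v) = u /\ word_j (mat_of u v) = v.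
Proof.
move=> sz uv_inc; rewrite /word_i /word_j (sort_ij uv_inc) => [|p]; last by rewrite mat_ofE.
by rewrite unzip1_zip ?unzip2_zip ?sz.
Qed.

(** Transposition exchanges the two sorted two-row words, so that the Q-tableau is the P-tableau of
    [mtr A]. *)
Definition mtr (A : mat) : mat := mat_of (word_j A) (word_i A).

Lemma zip_swap (u v : seq nat) : zip v u = [seq swap p | p <- zip u v].
Proof. by elim: u v => [|x u IH] [|y v] //=; rewrite IH. Qed.

Lemma count_swap p s : count_mem p (map swap s) = count_mem (swap p) s.
Proof.
by rewrite count_map; apply: eq_count => q /=; rewrite -(inj_eq (can_inj swapK)) swapK.
Qed.

Lemma mat_of_swap u v p : mat_of v u p = mat_of u v (swap p).
Proof. by rewrite !mat_ofE zip_swap count_swap. Qed.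

Lemma mtrE (A : mat) p : mtr A p = A (swap p).
Proof. by rewrite /mtr mat_of_swap mat_of_words. Qed.

Lemma mtrK : involutive mtr.
Proof. by move=> A; apply/fsfunP => p; rewrite !mtrE swapK. Qed.

Lemma mtr_mat_of u v : mtr (mat_of u v) = mat_of v u.
Proof. by apply/fsfunP => p; rewrite mtrE -mat_of_swap. Qed.

Lemma sort_mtr (A : mat) : sort ij_le (pairs (mtr A)) = [seq swap p | p <- sort kl_le (pairs A)].
Proof.
apply: sort_ij => [|p]; last by rewrite count_swap count_sort count_pairs mtrE.
rewrite sorted_map (eq_sorted ij_le_swap) //; apply: sort_sorted => p q.
by rewrite -!ij_le_swap ij_le_total.
Qed.

Lemma word_i_mtr (A : mat) : word_i (mtr A) = word_l A.
Proof. by rewrite /word_i sort_mtr /unzip1 -map_comp. Qed.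

Lemma word_j_mtr (A : mat) : word_j (mtr A) = word_k A.
Proof. by rewrite /word_j sort_mtr /unzip2 -map_comp. Qed.

Definition entries (A : mat) (i j : nat) : nat := A (i, j).

Definition bounded (n : nat) (A : mat) : Prop := forall i j, (n <= i) || (n <= j) -> A (i, j) = 0.

Lemma bounded_ex (A B : mat) : exists n, bounded n A /\ bounded n B.
Proof.
have ex (C : mat) : exists n, bounded n C.
  exists (\max_(p <- enum_fset (finsupp C)) maxn p.1 p.2).+1 => i j; apply: contraTeq => C0.
  have ijC : (i, j) \in enum_fset (finsupp C).
    by rewrite -[_ \in _]/((i, j) \in finsupp C) mem_finsupp.
  have := @leq_bigmax_seq _ (enum_fset (finsupp C)) xpredT (fun p => maxn p.1 p.2) _ ijC isT => /=.
  lia.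
have [[n nA] [m mB]] := (ex A, ex B); exists (maxn n m); split=> i j ij.
  by apply: nA; move: ij; lia.
by apply: mB; move: ij; lia.
Qed.

Lemma bounded_mtr n (A : mat) : bounded n A -> bounded n (mtr A).
Proof. by move=> nA i j ij; rewrite mtrE nA // orbC. Qed.

Definition colpairs (F : nat -> nat -> nat) (n p j : nat) : seq (nat * nat) :=
  flatten [seq nseq (F i j) (i, j) | i <- iota p (n - p)].

Definition matpairs (F : nat -> nat -> nat) (n : nat) (q : nat) : seq (nat * nat) :=
  flatten [seq colpairs F n 0 j | j <- rev (iota q (n - q))].

Definition revsorted (s : seq (nat * nat)) := sorted (fun p q => ij_le q p) s.

Lemma ij_ge_trans : transitive (fun p q => ij_le q p).
Proof. by move=> q p r pq qr; apply: ij_le_trans pq. Qed.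

Lemma mem_colpairs F n p j x : x \in colpairs F n p j -> p <= x.1 /\ x.2 = j.
Proof.
by move=> /flattenP[_ /mapP[i + ->]]; rewrite mem_iota => /andP[pi _] /nseqP[->].
Qed.

Lemma revsorted_colpairs F n p j : revsorted (colpairs F n p j).
Proof.
rewrite /colpairs /revsorted; move: (n - p) => k; elim: k p => [|k IH] p //=.
rewrite (sorted_pairwise ij_ge_trans) pairwise_cat -!(sorted_pairwise ij_ge_trans) IH andbT.
apply/andP; split.
  apply/allrelP => x y /nseqP[-> _] /flattenP[_ /mapP[i + ->]].
  by rewrite mem_iota => /andP[pi _] /nseqP[-> _]; rewrite /ij_le /= eqxx ltnn ltnW.
by case: (F p j) => //= m; elim: m => //= m ->; rewrite /ij_le /= eqxx leqnn orbT.
Qed.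

Lemma revsorted_matpairs F n q : revsorted (matpairs F n q).
Proof.
rewrite /matpairs /revsorted; move: (n - q) => k; elim: k q => [|k IH] q //.
rewrite /= rev_cons map_rcons flatten_rcons.
rewrite (sorted_pairwise ij_ge_trans) pairwise_cat -!(sorted_pairwise ij_ge_trans) IH.
rewrite -/(revsorted _) revsorted_colpairs !andbT.
apply/allrelP => x y /flattenP[_ /mapP[j + ->]]; rewrite mem_rev mem_iota => /andP[qj _].
by move=> /mem_colpairs[_ xj] /mem_colpairs[_ yq]; rewrite /ij_le xj yq qj.
Qed.

Lemma count_colpairs F n j x : count_mem x (colpairs F n 0 j) =
  if (x.1 < n) && (x.2 == j) then F x.1 j else 0.
Proof.
rewrite /colpairs subn0 count_flatten -map_comp sumnE big_map.
case: x => a b /=; have [ba|ba] := altP (b =P j); last first.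
  rewrite andbF big1 // => i _; apply/count_memPn/negP => /nseqP[[_ bj]].
  by rewrite bj eqxx in ba.
subst b; rewrite andbT (eq_bigr (fun i => if i == a then F a j else 0)) => [|i _ /=]; last first.
  by rewrite count_nseq /= xpair_eqE eqxx andbT; case: eqP => [->|_]; rewrite ?mul1n.
rewrite -big_mkcond big_const_seq iter_addn_0.
have := count_uniq_mem a (iota_uniq 0 n); rewrite mem_iota add0n /= => ->.
by case: (a < n); rewrite ?muln1 ?muln0.
Qed.

Lemma count_matpairs F n x : count_mem x (matpairs F n 0) =
  if (x.1 < n) && (x.2 < n) then F x.1 x.2 else 0.
Proof.
rewrite /matpairs subn0 count_flatten -map_comp sumnE big_map.
rewrite (eq_bigr (fun j => if j == x.2 then (if x.1 < n then F x.1 x.2 else 0) else 0)).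
  rewrite -big_mkcond big_const_seq iter_addn_0 count_rev.
  have := count_uniq_mem x.2 (iota_uniq 0 n); rewrite mem_iota add0n /= => ->.
  by rewrite andbC; case: (x.2 < n); rewrite ?muln1 ?muln0.
move=> j _ /=; rewrite count_colpairs eq_sym; case: eqP => [->|_]; last by rewrite andbF.
by rewrite andbT.
Qed.

Lemma sort_matpairs n (A : mat) : bounded n A ->
  rev (sort ij_le (pairs A)) = matpairs (entries A) n 0.
Proof.
move=> nA; rewrite -[RHS]revK; congr rev; apply: sort_ij => [|[i j]].
  by rewrite rev_sorted; exact: revsorted_matpairs.
rewrite count_rev count_matpairs /=; case: ifP => // /negbT.
by rewrite negb_and -!leqNgt => /nA.
Qed.

Lemma unzip1_matpairs F n q : unzip1 (matpairs F n q) = matword F n 0 q.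
Proof.
rewrite /matpairs /matword /unzip1 map_flatten -map_comp; congr flatten.
apply: eq_map => j /=; rewrite /colpairs /colword map_flatten -map_comp; congr flatten.
by apply: eq_map => i /=; rewrite map_nseq.
Qed.

Lemma rev_word_i n (A : mat) : bounded n A -> rev (word_i A) = matword (entries A) n 0 0.
Proof. by move=> nA; rewrite -map_rev (sort_matpairs nA) -unzip1_matpairs. Qed.

Lemma filter_matpairs F n q : [seq p <- matpairs F n 0 | q <= p.2] = matpairs F n q.
Proof.
have all_ge r : all (fun p => r <= p.2) (matpairs F n r).
  apply/allP => p /flattenP[_ /mapP[j + ->]]; rewrite mem_rev mem_iota => /andP[rj _].
  by move=> /mem_colpairs[_ ->].
elim: q => [|q IH]; first exact/all_filterP.
have [nq|qn] := leqP n q.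
  have nilE r : n <= r -> matpairs F n r = [::] by move=> nr; rewrite /matpairs (eqP nr).
  rewrite (nilE q) // in IH; rewrite (nilE q.+1) ?(leqW nq) //.
  apply/nilP; rewrite /nilp size_filter -leqn0.
  apply: (@leq_trans (size [seq p <- matpairs F n 0 | q <= p.2])); last by rewrite IH.
  by rewrite size_filter; apply: sub_count => p /= /ltnW.
have matE : matpairs F n q = matpairs F n q.+1 ++ colpairs F n 0 q.
  by rewrite /matpairs iota_cons // rev_cons map_rcons flatten_rcons.
have -> : [seq p <- matpairs F n 0 | q < p.2] = [seq p <- matpairs F n q | q < p.2].
  by rewrite -IH -filter_predI; apply: eq_filter => p /=; case: (ltnP q p.2) => // /ltnW.
rewrite matE filter_cat (all_filterP (all_ge q.+1)).
suff -> : [seq p <- colpairs F n 0 q | q < p.2] = [::] by rewrite cats0.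
rewrite -(filter_pred0 (colpairs F n 0 q)); apply: eq_in_filter => p /mem_colpairs[_ ->].
by rewrite ltnn.
Qed.

(* The letters of word_i A whose partner in word_j A is at least q form a suffix. *)
Lemma matword_suffix n (A : mat) q : bounded n A ->
  matword (entries A) n 0 q = rev (drop (count (ltn^~ q) (word_j A)) (word_i A)).
Proof.
move=> nA; rewrite -unzip1_matpairs -filter_matpairs -(sort_matpairs nA) filter_rev /unzip1 map_rev.
congr rev; rewrite /word_i /word_j -map_drop count_map; congr map.
elim: (sort _ _) (sorted_ij_pairs A) => //= p s IH p_s.
case: ltnP => [lt|le] /=; first by rewrite IH ?(path_sorted p_s).
have all_q : all (fun r => q <= r.2) s.
  by apply: sub_all (order_path_min ij_le_trans p_s) => r; rewrite /ij_le; lia.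
rewrite (all_filterP all_q) add0n (@eq_in_count _ _ pred0) ?count_pred0 ?drop0 // => r.
by move=> /(allP all_q) /=; rewrite ltnNge => ->.
Qed.

(** * Bijectivity of [kappa] *)

Definition Pmat (A : mat) : tableau nat := Ptab (rev (word_i A)).

Lemma kappaE (A : mat) : kappa A = (Pmat A, Pmat (mtr A)).
Proof. by rewrite /kappa /Pmat word_i_mtr. Qed.

Lemma semistandard_Pmat (A : mat) : semistandard (Pmat A).
Proof. exact: semistandard_Ptab. Qed.

Lemma count_Pmat n (A : mat) p k : bounded n A ->
  count (leq p) (nth [::] (Pmat A) k) = sh (entries A) n p 0 k.
Proof. by move=> nA; rewrite /Pmat nth_Ptab (rev_word_i nA) count_Pcol_matword. Qed.

Lemma sh_mtr n (A : mat) p q : sh (entries (mtr A)) n p q =1 sh (entries A) n q p.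
Proof.
move=> k; rewrite sh_tr /sh; congr height; apply: eq_matword => i j _ _.
by rewrite /entries mtrE.
Qed.

Lemma count0 (c : seq nat) : count (leq 0) c = size c.
Proof. by rewrite -(count_predT c); apply: eq_count. Qed.

Lemma eq_shape (T T' : tableau nat) : [::] \notin T -> [::] \notin T' ->
  (forall k, size (nth [::] T k) = size (nth [::] T' k)) -> shape T = shape T'.
Proof.
move=> T0 T0' eqT; apply: (@eq_nth_notin _ 0) => [||k]; last by rewrite !nth_shape eqT.
  by apply: contra T0 => /mapP[c cT /esym/size0nil <-].
by apply: contra T0' => /mapP[c cT /esym/size0nil <-].
Qed.

Lemma shape_Pmat_mtr (A : mat) : shape (Pmat (mtr A)) = shape (Pmat A).
Proof.
have [n [nA _]] := bounded_ex A A; have [_ A0 _ _] := semistandard_Pmat A.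
have [_ tA0 _ _] := semistandard_Pmat (mtr A); apply: eq_shape => // k.
by rewrite -!count0 (count_Pmat _ _ (bounded_mtr nA)) sh_mtr (count_Pmat _ _ nA).
Qed.

Lemma Pmat_inj (A B : mat) : Pmat A = Pmat B -> Pmat (mtr A) = Pmat (mtr B) -> A = B.
Proof.
move=> eqP eqQ; have [n [nA nB]] := bounded_ex A B.
have eqAB : forall p q, p < n -> q < n -> entries A p q = entries B p q.
  apply: growth_inj => p k; first by rewrite -(count_Pmat _ _ nA) eqP (count_Pmat _ _ nB).
  rewrite -(sh_mtr n A) -(sh_mtr n B) -(count_Pmat _ _ (bounded_mtr nA)) eqQ.
  by rewrite (count_Pmat _ _ (bounded_mtr nB)).
apply/fsfunP => -[i j]; have [ni|i_n] := leqP n i; first by rewrite nA ?nB ?ni.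
have [nj|j_n] := leqP n j; first by rewrite nA ?nB ?nj ?orbT.
exact: eqAB.
Qed.

Lemma nth_strict (T : tableau nat) k : all (sorted ltn) T -> sorted ltn (nth [::] T k).
Proof.
by case: (ltnP k (size T)) => [lt /allP|le _]; [apply; exact: mem_nth | rewrite nth_default].
Qed.

Lemma nth_size_anti (T : tableau nat) k : sorted geq (shape T) ->
  size (nth [::] T k.+1) <= size (nth [::] T k).
Proof.
move=> /(sortedP 0)/(_ k); rewrite size_map !nth_shape.
by case: (ltnP k.+1 (size T)) => [_|le _]; [exact | rewrite nth_default].
Qed.

Lemma count_anti (T : tableau nat) p k : semistandard T ->
  count (leq p) (nth [::] T k.+1) <= count (leq p) (nth [::] T k).
Proof.
case=> sT _ T_inc le_row; move: p.
apply/(count_leq_col (nth_strict k T_inc) (nth_strict k.+1 T_inc)); split.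
  exact: nth_size_anti.
by move=> h; apply: le_row.
Qed.

Lemma count_strip p c : sorted ltn c ->
  count (leq p.+1) c <= count (leq p) c <= (count (leq p.+1) c).+1.
Proof.
move=> c_inc; rewrite (count_leqS p) leq_addl /=.
by rewrite (count_uniq_mem p (sorted_uniq ltn_trans ltnn c_inc)); case: (p \in c).
Qed.

(** The letter counts of [S] are taken as the first column and those of [T] as the first row of a
    growth diagram; equal shapes make them agree at the corner, and the entries of the diagram form
    the matrix. *)
Lemma Pmat_surj (S T : tableau nat) : semistandard S -> semistandard T -> shape S = shape T ->
  exists2 A : mat, Pmat A = S & Pmat (mtr A) = T.
Proof.
move=> S_ok T_ok sh_ST; have [sS S0 S_inc _] := S_ok; have [sT T0 T_inc _] := T_ok.
pose n := (\max_(x <- flatten S ++ flatten T) x).+1.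
pose s p k := count (leq p) (nth [::] S k); pose t p k := count (leq p) (nth [::] T k).
have big (U : tableau nat) p k : {subset flatten U <= flatten S ++ flatten T} -> n <= p ->
    count (leq p) (nth [::] U k) = 0.
  move=> sub np; apply/eqP; rewrite -leqn0 leqNgt -has_count; apply/hasPn => x xU.
  rewrite -ltnNge; apply: leq_trans np; rewrite ltnS.
  apply: (@leq_bigmax_seq _ _ xpredT (fun x => x)) => //; apply: sub.
  apply/flattenP; exists (nth [::] U k) => //; apply: mem_nth; rewrite ltnNge.
  by apply/negP => le; rewrite nth_default in xU.
have s0 : s 0 =1 t 0.
  by move=> k; rewrite /s /t !count0 -!nth_shape sh_ST.
have t0 k : size T <= k -> t 0 k = 0 by move=> le; rewrite /t nth_default.
have s_n p k : n <= p -> s p k = 0 by apply: big => x; rewrite mem_cat => ->.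
have t_n p k : n <= p -> t p k = 0 by apply: big => x; rewrite mem_cat => ->; rewrite orbT.
have s_anti p k : s p k.+1 <= s p k by exact: count_anti.
have t_anti p k : t p k.+1 <= t p k by exact: count_anti.
have s_strip p k : s p.+1 k <= s p k <= (s p.+1 k).+1 by exact/count_strip/nth_strict.
have t_strip p k : t p.+1 k <= t p k <= (t p.+1 k).+1 by exact/count_strip/nth_strict.
have shE p q := sh_grow s0 s_anti t_anti s_strip t_strip t0 s_n t_n p q.
pose F := grow_entry (size T) s t; pose ps := matpairs F n 0.
pose A := mat_of (unzip1 ps) (unzip2 ps).
have AE i j : A (i, j) = if (i < n) && (j < n) then F i j else 0.
  by rewrite mat_ofE zip_unzip count_matpairs.
have nA : bounded n A by move=> i j ij; rewrite AE; case: ifP => // /andP[]; lia.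
have shA p q : sh (entries A) n p q =1 grow (size T) s t p q.
  move=> k; rewrite -shE /sh; congr height; apply: eq_matword => i j i_n j_n.
  by rewrite /entries AE i_n j_n.
exists A; apply: (@eq_nth_notin _ [::]) => [||k]; rewrite ?Ptab_nil //.
  apply: eq_strict_col => [||p]; rewrite ?nth_strict ?strict_Ptab //.
  by rewrite (count_Pmat _ _ nA) shA grow_p0.
apply: eq_strict_col => [||p]; rewrite ?nth_strict ?strict_Ptab //.
by rewrite (count_Pmat _ _ (bounded_mtr nA)) sh_mtr shA.
Qed.

Lemma lt_count_geq s k j : sorted geq s -> (j < count (ltn k) s) = (k < nth 0 s j).
Proof.
elim: s j => [|x s IH] j /= x_s; first by rewrite nth_nil !ltn0.
have {}IH := IH ^~ (path_sorted x_s).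
have x_ge := order_path_min (rev_trans leq_trans) x_s.
have [kx|xk] := ltnP k x; first by case: j => [|j]; rewrite ?kx //= add1n ltnS IH.
have -> : count (ltn k) s = 0.
  apply/eqP; rewrite -leqn0 leqNgt -has_count; apply/hasPn => y /(allP x_ge) /=; lia.
rewrite ltn0; symmetry; apply/negbTE; rewrite -leqNgt; case: j => //= j.
case: (ltnP j (size s)) => [lt|le]; last by rewrite nth_default.
by apply: leq_trans xk; apply: (allP x_ge); exact: mem_nth.
Qed.

Lemma nth_conj_part s k : sorted geq s -> nth 0 (conj_part s) k = count (ltn k) s.
Proof.
move=> s_dec; rewrite /conj_part; have [lt|le] := ltnP k (head 0 s).
  by rewrite (nth_map 0) ?size_iota // nth_iota.
rewrite nth_default ?size_map ?size_iota //; symmetry; apply/eqP; rewrite -leqn0 leqNgt.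
by rewrite lt_count_geq // nth0 -leqNgt.
Qed.

Lemma is_partition_conj s : sorted geq s -> is_partition (conj_part s).
Proof.
move=> s_dec; apply/andP; split.
  apply/(sortedP 0) => k _; rewrite !nth_conj_part //=.
  by apply: sub_count => x /=; lia.
apply/mapP => -[k]; rewrite mem_iota add0n /= => k_lt /esym/eqP.
by rewrite -leqn0 leqNgt lt_count_geq // nth0 k_lt.
Qed.

Lemma conj_partK s : sorted geq s -> 0 \notin s -> conj_part (conj_part s) = s.
Proof.
move=> s_dec s0; have /andP[c_dec c0] := is_partition_conj s_dec.
have /andP[_ cc0] := is_partition_conj c_dec.
apply: (@eq_nth_notin _ 0) => // k; rewrite nth_conj_part //.
have lt_iff y : (y < count (ltn k) (conj_part s)) = (y < nth 0 s k).
  by rewrite lt_count_geq // nth_conj_part // lt_count_geq.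
move: lt_iff; move: (count _ _) (nth 0 s k) => a b lt_iff.
by have := lt_iff a; have := lt_iff b; lia.
Qed.

Lemma kappa_in_T (A : mat) : in_T (kappa A).
Proof.
have [sT T0 T_inc le_row] := semistandard_Pmat A.
have [_ _ T'_inc le_row'] := semistandard_Pmat (mtr A).
have s0 : 0 \notin shape (Pmat A).
  by apply: contra T0 => /mapP[c cT /esym/size0nil <-].
(* [shape] lists the column lengths, so the partition of row lengths is its conjugate. *)
rewrite kappaE; exists (conj_part (shape (Pmat A))); split; first exact: is_partition_conj.
  by split=> [||k h _]; [rewrite conj_partK | | exact: le_row].
by split=> [||k h _]; [rewrite conj_partK // shape_Pmat_mtr | | exact: le_row'].
Qed.

Lemma semistandard_sst nu T : is_partition nu -> is_sst nu T -> semistandard T.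
Proof.
move=> /andP[nu_dec nu0] [shT T_inc le_row].
have /andP[s_dec s0] := is_partition_conj nu_dec; rewrite -shT in s_dec s0.
split=> // [|k h h_lt].
  by apply: contra s0 => T0; apply/mapP; exists [::].
by apply: le_row => //; rewrite ltnNge; apply/negP => le; rewrite nth_default in h_lt.
Qed.

Lemma kappa_inj (A B : mat) : kappa A = kappa B -> A = B.
Proof. by rewrite !kappaE => -[eqP eqQ]; apply: Pmat_inj. Qed.

Lemma kappa_surj b : in_T b -> exists A, kappa A = b.
Proof.
case: b => S T [nu [nu_part S_sst T_sst]].
have /= S_ok := semistandard_sst nu_part S_sst; have /= T_ok := semistandard_sst nu_part T_sst.
have [/= shS _ _] := S_sst; have [/= shT _ _] := T_sst.
have [|A <- <-] := Pmat_surj S_ok T_ok; first by rewrite shS shT.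
by exists A; rewrite kappaE.
Qed.

(** * Operators of nonzero index *)

Lemma pairhD (x y : weight) i : pairh (x + y)%R i = (pairh x i + pairh y i)%R.
Proof. by rewrite /pairh !mcoeffD; case: ifP => _ /=; lia. Qed.

Lemma pairhN (x : weight) i : pairh (- x)%R i = (- pairh x i)%R.
Proof. by rewrite /pairh !mcoeffN; case: ifP => _ /=; lia. Qed.

Lemma eq_Zx (u v : Zx) : (u == v) = (val u == val v).
Proof. by []. Qed.

Lemma pairh_epsilon j i : pairh (epsilon j) i =
  (Posz (val j == val (ends i).1) - Posz (val j == val (ends i).2))%R.
Proof.
by rewrite /pairh 2!mcoeffU !eq_Zx !natz; case: ifP => _; rewrite addr0.
Qed.

Lemma eq_ints :
  (forall a b, (Posz a == Posz b) = (a == b)) * (forall a b, (Negz a == Negz b) = (a == b)) *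
  (forall a b, (Posz a == Negz b) = false) * (forall a b, (Negz a == Posz b) = false).
Proof. by []. Qed.

Lemma pairh_alpha i : pairh (alpha i) i = Posz 2.
Proof.
rewrite /alpha pairhD pairhN [X in (X + _)%R]pairh_epsilon [pairh _ _]pairh_epsilon.
by case: i => [[|k]|k] //=; rewrite !eq_ints; lia.
Qed.

Lemma zmax_Fin (a b c : int) : (a <= b -> c = b)%R -> (b < a -> c = a)%R ->
  zmax (Fin a) (Fin b) = Fin c.
Proof. by rewrite /zmax /=; case: (Order.TotalTheory.leP a b) => [_ -> | _ _ ->]. Qed.

Section LetterCrystal.
Variables (n : nat) (i : int) (wtl : nat -> weight) (epsl phil : int -> nat -> zbar).
Variables (etl ftl : int -> nat -> option nat).

(** A letter crystal of which only the index [i] is specified: it stands for [Bpos] at [n.+1] and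
    for [Bneg] at [Negz n] alike. *)
Definition letters := Precrystal (fun _ : nat => True) wtl epsl phil etl ftl.

Hypothesis epsE : forall k, epsl i k = Fin (Posz (k == n.+1)).
Hypothesis phiE : forall k, phil i k = Fin (Posz (k == n)).
Hypothesis etE : forall k, etl i k = if k == n.+1 then Some n else None.
Hypothesis ftE : forall k, ftl i k = if k == n then Some n.+1 else None.
Hypothesis wtE : forall k, pairh (wtl k) i = (Posz (k == n) - Posz (k == n.+1))%R.

Lemma word_epsE (w : seq nat) : word_eps (B := letters) i w = Fin (Posz (weps n w)).
Proof.
elim: w => //= b w IH; rewrite IH /= epsE wtE; apply: zmax_Fin;
  by have [->|_] := eqVneq b n; rewrite ?(ltn_eqF (ltnSn n)) /=; last case: (b == n.+1) => /=; lia.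
Qed.

Lemma word_phiE (w : seq nat) :
  word_phi (B := letters) i w = Fin (Posz (weps n w) + pairh (word_wt (B := letters) w) i)%R.
Proof.
elim: w => [|b w IH] /=; first by rewrite /pairh !mcoeff0 if_same.
rewrite IH pairhD phiE wtE; apply: zmax_Fin;
  by have [->|_] := eqVneq b n; rewrite ?(ltn_eqF (ltnSn n)) /=; last case: (b == n.+1) => /=; lia.
Qed.

Lemma word_ftE (w : seq nat) : word_ft (B := letters) i w = wft n w.
Proof.
elim: w => //= b w IH; rewrite IH word_epsE phiE ftE /zlt /=.
by have [->|bn] := eqVneq b n; case: (weps n w).
Qed.

Lemma word_etE (w : seq nat) : word_et (B := letters) i w = wet n w.
Proof.
elim: w => //= b w IH; rewrite IH word_epsE phiE etE /=.
have [->|bn] := eqVneq b n.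
  rewrite (ltn_eqF (ltnSn n)) /=; case E: (weps n w) => [|[|e]] //=.
by have := wet_None n w; case: (weps n w) => [|e] /=; case: (b == n.+1) => //= /eqP->.
Qed.

Hypothesis wt_shift : wtl n.+1 = (wtl n - alpha i)%R.

Lemma word_wt_wft (w v : seq nat) : wft n w = Some v ->
  word_wt (B := letters) v = (word_wt (B := letters) w - alpha i)%R.
Proof.
elim: w v => //= b w IH v; case: ifP => [/andP[/eqP-> _] [<-]|_] /=.
  by rewrite wt_shift addrAC.
by case: (wft n w) IH => //= v' /(_ _ erefl) IH [<-] /=; rewrite IH addrA.
Qed.

Lemma word_wt_sum (w : seq nat) : word_wt (B := letters) w = (\sum_(x <- w) wtl x)%R.
Proof. by elim: w => [|b w /= ->]; rewrite ?big_nil ?big_cons. Qed.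

End LetterCrystal.

Lemma Bpos_letters n :
  [/\ forall k, eps (Posz n.+1) (k : Bpos) = Fin (Posz (k == n.+1)),
      forall k, phi (Posz n.+1) (k : Bpos) = Fin (Posz (k == n)),
      forall k, et (Posz n.+1) (k : Bpos) = if k == n.+1 then Some n else None
    & forall k, ft (Posz n.+1) (k : Bpos) = if k == n then Some n.+1 else None].
Proof.
have ftE k : Bpos_ft (Posz n.+1) k = if k == n then Some n.+1 else None.
  by rewrite /Bpos_ft eqz_nat eqSS eq_sym; case: eqP => // ->.
have etE k : Bpos_et (Posz n.+1) k = if k == n.+1 then Some n else None.
  by case: k => //= k; rewrite eqz_nat !eqSS eq_sym; case: eqP => // ->.
by split=> k //=; rewrite ?ftE ?etE; case: eqP.
Qed.

Lemma Bneg_letters n :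
  [/\ forall k, eps (Negz n) (k : Bneg) = Fin (Posz (k == n.+1)),
      forall k, phi (Negz n) (k : Bneg) = Fin (Posz (k == n)),
      forall k, et (Negz n) (k : Bneg) = if k == n.+1 then Some n else None
    & forall k, ft (Negz n) (k : Bneg) = if k == n then Some n.+1 else None].
Proof.
have ftE k : Bneg_ft (Negz n) k = if k == n then Some n.+1 else None.
  by rewrite /Bneg_ft NegzE eqr_opp eqz_nat eqSS eq_sym; case: eqP => // ->.
have etE k : Bneg_et (Negz n) k = if k == n.+1 then Some n else None.
  by case: k => //= k; rewrite NegzE eqr_opp eqz_nat !eqSS eq_sym; case: eqP => // ->.
by split=> k //=; rewrite ?ftE ?etE; case: eqP.
Qed.

Lemma Bpos_wt n k : pairh (wt (k : Bpos)) (Posz n.+1) = (Posz (k == n) - Posz (k == n.+1))%R.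
Proof.
by rewrite [LHS]pairh_epsilon /= !eq_ints ?eqSS; lia.
Qed.

Lemma Bneg_wt n k : pairh (wt (k : Bneg)) (Negz n) = (Posz (k == n) - Posz (k == n.+1))%R.
Proof.
by rewrite [LHS]pairhN pairh_epsilon /= !eq_ints ?eqSS; lia.
Qed.

Lemma Bpos_wt_neg n k : pairh (wt (k : Bpos)) (Negz n) = 0%R.
Proof.
by rewrite [LHS]pairh_epsilon.
Qed.

Lemma Bneg_wt_pos n k : pairh (wt (k : Bneg)) (Posz n.+1) = 0%R.
Proof.
by rewrite [LHS]pairhN pairh_epsilon.
Qed.

Lemma Bpos_wt_shift n : wt (n.+1 : Bpos) = (wt (n : Bpos) - alpha (Posz n.+1))%R.
Proof. by rewrite /alpha opprB subrKC. Qed.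

Lemma Bneg_wt_shift n : wt (n.+1 : Bneg) = (wt (n : Bneg) - alpha (Negz n))%R.
Proof. by rewrite /alpha opprB addKr. Qed.

Section Dictionary.
Variables (n : nat) (w : seq nat).

Lemma Bpos_word_eps : word_eps (B := Bpos) (Posz n.+1) w = Fin (Posz (weps n w)).
Proof. by have [e p f g] := Bpos_letters n; apply: word_epsE => //; exact: Bpos_wt. Qed.
Lemma Bpos_word_phi : word_phi (B := Bpos) (Posz n.+1) w =
  Fin (Posz (weps n w) + pairh (word_wt (B := Bpos) w) (Posz n.+1))%R.
Proof. by have [e p f g] := Bpos_letters n; apply: word_phiE => //; exact: Bpos_wt. Qed.
Lemma Bpos_word_ft : word_ft (B := Bpos) (Posz n.+1) w = wft n w.
Proof. by have [e p f g] := Bpos_letters n; apply: word_ftE => //; exact: Bpos_wt. Qed.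
Lemma Bpos_word_et : word_et (B := Bpos) (Posz n.+1) w = wet n w.
Proof. by have [e p f g] := Bpos_letters n; apply: word_etE => //; exact: Bpos_wt. Qed.
Lemma Bneg_word_eps : word_eps (B := Bneg) (Negz n) w = Fin (Posz (weps n w)).
Proof. by have [e p f g] := Bneg_letters n; apply: word_epsE => //; exact: Bneg_wt. Qed.
Lemma Bneg_word_phi : word_phi (B := Bneg) (Negz n) w =
  Fin (Posz (weps n w) + pairh (word_wt (B := Bneg) w) (Negz n))%R.
Proof. by have [e p f g] := Bneg_letters n; apply: word_phiE => //; exact: Bneg_wt. Qed.
Lemma Bneg_word_ft : word_ft (B := Bneg) (Negz n) w = wft n w.
Proof. by have [e p f g] := Bneg_letters n; apply: word_ftE => //; exact: Bneg_wt. Qed.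
Lemma Bneg_word_et : word_et (B := Bneg) (Negz n) w = wet n w.
Proof. by have [e p f g] := Bneg_letters n; apply: word_etE => //; exact: Bneg_wt. Qed.
Lemma Bpos_word_wt : word_wt (B := Bpos) w = (\sum_(x <- w) wt (x : Bpos))%R.
Proof. exact: word_wt_sum. Qed.
Lemma Bneg_word_wt : word_wt (B := Bneg) w = (\sum_(x <- w) wt (x : Bneg))%R.
Proof. exact: word_wt_sum. Qed.
Lemma pairh_Bpos_neg : pairh (word_wt (B := Bpos) w) (Negz n) = 0%R.
Proof.
by elim: w => [|b v IH]; [rewrite /pairh !mcoeff0 | rewrite [word_wt _]/= pairhD IH Bpos_wt_neg].
Qed.
Lemma pairh_Bneg_pos : pairh (word_wt (B := Bneg) w) (Posz n.+1) = 0%R.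
Proof.
by elim: w => [|b v IH]; [rewrite /pairh !mcoeff0 | rewrite [word_wt _]/= pairhD IH Bneg_wt_pos].
Qed.
Lemma Bpos_word_wt_wft v : wft n w = Some v ->
  word_wt (B := Bpos) v = (word_wt (B := Bpos) w - alpha (Posz n.+1))%R.
Proof. by apply: word_wt_wft; exact: Bpos_wt_shift. Qed.
Lemma Bneg_word_wt_wft v : wft n w = Some v ->
  word_wt (B := Bneg) v = (word_wt (B := Bneg) w - alpha (Negz n))%R.
Proof. by apply: word_wt_wft; exact: Bneg_wt_shift. Qed.
End Dictionary.

(** The order could only fail if the letter before the raised [n], with the same partner, were also
    [n]; but then the operator would have acted on that letter. *)
Lemma sorted_wft n (w v w' : seq nat) : size w = size v -> sorted ij_le (zip w v) ->
  wft n w = Some w' -> sorted ij_le (zip w' v).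
Proof.
elim: w v w' => //= b w IH [|j v] // w' [sz] /= bw_inc.
case: ifP => [/andP[/eqP bn _] [<-]|b_w] /=.
  by case: (zip w v) bw_inc => //= [[x y] s] /andP[+ ->]; rewrite andbT bn /ij_le /=; lia.
case E: (wft n w) => [w1|] //= [<-] /=.
have := IH v w1 sz (path_sorted bw_inc) E.
case: w sz E b_w bw_inc {IH} => [|b1 w] //=; case: v => //= j1 v _.
case: ifP => [/andP[/eqP-> /eqP w0] [<-]|_].
  rewrite w0 !eqxx andbT /= => bn /andP[bj _] ->; rewrite andbT.
  by move: bj bn; rewrite /ij_le /=; lia.
by case: (wft n w) => //= w2 [<-] _ /andP[b_le _] /= ->; rewrite b_le.
Qed.

(** Dually, the letter after the lowered [n.+1] is not [n.+1], because [weps] vanishes on what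
    follows. *)
Lemma sorted_wet n (w v w' : seq nat) : size w = size v -> sorted ij_le (zip w v) ->
  wet n w = Some w' -> sorted ij_le (zip w' v).
Proof.
elim: w v w' => //= b w IH [|j v] // w' [sz] /= bw_inc.
case: ifP => [/andP[/eqP bn w0] [<-]|b_w] /=.
  case: w v sz w0 bw_inc {IH} => [|b1 w] [|j1 v] //= _ w0 /andP[+ ->]; rewrite andbT.
  have : b1 != n.+1.
    by apply: contraTneq w0 => ->; rewrite eqxx (gtn_eqF (ltnSn n)).
  by rewrite bn /ij_le /=; lia.
case: ifP => // w_gt; case E: (wet n w) => [w1|] //= [<-] /=.
have := IH v w1 sz (path_sorted bw_inc) E.
case: w sz E bw_inc {IH b_w w_gt} => [|b1 w] //=; case: v => //= j1 v _.
case: ifP => [/andP[/eqP-> _] [<-]|_].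
  by move=> /= /andP[bj _] ->; rewrite andbT; move: bj; rewrite /ij_le /=; lia.
case: ifP => // _; by case: (wet n w) => //= w2 [<-] /andP[b_le _] /= ->; rewrite b_le.
Qed.

Lemma size_wet n (w v : seq nat) : wet n w = Some v -> size v = size w.
Proof. by move=> /wet_wft/size_wft. Qed.

Definition row_ft n (A : mat) : option mat :=
  omap (fun u => mat_of u (word_j A)) (wft n (word_i A)).
Definition row_et n (A : mat) : option mat :=
  omap (fun u => mat_of u (word_j A)) (wet n (word_i A)).

Lemma wft_mat_of n (A : mat) u : wft n (word_i A) = Some u ->
  word_i (mat_of u (word_j A)) = u /\ word_j (mat_of u (word_j A)) = word_j A.
Proof.
move=> uE; have sz := size_word_ij A; apply: word_mat_of; first by rewrite (size_wft uE).
by apply: sorted_wft uE; rewrite ?zip_word_ij ?sorted_ij_pairs.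
Qed.

Lemma wet_mat_of n (A : mat) u : wet n (word_i A) = Some u ->
  word_i (mat_of u (word_j A)) = u /\ word_j (mat_of u (word_j A)) = word_j A.
Proof.
move=> uE; have sz := size_word_ij A; apply: word_mat_of; first by rewrite (size_wet uE).
by apply: sorted_wet uE; rewrite ?zip_word_ij ?sorted_ij_pairs.
Qed.

Lemma row_ft_et n (A B : mat) : row_ft n A = Some B <-> row_et n B = Some A.
Proof.
rewrite /row_ft /row_et; split.
  case E: wft => [u|] //= [<-]; have [-> ->] := wft_mat_of E.
  by have [-> _] := wft_wet E; rewrite /= mat_of_words.
case E: wet => [u|] //= [<-]; have [-> ->] := wet_mat_of E.
by rewrite (wet_wft E) /= mat_of_words.
Qed.

Lemma row_ft_words n (A B : mat) : row_ft n A = Some B ->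
  wft n (word_i A) = Some (word_i B) /\ word_j B = word_j A.
Proof. by rewrite /row_ft; case E: wft => [u|] //= [<-]; have [-> ->] := wft_mat_of E. Qed.

Lemma Pmat_mtr_row_ft n (A B : mat) : row_ft n A = Some B -> Pmat (mtr B) = Pmat (mtr A).
Proof.
move=> /row_ft_words[uE jE]; have [N [NA NB]] := bounded_ex A B.
apply: (@eq_nth_notin _ [::]); rewrite ?Ptab_nil // => k.
apply: eq_strict_col => [||q]; rewrite ?nth_strict ?strict_Ptab //.
rewrite (count_Pmat _ _ (bounded_mtr NB)) (count_Pmat _ _ (bounded_mtr NA)) !sh_mtr.
rewrite /sh (matword_suffix _ NB) (matword_suffix _ NA) jE.
have [->//|/shape_Ptab_wft sh] := drop_wft (count (ltn^~ q) (word_j A)) uE.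
by rewrite /height -!nth_Ptab -!nth_shape sh.
Qed.

Lemma tab_row_ft n (A : mat) : let T := Pmat A in
  omap (unreading T) (wft n (reading T)) = omap Pmat (row_ft n A).
Proof.
rewrite /= tft_reading_Ptab /row_ft; case E: wft => [u|] //=; congr Some.
by rewrite /Pmat; have [-> _] := wft_mat_of E.
Qed.

Lemma tab_row_et n (A : mat) : let T := Pmat A in
  omap (unreading T) (wet n (reading T)) = omap Pmat (row_et n A).
Proof.
rewrite /= tet_reading_Ptab /row_et; case E: wet => [u|] //=; congr Some.
by rewrite /Pmat; have [-> _] := wet_mat_of E.
Qed.

(** * The 0-signature *)

(** The outcome of all replacements in one structural pass, suited to induction on the list;
    [signature0E] identifies it with the iterated replacement. *)
Fixpoint cancel_all (s : seq sign) : seq sign :=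
  match s with
  | Plus :: s' => if close_plus (cancel_all s') is Some t then Dot :: t else Plus :: cancel_all s'
  | x :: s' => x :: cancel_all s'
  | [::] => [::]
  end.

Lemma close_plus_cancel_all s t :
  close_plus s = Some t -> close_plus (cancel_all s) = Some (cancel_all t).
Proof.
elim: s t => [|[] s IH] t //=; first by case=> <-.
by case: close_plus IH => //= t' /(_ _ erefl) -> [<-].
Qed.

Lemma cancel_all_cancel1 s : cancel_all (cancel1 s) = cancel_all s.
Proof.
elim: s => [|[] s IH] //=; rewrite ?IH //.
case E: (close_plus s) => [t|] /=; first by rewrite (close_plus_cancel_all E).
by rewrite IH.
Qed.

Lemma cancel_all_fix s : cancel1 s = s -> cancel_all s = s.
Proof.
elim: s => [|[] s IH] //=; last 2 first.
- by case=> /IH ->.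
- by case=> /IH ->.
by case E: (close_plus s) => [t|] // [sE]; rewrite IH // E.
Qed.

Lemma signature0E b : signature0 b = cancel_all (signature b).
Proof.
rewrite -(cancel_all_fix (cancel1_signature0 b)) /signature0.
by elim: (size _) => //= k; rewrite cancel_all_cancel1.
Qed.

Fixpoint minus_first (t : seq sign) : bool :=
  match t with
  | Plus :: t' => ~~ has is_minus t'
  | _ :: t' => minus_first t'
  | [::] => true
  end.

Lemma close_plus_None t : minus_first t -> close_plus t = None -> ~~ has is_minus t.
Proof. by elim: t => [|[] t IH] //= t_ok; case: close_plus IH => // /(_ t_ok erefl). Qed.

Lemma close_plus_no_minus t : ~~ has is_minus t -> close_plus t = None.
Proof. by elim: t => [|[] t IH] //= /IH ->. Qed.

Lemma close_plus_Some t t' : close_plus t = Some t' ->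
  [/\ minus_first t -> minus_first t' & count is_minus t = (count is_minus t').+1].
Proof.
elim: t t' => [|[] t IH] t' //=; first by case=> <-.
by case: close_plus IH => //= t1 /(_ _ erefl)[ok ->] [<-].
Qed.

Lemma minus_first_cancel_all s : minus_first (cancel_all s).
Proof.
elim: s => [|[] s IH] //=; case E: close_plus => [t|] /=.
  by have [/(_ IH)] := close_plus_Some E.
exact: close_plus_None E.
Qed.

(* A column is described by the pair telling whether, from sh(1, 1), it grows when the
   first row, resp. the first column, of the matrix is put back. *)
Definition col_step (z : bool * bool) (c : nat) : nat :=
  if z.1 && z.2 then c.+1 else if z.1 || z.2 then c else c.-1.

Definition col_sgn (z : bool * bool) (c : nat) : sign :=
  if z.1 && z.2 then Plus else if z.1 || z.2 then Dot else if 0 < c then Minus else Plus.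

(** Such a column has sign + and hands on the carry 0; by [count_minus_gen] no - then survives
    further left, so nothing cancels this +. *)
Definition free (z : bool * bool) (c : nat) : bool := ~~ (z.1 || z.2) && (c == 0).

Fixpoint gen (l : seq (bool * bool)) (c : nat) : seq sign :=
  if l is z :: l' then col_sgn z c :: gen l' (col_step z c) else [::].

Fixpoint free_pos (l : seq (bool * bool)) (c : nat) : nat :=
  if l is z :: l' then if free z c then 0 else (free_pos l' (col_step z c)).+1 else 0.

(** A - lowers the carry by one and a + outside the free columns raises it by one: each - is either
    cancelled by such a + or paid for by the initial carry. *)
Lemma count_minus_gen l c : count is_minus (cancel_all (gen l c)) <= c.
Proof.
elim: l c => [|[x y] l IH] c //; rewrite /gen -/gen /col_sgn /col_step.
case: x; case: y => /=; rewrite ?add0n ?IH //.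
  have := IH c.+1; case E: close_plus => [t|] /=.
    by have [_ ->] := close_plus_Some E; rewrite add0n.
  by have /negbTE := close_plus_None (minus_first_cancel_all _) E;
    rewrite has_count add0n; case: count.
case: c => [|c] /=; last by rewrite add1n ltnS IH.
have := IH 0; rewrite leqn0 => /eqP c0.
have no_minus : ~~ has is_minus (cancel_all (gen l 0)) by rewrite has_count c0.
by rewrite (close_plus_no_minus no_minus) /= c0.
Qed.

Lemma close_plus_cat pre c : ~~ has is_plus pre -> count is_minus pre = c.+1 ->
  exists pre', [/\ forall s, close_plus (pre ++ s) = Some (pre' ++ s), size pre' = size pre,
                   ~~ has is_plus pre' & count is_minus pre' = c].
Proof.
elim: pre => [|[] pre IH] //=.
  by move=> no_plus [cnt]; exists (Dot :: pre); rewrite /= cnt.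
rewrite add0n => no_plus /(IH no_plus)[pre' [closeE sz no_plus' cnt]].
by exists (Dot :: pre'); split=> [s| | |] //=; rewrite ?closeE ?sz.
Qed.

(** Started with [c] and with [c.+1], the signs agree up to the first free column. There the carries
    are 0 and 1, the signs + and -, and both outgoing carries are 0, so the signs agree again
    afterwards. *)
Lemma gen_spec l c : free_pos l c < size l -> exists pre,
  [/\ size pre = free_pos l c, ~~ has is_plus pre, count is_minus pre = c,
      exists2 s, cancel_all (gen l c) = pre ++ Plus :: s & ~~ has is_minus s
    & exists2 s, cancel_all (gen l c.+1) = pre ++ Minus :: s & ~~ has is_minus s].
Proof.
have no_minus l' : ~~ has is_minus (cancel_all (gen l' 0)).
  by rewrite has_count -leqNgt count_minus_gen.
elim: l c => [|[x y] l IH] c //; rewrite /free_pos -/free_pos /gen -/gen /free /col_sgn /col_step.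
case: x; case: y; rewrite /= ?ltnS.
- move=> /IH[pre [sz no_plus cnt [s1 E1 m1] [s2 E2 m2]]].
  have [pre' [closeE sz' no_plus' cnt']] := close_plus_cat no_plus cnt.
  exists (Dot :: pre'); rewrite /= sz' sz E1 E2 !closeE; split=> //; first by exists s1.
  by exists s2.
- move=> /IH[pre [sz no_plus cnt [s1 E1 m1] [s2 E2 m2]]].
  by exists (Dot :: pre); rewrite /= sz E1 E2; split=> //; [exists s1 | exists s2].
- move=> /IH[pre [sz no_plus cnt [s1 E1 m1] [s2 E2 m2]]].
  by exists (Dot :: pre); rewrite /= sz E1 E2; split=> //; [exists s1 | exists s2].
case: c => [|c] /=.
  move=> _; exists [::]; split=> //; last by exists (cancel_all (gen l 0)).
  by exists (cancel_all (gen l 0)); rewrite // (close_plus_no_minus (no_minus l)).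
move=> /IH[pre [sz no_plus cnt [s1 E1 m1] [s2 E2 m2]]].
by exists (Minus :: pre); rewrite /= sz E1 E2 cnt; split=> //; [exists s1 | exists s2].
Qed.

(** * The effect of raising the initial carry by one *)

Section Columns.
Variables (r l m : nat -> nat).

Definition kind (k : nat) : bool * bool := (r k < l k, r k < m k).

Lemma gen_iota a j N : gen [seq kind k | k <- iota j N] (carry r l m a j) =
  [seq col_sgn (kind k) (carry r l m a k) | k <- iota j N].
Proof. by elim: N j => //= N IH j; rewrite -IH. Qed.

Lemma free_pos_iota a j N : free_pos [seq kind k | k <- iota j N] (carry r l m a j) =
  find (fun k => free (kind k) (carry r l m a k)) (iota j N).
Proof. by elim: N j => //= N IH j; rewrite -IH. Qed.

Variables (a K : nat).
Hypothesis K_free : free (kind K) (carry r l m a K).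
Hypothesis K_first : forall k, k < K -> ~~ free (kind k) (carry r l m a k).

Lemma find_free N : K < N -> find (fun k => free (kind k) (carry r l m a k)) (iota 0 N) = K.
Proof.
move=> KN; have -> : iota 0 N = iota 0 K ++ K :: iota K.+1 (N - K.+1).
  by rewrite -[K :: _]/(iota K (N - K.+1).+1) -iotaD; congr iota; lia.
rewrite find_cat; case: ifP => [/hasP[k]|_]; last by rewrite /= K_free size_iota addn0.
by rewrite mem_iota => /andP[_ /K_first/negPf->].
Qed.

(** The two carries differ by one up to column [K], where the larger one loses its unit while the
    smaller one is already 0. *)
Lemma carry_incr k : carry r l m a.+1 k = carry r l m a k + (k <= K).
Proof.
elim: k => [|k IH]; first by rewrite addn1.
move: IH; rewrite /= => ->; have := @K_first k; have := K_free.
rewrite /free /kind /carry_step /=; case: (ltngtP k K) => [kK _ /(_ isT)|Kk _ _|->].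
- by move: (carry _ _ _ _ k) => c; case: (r k < l k); case: (r k < m k) => //=; case: c; lia.
- by rewrite !addn0.
by case: (r K < l K) => //=; case: (r K < m K) => //= /eqP->.
Qed.

Lemma local_height_incr k : local_height (r k) (l k) (m k) (carry r l m a.+1 k) =
  local_height (r k) (l k) (m k) (carry r l m a k) + (k == K).
Proof.
rewrite carry_incr; have := @K_first k; have := K_free; rewrite /free /kind /local_height /=.
case: (ltngtP k K) => [kK _ /(_ isT)|Kk _ _|->].
- case: (r k < l k); case: (r k < m k) => //=; rewrite ?addn0 //.
  by case: (carry _ _ _ _ k).
- by rewrite !addn0.
by case: (r K < l K) => //=; case: (r K < m K) => //= /eqP-> _; rewrite !addn1.
Qed.

End Columns.

(** A top letter 0 is present exactly when deleting the letters 0 shortens the column, so comparing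
    [m] and [l] with the full height gives the sign. If [r], [l] and [m] agree, the carry tells
    whether the full column is longer. *)
Lemma col_signE (s t : seq nat) (r l m c : nat) : sorted ltn s -> sorted ltn t ->
  r <= l <= r.+1 -> r <= m <= r.+1 ->
  size s = local_height r l m c -> size t = local_height r l m c ->
  count (leq 1) s = m -> count (leq 1) t = l -> col_sign s t = col_sgn (r < l, r < m) c.
Proof.
have head_count (x : nat) u : sorted ltn (x :: u) ->
    count (leq 1) (x :: u) = (size u) + (0 < x).
  move=> x_u; rewrite /= addnC; congr addn; apply/eqP; rewrite -all_count.
  by apply: sub_all (order_path_min ltn_trans x_u) => y /=; lia.
move=> s_inc t_inc rl rm; rewrite /col_sign /col_sgn /local_height.
case: s s_inc => [|x s] s_inc /=.
  by move=> + _ _ _; case: (r < l); case: (r < m) => //=; case: c.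
case: t t_inc => [|y t] t_inc /=; first by move=> <-.
have := head_count x s s_inc; have := head_count y t t_inc; rewrite /= => -> -> sE tE mE lE.
have {tE} tE : size t = size s by apply: succn_inj; rewrite tE.
move: sE mE lE rl rm; rewrite tE; clear; move: (size s) => z.
case: x => [|x]; case: y => [|y]; rewrite /= ?addn0 ?addn1;
  (case: (ltnP r l) => ?; case: (ltnP r m) => ? /=);
  case: c => [|c] /= *; first [by [] | exfalso; lia].
Qed.

Lemma filter_nth (X : eqType) (x0 : X) (s t : seq X) : x0 \notin t ->
  nth x0 s =1 nth x0 t -> [seq x <- s | x != x0] = t.
Proof.
elim: s t => [|x s IH] [|y t] //=.
- by rewrite inE negb_or => /andP[/eqP y0 _] /(_ 0) /= x0y; case: y0.
- move=> t0 eqs; have /= -> := eqs 0; rewrite eqxx /=; apply: IH => // k.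
  by have /= -> := eqs k.+1; rewrite nth_nil.
rewrite inE negb_or => /andP[y0 t0] eqs.
by have /= -> := eqs 0; rewrite eq_sym y0; congr cons; apply: IH => // k; exact: (eqs k.+1).
Qed.

Lemma upd_colE g K (T T' : tableau nat) : [::] \notin T' ->
  (forall k, nth [::] T' k = if k == K then g (nth [::] T K) else nth [::] T k) ->
  upd_col g K T = T'.
Proof.
by move=> T'0 eqT; apply: filter_nth => // k; rewrite nth_set_nth /= eqT.
Qed.

Lemma eq_matword_ge F G n p q : (forall i j, p <= i -> q <= j -> F i j = G i j) ->
  matword F n p q = matword G n p q.
Proof.
move=> FG; congr flatten; apply/eq_in_map => j; rewrite mem_rev mem_iota => /andP[qj _].
congr flatten; apply/eq_in_map => i; rewrite mem_iota => /andP[pi _].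
by rewrite FG.
Qed.

Definition incr00 (A : mat) : mat := [fsfun A with (0, 0) |-> (A (0, 0)).+1].
Definition decr00 (A : mat) : mat := [fsfun A with (0, 0) |-> (A (0, 0)).-1].

Lemma incr00E (A : mat) p : incr00 A p = A p + (p == (0, 0)).
Proof. by rewrite fsfun_withE; case: eqP => [->|_]; rewrite ?addn1 ?addn0. Qed.

Lemma decr00E (A : mat) p : decr00 A p = A p - (p == (0, 0)).
Proof. by rewrite fsfun_withE; case: eqP => [->|_]; rewrite ?subn1 ?subn0. Qed.

Lemma incr00K : cancel incr00 decr00.
Proof. by move=> A; apply/fsfunP => p; rewrite decr00E incr00E addnK. Qed.

Lemma decr00K (A : mat) : A (0, 0) != 0 -> incr00 (decr00 A) = A.
Proof.
move=> A0; apply/fsfunP => p; rewrite incr00E decr00E subnK //.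
by case: eqP => // ->; rewrite lt0n.
Qed.

Section ZeroOperators.
Variables (A : mat).

(** Raising the entry (0, 0) affects no shape of the diagram other than sh(0, 0): the same [r], [l],
    [m] serve both matrices and only the initial carry differs. [K] is the first free column. *)
Lemma kappa_incr00_columns : exists r l m : nat -> nat, exists K,
  [/\ free (kind r l m K) (carry r l m (A (0, 0)) K),
      forall k, k < K -> ~~ free (kind r l m k) (carry r l m (A (0, 0)) k),
      K <= size (Pmat A),
      (forall B, B = A \/ B = incr00 A ->
         signature (kappa B) = gen [seq kind r l m k | k <- iota 0 (size (Pmat B)).+1] (B (0, 0)))
    & (forall k, nth [::] (Pmat (incr00 A)) k =
         if k == K then 0 :: nth [::] (Pmat A) K else nth [::] (Pmat A) k) /\
      (forall k, nth [::] (Pmat (mtr (incr00 A))) k =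
         if k == K then 0 :: nth [::] (Pmat (mtr A)) K else nth [::] (Pmat (mtr A)) k)].
Proof.
(* The successor makes [n] positive, as the local rule at the corner (0, 0) requires. *)
have [n0 [nA0 nB0]] := bounded_ex A (incr00 A); pose n := n0.+1.
have bound C : bounded n0 C -> bounded n C.
  by move=> nC i j ij; apply: nC; move: ij; rewrite /n; lia.
have {nA0} nA := bound _ nA0; have {nB0} nB := bound _ nB0.
pose r := sh (entries A) n 1 1; pose l := sh (entries A) n 0 1; pose m := sh (entries A) n 1 0.
pose nu a k := local_height (r k) (l k) (m k) (carry r l m a k).
have shE p q : 0 < p + q -> sh (entries (incr00 A)) n p q =1 sh (entries A) n p q.
  move=> pq k; rewrite /sh; congr height; apply: eq_matword_ge => i j pi qj.
  by rewrite /entries incr00E xpair_eqE; move: pi qj pq; case: eqP; case: eqP; lia.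
have nuA k : sh (entries A) n 0 0 k = nu (A (0, 0)) k by rewrite sh_local.
have nuB k : sh (entries (incr00 A)) n 0 0 k = nu (A (0, 0)).+1 k.
  rewrite sh_local // [entries _ 0 0]incr00E addn1 !shE //.
  by congr local_height; apply: eq_carry => j; rewrite shE.
have rl k : r k <= l k <= (r k).+1 by rewrite /l sh_strip.
have rm k : r k <= m k <= (r k).+1 by rewrite /m /r (sh_tr _ _ 1 0) (sh_tr _ _ 1 1) sh_strip.
have sizeP C k : bounded n C -> size (nth [::] (Pmat C) k) = sh (entries C) n 0 0 k.
  by move=> nC; rewrite -count0 (count_Pmat _ _ nC).
have sizeQ C k : bounded n C -> size (nth [::] (Pmat (mtr C)) k) = sh (entries C) n 0 0 k.
  by move=> nC; rewrite -count0 (count_Pmat _ _ (bounded_mtr nC)) sh_mtr.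
pose fr k := free (kind r l m k) (carry r l m (A (0, 0)) k).
(* The first column beyond the shape has height 0 and is therefore free. *)
have fr_ex : exists k, fr k && (k <= size (Pmat A)).
  exists (size (Pmat A)); rewrite leqnn andbT /fr.
  have := nuA (size (Pmat A)); rewrite -sizeP // nth_default // /nu /local_height /free /kind /=.
  by case: (_ < l _); case: (_ < m _) => //=; case: carry.
pose K := ex_minn fr_ex; exists r, l, m, K.
have [K_fr K_le] : fr K /\ K <= size (Pmat A) by rewrite /K; case: ex_minnP => k /andP[].
have K_first k : k < K -> ~~ fr k.
  rewrite /K; case: ex_minnP => k0 /andP[_ k0_le] k0_min k_lt; apply/negP => fr_k.
  by have := k0_min k; rewrite fr_k (leq_trans (ltnW k_lt) k0_le) leqNgt k_lt => /(_ isT).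
split=> //.
- move=> B BA; have nB' : bounded n B by case: BA => ->.
  have nuE k : sh (entries B) n 0 0 k = nu (B (0, 0)) k.
    by case: BA => ->; rewrite ?nuB // incr00E addn1.
  rewrite (gen_iota r l m (B (0, 0)) 0) /signature kappaE; apply: eq_map => k /=.
  have [_ _ S_inc _] := semistandard_Pmat B; have [_ _ T_inc _] := semistandard_Pmat (mtr B).
  apply: (col_signE _ _ (rl k) (rm k)); rewrite ?nth_strict //.
  - by rewrite sizeP // nuE.
  - by rewrite sizeQ // nuE.
  - by rewrite (count_Pmat _ _ nB'); case: BA => ->; rewrite ?shE.
  - by rewrite (count_Pmat _ _ (bounded_mtr nB')) sh_mtr; case: BA => ->; rewrite ?shE.
have nu_incr k : nu (A (0, 0)).+1 k = nu (A (0, 0)) k + (k == K) by exact: local_height_incr.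
(* At [K] the four shapes have equal heights: neither tableau has a letter 0 in this column, and the
   cell added there must hold one. *)
have nuK : nu (A (0, 0)) K = r K /\ r K = m K /\ r K = l K.
  move: K_fr; rewrite /fr /free /kind /nu /local_height /=; have := rl K; have := rm K.
  by case: (ltnP (r K) (l K)) => //= ?; case: (ltnP (r K) (m K)) => //= ? ? ? /eqP->;
    split=> //; lia.
have col_incr (T T' : tableau nat) : all (sorted ltn) T -> all (sorted ltn) T' ->
    (forall k, size (nth [::] T k) = nu (A (0, 0)) k) ->
    (forall k, size (nth [::] T' k) = nu (A (0, 0)).+1 k) ->
    (forall p k, count (leq p.+1) (nth [::] T' k) = count (leq p.+1) (nth [::] T k)) ->
    count (leq 1) (nth [::] T K) = nu (A (0, 0)) K ->
    forall k, nth [::] T' k = if k == K then 0 :: nth [::] T K else nth [::] T k.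
  move=> T_inc T'_inc szT szT' cnt cntK k; have := nu_incr k; case: eqP => [->|_] nuE.
    have T_pos : all (ltn 0) (nth [::] T K) by rewrite all_count cntK szT.
    apply: eq_strict_col => [||[|p]]; rewrite ?nth_strict //.
    - by rewrite /= path_sortedE ?T_pos ?nth_strict //; exact: ltn_trans.
    - by rewrite !count0 szT' nuE /= szT addn1.
  apply: eq_strict_col => [||[|p]]; rewrite ?nth_strict // ?cnt //.
  by rewrite !count0 szT szT' nuE addn0.
have [_ _ S_inc _] := semistandard_Pmat A; have [_ _ T_inc _] := semistandard_Pmat (mtr A).
have [_ _ S'_inc _] := semistandard_Pmat (incr00 A).
have [_ _ T'_inc _] := semistandard_Pmat (mtr (incr00 A)).
have [nuKr [rKm rKl]] := nuK.
split; apply: col_incr => // [k|k|p k|]; rewrite ?sizeQ ?sizeP //.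
- by rewrite (count_Pmat _ _ nA) (count_Pmat _ _ nB) shE.
- by rewrite (count_Pmat _ _ nA) nuKr rKm.
- by rewrite (count_Pmat _ _ (bounded_mtr nA)) (count_Pmat _ _ (bounded_mtr nB));
     rewrite !sh_mtr shE // addn1.
- by rewrite (count_Pmat _ _ (bounded_mtr nA)) sh_mtr nuKr rKl.
Qed.

(** By [gen_spec] the rightmost + for [A] and the leftmost - for the raised matrix stand at the same
    column [K], the only one in which the tableaux differ. *)
Lemma kappa_incr00 :
  [/\ bitab_f0 (kappa A) = Some (kappa (incr00 A)),
      bitab_e0 (kappa (incr00 A)) = Some (kappa A)
    & A (0, 0) = 0 -> bitab_e0 (kappa A) = None].
Proof.
have [r [l [m [K [K_free K_first K_le sigE [S_incr T_incr]]]]]] := kappa_incr00_columns.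
pose a := A (0, 0); pose kinds N := [seq kind r l m k | k <- iota 0 N].
have posE N : K < N -> free_pos (kinds N) a = K.
  by move=> KN; rewrite (free_pos_iota r l m a 0) (find_free K_free K_first).
have spec' N (KN : K < N) : free_pos (kinds N) a < size (kinds N).
  by rewrite posE // size_map size_iota.
split.
- have [pre [sz no_plus _ [s E _] _]] := gen_spec (spec' _ (K_le : K < (size (Pmat A)).+1)).
  rewrite /bitab_f0 signature0E (sigE A (or_introl erefl)) -/a -/(kinds _) E !kappaE.
  rewrite has_cat /= orbT find_cat (negPf no_plus) /= addn0 sz posE //=.
  by congr (Some (_, _)); apply: upd_colE; rewrite ?Ptab_nil // => k; rewrite ?S_incr ?T_incr.
(* Column [K] of the larger tableau contains the added 0, so it lies within the shape. *)
- have K_le' : K < (size (Pmat (incr00 A))).+1.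
    by rewrite ltnS leqNgt; apply/negP => lt; have := S_incr K; rewrite eqxx nth_default // ltnW.
  have [pre [sz no_plus _ _ [s E no_minus]]] := gen_spec (spec' _ K_le').
  rewrite /bitab_e0 signature0E (sigE _ (or_intror erefl)) incr00E eqxx addn1.
  rewrite -/a -/(kinds _) E !kappaE.
  rewrite has_cat /= orbT rev_cat rev_cons cat_rcons find_cat has_rev (negPf no_minus) /= addn0.
  rewrite size_rev size_cat /= addnS /= addnK sz posE //=.
  congr (Some (_, _)); apply: upd_colE; rewrite ?Ptab_nil // => k; rewrite ?S_incr ?T_incr ?eqxx;
    by case: eqP => // ->.
move=> a0; rewrite /bitab_e0 signature0E (sigE A (or_introl erefl)) a0.
by rewrite has_count ltnNge count_minus_gen.
Qed.
End ZeroOperators.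

(** * The isomorphism *)

Definition pair_wt (p : nat * nat) : weight := (- epsilon (zneg p.1) + epsilon (zpos p.2))%R.

Lemma mat_wt_pairs (A : mat) : mat_wt A = (\sum_(p <- pairs A) pair_wt p)%R.
Proof.
rewrite /mat_wt /pairs big_flatten big_map; apply: eq_bigr => p _.
by rewrite big_nseq iter_addr_0.
Qed.

Lemma sum_pair_wt (s : seq (nat * nat)) : (\sum_(p <- s) pair_wt p =
  word_wt (B := Bneg) (unzip1 s) + word_wt (B := Bpos) (unzip2 s))%R.
Proof. by rewrite big_split Bneg_word_wt Bpos_word_wt !big_map. Qed.

Lemma mat_wt_ij (A : mat) :
  mat_wt A = (word_wt (B := Bneg) (word_i A) + word_wt (B := Bpos) (word_j A))%R.
Proof.
by rewrite mat_wt_pairs -sum_pair_wt; apply: perm_big; rewrite perm_sym perm_sort.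
Qed.

Lemma mat_wt_kl (A : mat) :
  mat_wt A = (word_wt (B := Bneg) (word_k A) + word_wt (B := Bpos) (word_l A))%R.
Proof.
by rewrite mat_wt_pairs -sum_pair_wt; apply: perm_big; rewrite perm_sym perm_sort.
Qed.

Lemma mat_wt_il (A : mat) :
  mat_wt A = (word_wt (B := Bneg) (word_i A) + word_wt (B := Bpos) (word_l A))%R.
Proof.
rewrite mat_wt_ij; congr (_ + _)%R; rewrite !Bpos_word_wt; apply: perm_big.
by apply: perm_map; rewrite perm_sort perm_sym perm_sort.
Qed.

Lemma mat_wt_incr00 (A : mat) : mat_wt (incr00 A) = (mat_wt A - alpha 0)%R.
Proof.
rewrite !mat_wt_pairs (perm_big ((0, 0) :: pairs A)) /=; last first.
  apply/allP => p _ /=; rewrite count_pairs incr00E.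
  by rewrite count_pairs addnC [p == _]eq_sym.
by rewrite big_cons addrC; congr (_ + _)%R; rewrite /alpha opprB addrC.
Qed.

Lemma mat_ft_neg n (A : mat) : mat_ft (Negz n) A = row_ft n A.
Proof. by rewrite /mat_ft /= Bneg_word_ft. Qed.

Lemma mat_et_neg n (A : mat) : mat_et (Negz n) A = row_et n A.
Proof. by rewrite /mat_et /= Bneg_word_et. Qed.

Lemma mat_ft_pos n (A : mat) : mat_ft (Posz n.+1) A = omap mtr (row_ft n (mtr A)).
Proof.
rewrite /mat_ft /= Bpos_word_ft /row_ft word_i_mtr word_j_mtr.
by case: wft => //= u; rewrite mtr_mat_of.
Qed.

Lemma mat_et_pos n (A : mat) : mat_et (Posz n.+1) A = omap mtr (row_et n (mtr A)).
Proof.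
rewrite /mat_et /= Bpos_word_et /row_et word_i_mtr word_j_mtr.
by case: wet => //= u; rewrite mtr_mat_of.
Qed.

Lemma mat_ft_zero (A : mat) : mat_ft 0 A = Some (incr00 A).
Proof. by []. Qed.

Lemma mat_et_zero (A : mat) : mat_et 0 A = if A (0, 0) == 0 then None else Some (decr00 A).
Proof. by []. Qed.

Lemma mat_eps_neg n (A : mat) : mat_eps (Negz n) A = Fin (Posz (weps n (word_i A))).
Proof. by rewrite /mat_eps /= Bneg_word_eps. Qed.

Lemma mat_eps_pos n (A : mat) : mat_eps (Posz n.+1) A = Fin (Posz (weps n (word_l A))).
Proof. by rewrite /mat_eps /= Bpos_word_eps. Qed.

(** The word acted on yields only its own part of the weight; the weight of the other alphabet pairs
    to 0 with [h_i]. *)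
Lemma mat_phiE i (A : mat) : mat_phi i A = zadd (mat_eps i A) (pairh (mat_wt A) i).
Proof.
case: i => [[|n]|n] //.
  by rewrite mat_eps_pos /mat_phi /= Bpos_word_phi mat_wt_il pairhD pairh_Bneg_pos add0r.
by rewrite mat_eps_neg /mat_phi /= Bneg_word_phi mat_wt_il pairhD pairh_Bpos_neg addr0.
Qed.

Lemma mat_ft_et i (A B : mat) : mat_ft i A = Some B <-> Some A = mat_et i B.
Proof.
case: i => [[|n]|n].
- rewrite mat_ft_zero mat_et_zero; split=> [[<-]|].
    by rewrite incr00E eqxx addn1 /= incr00K.
  by case: eqP => // /eqP B0 [->]; rewrite decr00K.
- rewrite mat_ft_pos mat_et_pos; split.
    case E: row_ft => [C|] //= [<-]; rewrite mtrK.
    by have/row_ft_et-> := E; rewrite /= mtrK.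
  case E: row_et => [C|] //= [->]; rewrite mtrK.
  by have/row_ft_et-> := E; rewrite /= mtrK.
rewrite mat_ft_neg mat_et_neg; split; first by move/row_ft_et->.
by move=> /esym/row_ft_et.
Qed.

Lemma mat_ft_shift i (A B : mat) : mat_ft i A = Some B ->
  mat_eps i B = zadd (mat_eps i A) 1%R /\ mat_wt B = (mat_wt A - alpha i)%R.
Proof.
case: i => [[|n]|n].
- rewrite mat_ft_zero => -[<-]; rewrite mat_wt_incr00; split=> //.
  by rewrite /mat_eps /= incr00E eqxx PoszD.
- rewrite mat_ft_pos; case E: row_ft => [C|] //= [<-]; have [wE jE] := row_ft_words E.
  rewrite !mat_eps_pos -!word_i_mtr mtrK; have [_ ->] := wft_wet wE.
  rewrite !mat_wt_kl -!word_i_mtr -!word_j_mtr mtrK jE (Bpos_word_wt_wft wE) addrA.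
  by split=> //; rewrite /= -addn1 PoszD.
rewrite mat_ft_neg => E; have [wE jE] := row_ft_words E.
rewrite !mat_eps_neg; have [_ ->] := wft_wet wE.
rewrite !mat_wt_ij jE (Bneg_word_wt_wft wE) addrAC.
by split=> //; rewrite /= -addn1 PoszD.
Qed.

Lemma zadd0 x : zadd x 0 = x. Proof. by case: x => //= a; rewrite addr0. Qed.

Lemma zaddA x a b : zadd (zadd x a) b = zadd x (a + b)%R.
Proof. by case: x => //= c; rewrite addrA. Qed.

Lemma crysM_crystal : is_crystal gl_infty crysM.
Proof.
have ft_shiftM i (A B : mat) : mat_ft i A = Some B ->
    [/\ mat_eps i B = zadd (mat_eps i A) 1, mat_phi i B = zadd (mat_phi i A) (- 1)
      & mat_wt B = mat_wt A - alpha i]%R.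
  move=> /mat_ft_shift[epsB wtB]; split=> //; rewrite !mat_phiE epsB wtB !zaddA.
  by congr zadd; rewrite pairhD pairhN pairh_alpha; lia.
split=> //.
- by move=> i A _ _; exact: mat_phiE.
- move=> i A B _ _ /esym/mat_ft_et/ft_shiftM[epsA phiA wtA].
  rewrite /= epsA phiA wtA !zaddA; split; last by rewrite subrK.
    by rewrite subrr zadd0.
  by rewrite addNr zadd0.
- by move=> i A B _ _; exact: ft_shiftM.
- by move=> i A B _ _ _; exact: mat_ft_et.
move=> i A _ _ /=; rewrite mat_phiE; case: i => [[|n]|n] //.
  by rewrite mat_eps_pos.
by rewrite mat_eps_neg.
Qed.

(** A bijection that preserves all structure maps carries the axioms along, so they need not be
    verified on signatures and row readings. *)
Lemma crystal_transfer (J : pred int) (B1 B2 : precrystal) (f : B1 -> B2) :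
  is_crystal J B1 ->
  (forall b, cmem b -> cmem (f b)) ->
  (forall b b', cmem b -> cmem b' -> f b = f b' -> b = b') ->
  (forall c, cmem c -> exists2 b, cmem b & f b = c) ->
  (forall b, cmem b -> wt (f b) = wt b) ->
  (forall i b, J i -> cmem b -> eps i (f b) = eps i b) ->
  (forall i b, J i -> cmem b -> phi i (f b) = phi i b) ->
  (forall i b, J i -> cmem b -> et i (f b) = omap f (et i b)) ->
  (forall i b, J i -> cmem b -> ft i (f b) = omap f (ft i b)) ->
  crystal_iso J f.
Proof.
case=> etc ftc phi_e ets fts fe pinf f_mem f_inj f_surj f_wt f_eps f_phi f_et f_ft; split=> //.
split.
- move=> i b b' Ji /f_surj[a ma <-]; rewrite f_et //; case E: et => [a'|] //= [<-].
  by apply: f_mem; apply: etc E.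
- move=> i b b' Ji /f_surj[a ma <-]; rewrite f_ft //; case E: ft => [a'|] //= [<-].
  by apply: f_mem; apply: ftc E.
- by move=> i b Ji /f_surj[a ma <-]; rewrite f_phi // f_eps // f_wt // phi_e.
- move=> i b b' Ji /f_surj[a ma <-]; rewrite f_et //; case E: et => [a'|] //= [<-].
  have ma' := etc _ _ _ Ji ma E.
  by rewrite !f_eps // !f_phi // !f_wt //; apply: ets E.
- move=> i b b' Ji /f_surj[a ma <-]; rewrite f_ft //; case E: ft => [a'|] //= [<-].
  have ma' := ftc _ _ _ Ji ma E.
  by rewrite !f_eps // !f_phi // !f_wt //; apply: fts E.
- move=> i b b' Ji /f_surj[a ma <-] /f_surj[a' ma' <-]; rewrite f_ft // f_et //; split.
    case E: ft => [x|] //= [/f_inj xE]; have mx := ftc _ _ _ Ji ma E.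
    by move: E; rewrite xE // => /fe-/(_ Ji ma ma') <-.
  case E: et => [x|] //= [/f_inj xE]; have mx := etc _ _ _ Ji ma' E.
  by move: E; rewrite -xE // => /esym/fe-/(_ Ji ma ma') ->.
move=> i b Ji /f_surj[a ma <-]; rewrite f_phi // => /pinf-/(_ Ji ma)[e0 f0].
by rewrite f_et // f_ft // e0 f0.
Qed.

Lemma perm_reading (w : seq nat) : perm_eq (reading (Ptab (rev w))) w.
Proof.
have H := perm_Ptab (rev (reading (Ptab (rev w)))).
rewrite Ptab_reading in H; last exact: semistandard_Ptab.
have rev_eq (v : seq nat) : perm_eq (rev v) v by rewrite perm_rev.
apply: perm_trans (perm_trans (perm_Ptab _) (rev_eq w)).
by rewrite perm_sym; apply: perm_trans H (rev_eq _).
Qed.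

Lemma kappa_wt (A : mat) : bitab_wt (kappa A) = mat_wt A.
Proof.
rewrite mat_wt_il /bitab_wt /tab_wt /=; congr (_ + _)%R.
  by rewrite !Bneg_word_wt; apply: perm_big; exact: perm_reading.
by rewrite !Bpos_word_wt; apply: perm_big; exact: perm_reading.
Qed.

Lemma kappa_e0 (A : mat) : bitab_e0 (kappa A) = omap kappa (mat_et 0 A).
Proof.
rewrite mat_et_zero; case: eqP => [A0|/eqP A0] /=.
  by have [_ _ ->] := kappa_incr00 A.
by have [_ + _] := kappa_incr00 (decr00 A); rewrite decr00K.
Qed.

(** On images of [kappa] the operator lowers the entry (0, 0), hence can be iterated exactly as
    often as that entry allows. *)
Lemma kappa_e0n k (A : mat) : isSome (bitab_e0n k (kappa A)) = (k <= A (0, 0)).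
Proof.
have -> : bitab_e0n k (kappa A) = if k <= A (0, 0) then Some (kappa (iter k decr00 A)) else None.
  have val00 j : iter j decr00 A (0, 0) = A (0, 0) - j.
    by elim: j => [|j IH] /=; rewrite ?subn0 // decr00E eqxx IH -subnDA addn1.
  elim: k => // k IH; rewrite /bitab_e0n iterS -/(bitab_e0n k _) IH.
  case: (leqP k (A (0, 0))) => [le|lt] /=; last by rewrite leqNgt ltnW // ltnS ltnW.
  by rewrite kappa_e0 mat_et_zero val00 subn_eq0; case: ltnP.
by case: ifP.
Qed.

Lemma kappa_eps0 (A : mat) : bitab_eps0 (kappa A) = A (0, 0).
Proof.
have A_lt : A (0, 0) < (size (flatten (kappa A).1)).+1.
  by apply: bitab_e0n_lt; rewrite kappa_e0n.
apply/eqP; rewrite eqn_leq; apply/andP; split.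
  by apply/bigmax_leqP => k; rewrite kappa_e0n.
by apply: (leq_bigmax_cond (Ordinal A_lt)); rewrite kappa_e0n.
Qed.

Lemma kappa_eps i (A : mat) : bitab_eps i (kappa A) = mat_eps i A.
Proof.
case: i => [[|n]|n]; first by rewrite /bitab_eps /mat_eps /= kappa_eps0.
  by rewrite mat_eps_pos /bitab_eps /tab_eps /= Bpos_word_eps weps_reading.
by rewrite mat_eps_neg /bitab_eps /tab_eps /= Bneg_word_eps weps_reading.
Qed.

Lemma bitab_phiE i b : bitab_phi i b = zadd (bitab_eps i b) (pairh (bitab_wt b) i).
Proof.
case: i => [[|n]|n] //; rewrite /bitab_phi /bitab_eps /tab_phi /tab_eps /bitab_wt /tab_wt /=.
  by rewrite Bpos_word_phi Bpos_word_eps pairhD pairh_Bneg_pos add0r.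
by rewrite Bneg_word_phi Bneg_word_eps pairhD pairh_Bpos_neg addr0.
Qed.

Lemma kappa_ft i (A : mat) : bitab_ft i (kappa A) = omap kappa (mat_ft i A).
Proof.
case: i => [[|n]|n].
- by have [f0E _ _] := kappa_incr00 A; rewrite mat_ft_zero /= -f0E.
- rewrite mat_ft_pos kappaE /bitab_ft /tab_ft /= Bpos_word_ft tab_row_ft.
  case E: row_ft => [B|] //=; rewrite kappaE mtrK.
  by have := Pmat_mtr_row_ft E; rewrite mtrK => ->.
rewrite mat_ft_neg kappaE /bitab_ft /tab_ft /= Bneg_word_ft tab_row_ft.
by case E: row_ft => [B|] //=; rewrite kappaE (Pmat_mtr_row_ft E).
Qed.

Lemma kappa_et i (A : mat) : bitab_et i (kappa A) = omap kappa (mat_et i A).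
Proof.
case: i => [[|n]|n]; first exact: kappa_e0.
  rewrite mat_et_pos kappaE /bitab_et /tab_et /= Bpos_word_et tab_row_et.
  case E: row_et => [B|] //=; rewrite kappaE mtrK.
  by have := Pmat_mtr_row_ft (proj2 (row_ft_et _ _ _) E); rewrite mtrK => ->.
rewrite mat_et_neg kappaE /bitab_et /tab_et /= Bneg_word_et tab_row_et.
by case E: row_et => [B|] //=; rewrite kappaE (Pmat_mtr_row_ft (proj2 (row_ft_et _ _ _) E)).
Qed.

Theorem theorem3p6 : @crystal_iso gl_infty crysM crysT kappa.
Proof.
apply: crystal_transfer => [|A _|A B _ _|b /kappa_surj[A <-]|A _|i A _ _|i A _ _|i A _ _|i A _ _].
- exact: crysM_crystal.
- exact: kappa_in_T.
- exact: kappa_inj.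
- by exists A.
- exact: kappa_wt.
- exact: kappa_eps.
- by rewrite /= bitab_phiE mat_phiE kappa_eps kappa_wt.
- exact: kappa_et.
- exact: kappa_ft.
Qed.
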